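(* Let $X$ be an operator-stable-like (OSL) process on $\mathbb{R}^d$ with admissible exponent $E$, where $a>1/2$ is the constant with $a\le\lambda(x)$ for all $x\in\mathbb{R}^d$. Then: (i) There exists $C>0$ such that for all $x\in\mathbb{R}^d$, $t>0$ and $0<R\le1$: $$\mathbb{P}^x\Big(\sup_{s\le t}\|X_s-x\|>R\Big)\le C\,t\,R^{-1/a}.$$ (ii) If in addition there is a constant $b<\infty$ with $\Lambda(x)\le b$ for all $x\in\mathbb{R}^d$, then there exists $C>0$ such that for all $x\in\mathbb{R}^d$, $t>0$ and $R\ge1$: $$\mathbb{P}^x\Big(\sup_{s\le t}\|X_s-x\|>R\Big)\le C\,t\,R^{-1/b}.$$ The same upper bounds hold for $\mathbb{P}^x(T\le t)$, where $T=T^x_R:=\inf\{t>0:\|X_t-x\|>R\}$.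
   Context: $\|\cdot\|$ is the Euclidean norm on $\mathbb{R}^d$ and also the induced operator norm on $d\times d$ matrices; $\langle\cdot,\cdot\rangle$ is the Euclidean scalar product; $\mathbb{S}^{d-1}$ is the Euclidean unit sphere. For $r>0$ and a matrix $A$, $r^A:=\exp(A\ln r)$. $\lambda(x)$ and $\Lambda(x)$ denote the minimum and the maximum of the real parts of the eigenvalues of $E(x)$. Admissible exponent: a map $E:\mathbb{R}^d\to GL(\mathbb{R}^d)$ such that (E1) $E(x)$ is symmetric for every $x$; (E2) there is a constant $C>0$ with $\|E(y)-E(x)\|\le C\|y-x\|$ for all $x,y$; (E3) there is a constant $a>1/2$ with $a\le\lambda(x)$ for all $x$. Operator-stable-like L\'evy measure: $\phi_x(A)=\int_{\mathbb{S}^{d-1}}\int_0^\infty1_A(r^{E(x)}\theta)\frac{dr}{r^2}\sigma(d\theta)$ for Borel $A\subset\mathbb{R}^d\setminus\{0\}$, where $\sigma$ is a finite measure on $\mathbb{S}^{d-1}$; here $\sigma$ is assumed symmetric, $\sigma(A)=\sigma(-A)$. OSL process: a (conservative) It\^o process $(X,\mathbb{P}^x)_{x\in\mathbb{R}^d}$ with symbol $q(x,\xi)=\int_{\mathbb{R}^d\setminus\{0\}}(1-\cos\langle y,\xi\rangle)\,\phi_x(dy)$. That is: $X$ is a c\`adl\`ag universal Markov process ($\mathbb{P}^x(X_0=x)=1$, $x\mapsto\mathbb{P}^x(A)$ measurable, simple Markov property $\mathbb{P}^x(X_{s+t}\in B\mid\mathcal{F}^X_s)=\mathbb{P}^{X_s}(X_t\in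 B)$) which under every $\mathbb{P}^x$ is a semimartingale with characteristics, relative to the truncation function $y1_{\{\|y\|<1\}}$, $B=0$, $C=0$, $\nu(ds,dy)=\phi_{X_s}(dy)\,ds$. *)

(* Defs.v *)
From HB Require Import structures.
From mathcomp Require Import all_boot all_order all_algebra.
From mathcomp Require Import complex.
From mathcomp Require Import all_classical all_reals all_analysis.
From mathcomp Require Import measurable_realfun.

Set Implicit Arguments.
Unset Strict Implicit.
Unset Printing Implicit Defensive.

Import Order.TTheory GRing.Theory Num.Theory.
Import numFieldNormedType.Exports.

Local Open Scope classical_set_scope.
Local Open Scope ring_scope.

Section borel_matrix.
Context {R : realType} {m n : nat}.

Let mx_borel : set (set 'M[R]_(m, n)) := <<s @open 'M[R]_(m, n) >>.

Let mx_borel0 : mx_borel set0.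
Proof. exact: sigma_algebra0. Qed.

Let mx_borelC A : mx_borel A -> mx_borel (~` A).
Proof. exact: sigma_algebraC. Qed.

Let mx_borel_bigcup (A : (set 'M[R]_(m, n))^nat) :
  (forall i, mx_borel (A i)) -> mx_borel (\bigcup_i A i).
Proof. exact: sigma_algebra_bigcup. Qed.

HB.instance Definition _ := @isMeasurable.Build
  (sigma_display (@open 'M[R]_(m, n))) 'M[R]_(m, n) mx_borel
  mx_borel0 mx_borelC mx_borel_bigcup.

End borel_matrix.

Section euclidean.
Context {R : realType} {d : nat}.
Implicit Types (v : 'cV[R]_d) (A : 'M[R]_d).

(* The library norm `|v| on matrices is the maximum norm. *)
Definition enorm v : R := Num.sqrt (\sum_i v i 0 ^+ 2).

Definition opnorm A : R := sup [set enorm (A *m v) | v in [set v | enorm v <= 1]].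

Definition usphere : set 'cV[R]_d := [set v | enorm v = 1].

Definition mxexp A : 'M[R]_d := limn (series (fun k => (k`!%:R)^-1 *: A ^+ k)).

Definition mxpow (r : R) A : 'M[R]_d := mxexp (ln r *: A).

(* Real parts of the complex eigenvalues; a square matrix and its transpose have
   the same ones, so it does not matter that [eigenvalue] uses row vectors. *)
Definition eigen_re A : set R :=
  [set complex.Re z | z in [set z : complex R |
    eigenvalue (map_mx (fun c : R => real_complex R c) A) z]].

Definition lambda_min A : R := inf (eigen_re A).

Definition lambda_max A : R := sup (eigen_re A).

End euclidean.

Record admissible_exponent {R : realType} {d : nat}
    (E : 'cV[R]_d -> 'M[R]_d) (a : R) : Prop := {
  admissible_GL : forall x, E x \in unitmx ;
  admissible_sym : forall x, (E x)^T = E x ;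
  admissible_lipschitz : exists2 C : R, 0 < C &
    forall x y, opnorm (E y - E x) <= C * enorm (y - x) ;
  admissible_gt : 2^-1 < a ;
  admissible_lambda : forall x, a <= lambda_min (E x) }.

(* A finite measure on the unit sphere, seen as a measure on R^d. *)
Record spherical_symmetric {R : realType} {d : nat}
    (sigma : {finite_measure set 'cV[R]_d -> \bar R}) : Prop := {
  spherical_support : sigma (~` usphere) = 0%E ;
  spherical_sym : forall A, measurable A -> sigma A = sigma (-%R @` A) }.

(* The Levy measure phi_x. It is not packaged as a {measure ...}: the library
   integral is defined for any set function. It gives no mass to {0}, since
   r^(E x) is invertible. *)
Definition osl_levy {R : realType} {d : nat} (E : 'cV[R]_d -> 'M[R]_d)
    (sigma : {finite_measure set 'cV[R]_d -> \bar R}) (x : 'cV[R]_d)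
    (A : set 'cV[R]_d) : \bar R :=
  (\int[sigma]_(theta in usphere)
    \int[lebesgue_measure]_(r in `]0%R, +oo[)
      (\1_A (mxpow r (E x) *m theta) / r ^+ 2)%:E)%E.

Section paths.
Context {R : realType} {V : ptopologicalType}.
Implicit Types f : R -> V.

Definition cadlag f :=
  (forall t, 0 <= t -> f u @[u --> t^'+] --> f t) /\
  (forall t, 0 < t -> cvg (f u @[u --> t^'-])).

Definition continuous_path f := {within `[0, +oo[, continuous f}.

End paths.

Definition jump {R : realType} {d : nat} (f : R -> 'cV[R]_d) (s : R) : 'cV[R]_d :=
  f s - lim (f u @[u --> s^'-]).

Section filtrations.
Context {R : realType} {disp : measure_display} {T : measurableType disp}.

Definition natural_filtration {dV} {V : measurableType dV} (X : R -> T -> V)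
    (t : R) : set (set T) :=
  <<s \bigcup_(u in `[0, t]) preimage_set_system setT (X u) measurable >>.

(* Right-continuous P-augmentation of F. The null sets added are those of the
   sigma-algebra of T, which is not itself completed, so that every process
   adapted to the augmentation is measurable. *)
Definition augmentation (P : probability T R) (F : R -> set (set T)) (t : R) :
    set (set T) :=
  [set A | measurable A /\
    exists2 B, (\bigcap_(u in `]t, +oo[) F u) B & P (A `+` B) = 0%E].

End filtrations.

(* Processes are indexed by R; only their values at times t >= 0 matter. The
   terminology is that of the general theory of processes, for a filtration that
   is right-continuous and contains the null sets. *)
Section general_theory.
Context {R : realType} {disp : measure_display} {T : measurableType disp}.
Variables (P : probability T R) (F : R -> set (set T)).
Implicit Types (Y M N V : R -> T -> R) (tau : T -> \bar R) (A : set T).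

Definition adapted Y := forall t, 0 <= t ->
  forall B : set R, measurable B -> F t (Y t @^-1` B).

Definition stopping_time tau :=
  (forall w, (0 <= tau w)%E) /\
  (forall t : R, 0 <= t -> F t [set w | (tau w <= t%:E)%E]).

Definition stopped Y tau : R -> T -> R :=
  fun t w => Y (fine (Order.min t%:E (tau w))) w.

Definition martingale M :=
  [/\ adapted M,
      forall w, cadlag (M ^~ w),
      forall t, 0 <= t -> P.-integrable setT (EFin \o M t) &
      forall (s t : R) A, 0 <= s -> s <= t -> F s A ->
        (\int[P]_(w in A) (M t w)%:E = \int[P]_(w in A) (M s w)%:E)%E].

Definition local_martingale M :=
  [/\ adapted M,
      forall w, cadlag (M ^~ w) &
      exists tau : nat -> T -> \bar R,
        [/\ forall k, stopping_time (tau k),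
            forall w, nondecreasing_seq (tau ^~ w),
            {ae P, forall w, tau k w @[k --> \oo] --> +oo%E} &
            forall k, martingale (stopped M (tau k))]].

Definition continuous_local_martingale M :=
  local_martingale M /\ forall w, continuous_path (M ^~ w).

Definition purely_discontinuous M :=
  [/\ local_martingale M,
      forall w, M 0 w = 0 &
      forall N, continuous_local_martingale N ->
        local_martingale (fun t w => M t w * N t w)].

Definition finite_variation V :=
  [/\ adapted V,
      forall w, cadlag (V ^~ w) &
      forall w t, 0 <= t -> bounded_variation 0 t (V ^~ w)].

Definition semimartingale Y :=
  [/\ adapted Y, forall w, cadlag (Y ^~ w) &
      exists M V, [/\ local_martingale M, finite_variation V,
        forall w, M 0 w = 0, forall w, V 0 w = 0 &
        {ae P, forall w, forall t, 0 <= t -> Y t w = Y 0 w + M t w + V t w}]].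

Definition times_ge0 : set (R * T) := [set u | 0 <= u.1].

Definition predictable_sets : set (set (R * T)) :=
  <<s times_ge0,
    [set [set 0] `*` A | A in F 0] `|`
    [set D | exists (s t : R) A, [/\ 0 <= s, s <= t, F s A & D = `]s, t] `*` A]] >>.

Definition predictable {dV} {V : measurableType dV} (Y : R -> T -> V) :=
  forall B, measurable B ->
    predictable_sets (times_ge0 `&` [set u | B (Y u.1 u.2)]).

(* Measurability of W : (t, w, y) |-> W t w y with respect to the product of the
   predictable sigma-algebra and the sigma-algebra of V. *)
Definition predictable_field {dV} {V : measurableType dV}
    (W : R -> T -> V -> \bar R) :=
  forall B : set (\bar R), measurable B ->
    <<s times_ge0 `*` setT,
      [set D `*` A | D in predictable_sets & A in measurable] >>
    ((times_ge0 `*` setT) `&` [set u | B (W u.1.1 u.1.2 u.2)]).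

End general_theory.

Section characteristics.
Context {R : realType} {disp : measure_display} {T : measurableType disp}.
Context {d : nat}.
Variables (P : probability T R) (F : R -> set (set T)).
Implicit Types (X B : R -> T -> 'cV[R]_d) (h : 'cV[R]_d -> 'cV[R]_d).

(* X(h), that is X without the part of its jumps not retained by h. For a cadlag
   path, and h the identity near 0, the sum over ]0, t] has finite support. *)
Definition truncated X h : R -> T -> 'cV[R]_d := fun t w =>
  X t w - \sum_(s \in `]0, t]) (jump (X ^~ w) s - h (jump (X ^~ w) s)).

(* nu(w; ds, dy) = K s w (dy) ds on ]0, +oo[ x (R^d \ {0}) is the compensator of
   the random measure associated with the jumps of X: it is a predictable random
   measure that gives the same expectation to all predictable W >= 0. *)
Definition jump_compensator X (K : R -> T -> set 'cV[R]_d -> \bar R) :=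
  forall W : R -> T -> 'cV[R]_d -> \bar R,
    (forall t w y, (0 <= W t w y)%E) -> predictable_field F W ->
    predictable F (fun t w =>
      \int[lebesgue_measure]_(s in `]0%R, t])
        \int[K s w]_(y in [set y | y != 0%R]) W s w y)%E /\
    (\int[P]_w (\esum_(s in [set s : R | 0 < s /\ jump (X ^~ w) s != 0]%R)
        W s w (jump (X ^~ w) s)) =
     \int[P]_w \int[lebesgue_measure]_(s in `]0%R, +oo[)
        \int[K s w]_(y in [set y | y != 0%R]) W s w y)%E.

(* X is a semimartingale with characteristics (B, C, K s w (dy) ds) relative to
   the truncation function h: B is the predictable finite variation part of the
   special semimartingale X(h), and C is the bracket of the continuous
   martingale part Xc of X. *)
Definition has_characteristics X h B (C : R -> T -> 'M[R]_d)
    (K : R -> T -> set 'cV[R]_d -> \bar R) :=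
  (forall i, semimartingale P F (fun t w => X t w i 0)) /\
  (forall i, [/\ finite_variation F (fun t w => B t w i 0),
    predictable F (fun t w => B t w i 0), forall w, B 0 w i 0 = 0 &
    local_martingale P F
      (fun t w => truncated X h t w i 0 - X 0 w i 0 - B t w i 0)]) /\
  (exists Xc : R -> T -> 'cV[R]_d,
    (forall i, [/\ continuous_local_martingale P F (fun t w => Xc t w i 0),
      forall w, Xc 0 w i 0 = 0 &
      purely_discontinuous P F (fun t w =>
        truncated X h t w i 0 - X 0 w i 0 - B t w i 0 - Xc t w i 0)]) /\
    (forall i j, [/\ finite_variation F (fun t w => C t w i j),
      forall w, continuous_path (fun t => C t w i j),
      forall w, C 0 w i j = 0 &
      local_martingale P F
        (fun t w => Xc t w i 0 * Xc t w j 0 - C t w i j)])) /\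
  jump_compensator X K.

End characteristics.

Definition cond_prob {R : realType} {disp} {T : measurableType disp}
    (P : probability T R) (G : set (set T)) (B : set T) (f : T -> \bar R) :=
  (forall U, measurable U -> G (f @^-1` U)) /\
  (forall A, G A -> (\int[P]_(w in A) f w = P (A `&` B))%E).

Section osl.
Context {R : realType} {disp : measure_display} {T : measurableType disp}.
Context {d : nat}.
Implicit Types (X : R -> T -> 'cV[R]_d) (P : 'cV[R]_d -> probability T R).

Record universal_markov X P : Prop := {
  um_measurable : forall t, 0 <= t -> measurable_fun setT (X t) ;
  um_cadlag : forall w, cadlag (X ^~ w) ;
  um_start : forall x, P x [set w | X 0 w = x] = 1%E ;
  um_kernel : forall A, measurable A -> measurable_fun setT (fun x => P x A) ;
  um_markov : forall x s t, 0 <= s -> 0 <= t -> forall B, measurable B ->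
    cond_prob (P x) (natural_filtration X s) (X (s + t) @^-1` B)
      (fun w => P (X s w) (X t @^-1` B)) }.

Definition unit_truncation (y : 'cV[R]_d) : 'cV[R]_d :=
  if enorm y < 1 then y else 0.

Definition osl_process (E : 'cV[R]_d -> 'M[R]_d)
    (sigma : {finite_measure set 'cV[R]_d -> \bar R}) X P : Prop :=
  universal_markov X P /\
  forall x, has_characteristics (P x) (augmentation (P x) (natural_filtration X))
    X unit_truncation (fun _ _ => 0) (fun _ _ => 0)
    (fun s w => osl_levy E sigma (X s w)).

Definition sup_dist X (x : 'cV[R]_d) (t : R) (w : T) : \bar R :=
  ereal_sup [set (enorm (X s w - x))%:E | s in `[0, t]].

Definition exit_time X (x : 'cV[R]_d) (r : R) (w : T) : \bar R :=
  ereal_inf [set t%:E | t in [set t | 0 < t /\ r < enorm (X t w - x)]].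

End osl.

(* Main.v *)
Require Import Defs.
From HB Require Import structures.
From mathcomp Require Import all_boot all_order all_algebra.
From mathcomp Require Import complex.
From mathcomp Require Import all_classical all_reals all_analysis.
From mathcomp Require Import measurable_realfun.
From mathcomp Require Import ring lra.

(** The process has no drift and no Gaussian part, and the measures phi_x are
symmetric, so X is the sum of its jumps, without compensation. To leave the ball
of radius r before time t, either X makes a jump of norm at least r/2, or some
coordinate of the sum of its jumps below r exceeds r/d. The first event has
probability at most t sup_x phi_x(|y| > r/4), because phi_(X_s)(dy) ds compensates
the jumps. The sum of the jumps below r is a martingale, since its positive and
negative parts have the same compensator, and its variance is at most
t sup_x int min(|y|, r)^2 phi_x(dy); Chebyshev's inequality at the first exit
bounds the second event. This is [exit_probability], which rests on
[jump_process_mean], [jump_process_variance] and [jump_process_maximal].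

Both quantities are controlled by tails. If theta is a unit vector and E(x) is
symmetric with spectrum in [a, b], then |s^E(x) theta| > r forces
s >= r^(1/g), with g = a when r <= 1 and g = b when r >= 1. The integral of
1/s^2 from r^(1/g) on is r^(-1/g), whence phi_x(|y| > r) <= sigma(S) r^(-1/g)
([osl_tail]). Halving r multiplies this by at most 2^(1/a), which is less than 4
because a > 1/2; so the truncated second moment, a sum of r^2 4^(-k) times the
tails at r 2^(-k-1), is at most a multiple of r^2 r^(-1/g)
([tail_levy_square]).

The delicate point is that the characteristics do make X the sum of its jumps.
Fix a coordinate and let J_n be the sum of its jumps, cut off continuously at a
level e_n that decreases fast. The maximal inequality and the Borel-Cantelli
lemma make J_n converge locally uniformly outside a null set ([good_limit]), so
L = X - X_0 - lim J_n - Xc is continuous ([continuous_drift]): the jump of X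
that J_n misses has size at most e_n. Let M be the purely discontinuous
martingale of the canonical decomposition, and N_n the compensated-by-symmetry
sum of the jumps smaller than 1, cut off near 0. Then L = M - N_n - Q_n with Q_n
small in mean. Hence L is a local martingale, and after localisation E L^2 is
the limit of E[L M] - E[L N_n], where both terms vanish: the first by the
definition of pure discontinuity, the second because N_n has bounded variation
([product_expect0]). So L = 0. Finally Xc = 0, as its bracket C is zero.

The martingale theory behind this (optional stopping, exit levels, predictable
left limits) is carried out for cadlag processes in a filtration satisfying the
usual conditions. The expectations that involve the compensator bear on
functions of the path whose measurability is not clear; the integral of such a
function is a lower integral, and only the properties of lower integrals are
used. *)

Set Implicit Arguments.
Unset Strict Implicit.
Unset Printing Implicit Defensive.

Import Order.TTheory GRing.Theory Num.Theory.
Import numFieldNormedType.Exports.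

Local Open Scope classical_set_scope.
Local Open Scope ring_scope.

(** * Lower integrals *)

Section lower_integral.
Import HBNNSimple.
Context d (T : measurableType d) (R : realType) (mu : {measure set T -> \bar R}).
Local Open Scope ereal_scope.

Lemma ge0_le_lower_integral (D : set T) (f g : T -> \bar R) :
  (forall x, D x -> 0 <= f x) -> (forall x, D x -> f x <= g x) ->
  \int[mu]_(x in D) f x <= \int[mu]_(x in D) g x.
Proof.
move=> f0 fg; rewrite !ge0_integralE//; last first.
  by move=> x Dx; rewrite (le_trans (f0 _ Dx))// fg.
apply: ge_ereal_sup => _ [h hf <-]; apply: ereal_sup_ubound; exists h => //= x.
rewrite (le_trans (hf x))//; rewrite /patch; case: ifPn => // /[!inE] Dx.
exact: fg.
Qed.

(** Without measurability the integral of a nonnegative function is the supremum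
    of the integrals of the simple functions below it, and such simple functions
    can be added; this gives one half of additivity. *)
Lemma ge0_lower_integralD_ge (D : set T) (f g : T -> \bar R) :
  (forall x, D x -> 0 <= f x) -> (forall x, D x -> 0 <= g x) ->
  \int[mu]_(x in D) f x + \int[mu]_(x in D) g x
    <= \int[mu]_(x in D) (f x + g x).
Proof.
move=> f0 g0; rewrite [X in X + _]ge0_integralE// [X in _ + X]ge0_integralE//.
have fg0 x : D x -> 0 <= f x + g x by move=> Dx; rewrite adde_ge0 ?f0 ?g0.
set I := \int[mu]_(x in D) (f x + g x).
have I0 : 0 <= I by exact: integral_ge0.
have nn0 (h : T -> \bar R) : (forall x, D x -> 0 <= h x) ->
    0 <= ereal_sup [set sintegral mu (k : {nnsfun T >-> R}) |
      k in [set k : {nnsfun T >-> R} | forall x, (k x)%:E <= (h \_ D) x]].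
  by move=> h0; rewrite -ge0_integralE//; exact: integral_ge0.
have [->|Ifin] := eqVneq I +oo; first by rewrite leey.
have key (h k : {nnsfun T >-> R}) : (forall x, (h x)%:E <= (f \_ D) x) ->
    (forall x, (k x)%:E <= (g \_ D) x) -> sintegral mu h + sintegral mu k <= I.
  move=> hf kg; rewrite -sintegralD /I ge0_integralE//.
  apply: ereal_sup_ubound; exists (h \+ k)%R => //= x; rewrite EFinD.
  have := leeD (hf x) (kg x); rewrite /patch; case: ifPn => //.
  by rewrite adde0.
have Ifn : I \is a fin_num by rewrite fin_real// ltNye_eq ltey Ifin andbT; case: (I) I0.
have sfin (h : {nnsfun T >-> R}) :
    sintegral mu h <= I -> sintegral mu h \is a fin_num.
  move=> hI; rewrite ge0_fin_numE ?sintegral_ge0//.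
  by rewrite (le_lt_trans hI)// ltey.
rewrite -leeBrDr; last first.
  rewrite ge0_fin_numE ?nn0//; apply: le_lt_trans (_ : I < +oo); last by rewrite ltey.
  apply: ge_ereal_sup => _ [h hf <-].
  by have := @key (nnsfun0) h; rewrite sintegral0 add0e; apply => // x;
    rewrite /patch; case: ifPn => // /[!inE] /f0.
apply: ge_ereal_sup => _ [h hf <-].
have hI : sintegral mu h <= I.
  by have := @key h (nnsfun0); rewrite sintegral0 adde0; apply => // x;
    rewrite /patch; case: ifPn => // /[!inE] /g0.
rewrite leeBrDl; last first.
  rewrite ge0_fin_numE ?nn0//; apply: le_lt_trans (_ : I < +oo); last by rewrite ltey.
  apply: ge_ereal_sup => _ [k kf <-].
  by have := @key (nnsfun0) k; rewrite sintegral0 add0e; apply => // x;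
    rewrite /patch; case: ifPn => // /[!inE] /f0.
rewrite -leeBrDr ?sfin//; apply: ge_ereal_sup => _ [k kg <-].
by rewrite leeBrDr ?sfin// addeC; exact: key.
Qed.

(** Full additivity holds as soon as one summand is measurable and finite: the
    remaining inequality is obtained by subtracting that summand from a simple
    function below the sum. This is how an identity between lower integrals is
    turned into an estimate for a measurable term. *)
Lemma ge0_lower_integralDr (D : set T) (f : T -> \bar R) (g : T -> R) :
  measurable D -> measurable_fun D g ->
  (forall x, D x -> 0 <= f x) -> (forall x, D x -> (0 <= g x)%R) ->
  \int[mu]_(x in D) (f x + (g x)%:E)
    = \int[mu]_(x in D) f x + \int[mu]_(x in D) (g x)%:E.
Proof.
move=> mD mg f0 g0; apply/eqP; rewrite eq_le; apply/andP; split; last first.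
  by apply: ge0_lower_integralD_ge => // x Dx; rewrite lee_fin g0.
have fg0 x : D x -> 0 <= f x + (g x)%:E.
  by move=> Dx; rewrite adde_ge0 ?f0// lee_fin g0.
rewrite ge0_integralE//; apply: ge_ereal_sup => _ [h hfg <-].
pose k x := Num.max 0%R (h x - g x)%R.
have mk : measurable_fun D (EFin \o k).
  apply/measurable_EFinP; apply: measurable_maxr => //.
  by apply: measurable_funB => //; exact: measurable_funTS.
have k0 x : D x -> 0 <= (k x)%:E by move=> _; rewrite lee_fin le_max lexx.
apply: (@le_trans _ _ (\int[mu]_(x in D) (k x)%:E + \int[mu]_(x in D) (g x)%:E)).
  rewrite -ge0_integralD//; [|exact/measurable_EFinP].
  have -> : sintegral mu h = \int[mu]_(x in D) (h x)%:E.
    rewrite -integralT_nnsfun [RHS]integral_mkcond; apply: eq_integral => x _.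
    rewrite /patch; case: ifPn => // xD; have := hfg x; rewrite patchN//.
    by rewrite lee_fin => hx; congr EFin; apply/eqP; rewrite eq_le hx/=.
  apply: ge0_le_lower_integral => x Dx; first by rewrite lee_fin.
  by rewrite -EFinD lee_fin -lerBlDr le_max lexx orbT.
rewrite leeD2r//; apply: ge0_le_lower_integral => // x Dx.
have := hfg x; rewrite patchT ?inE// => hx.
rewrite EFin_max ge_max f0//=.
by move: hx; case: (f x) (f0 _ Dx) => [r| |]// _; rewrite ?leey// -EFinD !lee_fin lerBlDr.
Qed.

End lower_integral.

(** * Sequences and coverings on the real line *)

Section real_line.
Context {R : realType}.

Lemma half_power_small (eps : R) : 0 < eps -> exists N, forall n, (N <= n)%N -> 2^-1 ^+ n < eps.
Proof.
move=> eps0; have := @cvg_geometric R 1 2^-1; rewrite ger0_norm// invf_lt1// ltr1n => /(_ isT).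
move=> /cvgrPdist_lt/(_ eps eps0)[N _ H]; exists N => n Nn.
by have := H n Nn; rewrite sub0r normrN /= mul1r ger0_norm// exprn_ge0.
Qed.

Lemma natr_above (t : R) : exists N, forall n, (N <= n)%N -> t <= n%:R.
Proof.
exists (Num.truncn (Num.max 0 t)).+1 => n Nn.
have h : t < (Num.truncn (Num.max 0 t)).+1%:R.
  by apply: le_lt_trans (truncnS_gt _); rewrite le_max lexx orbT.
by rewrite (le_trans (ltW h))// ler_nat.
Qed.

Lemma geometric_le (z : R) n : 0 <= z -> z < 1 -> \sum_(0 <= k < n) z ^+ k <= (1 - z)^-1.
Proof.
move=> z0 z1; have h : 0 < 1 - z by rewrite subr_gt0.
rewrite -[leRHS]mul1r ler_pdivlMr// mulrC big_mkord -opprB mulNr -subrX1 opprB.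
by rewrite gerBl exprn_ge0.
Qed.

(** Used to conclude that a quantity vanishes when it is bounded by errors that
    decrease with n. *)
Lemma half_power_le0 (x c : R) : (forall n, x <= 2^-1 ^+ n * c) -> x <= 0.
Proof.
move=> h; rewrite leNgt; apply/negP => x0.
have c1 : 0 < `|c| + 1 by rewrite ltr_wpDl.
have [N HN] := half_power_small (divr_gt0 x0 c1).
have := HN N (leqnn _); rewrite ltr_pdivlMr// => h1.
have := h N; have := ler_norm c; have : 0 <= (2^-1 : R) ^+ N by rewrite exprn_ge0.
by move: h1; set q := _ ^+ _; nra.
Qed.

(** The bound is uniform in the sequence; applied at each time of a path it gives
    locally uniform convergence. *)
Lemma dyadic_cauchy (u : nat -> R) N :
  (forall n, (N <= n)%N -> `|u n.+1 - u n| <= 2^-1 ^+ n) ->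
  u n @[n --> \oo] --> limn u /\
  forall n, (N <= n)%N -> `|limn u - u n| <= 2 * 2^-1 ^+ n.
Proof.
move=> uN; have h0 n : 0 < (2^-1 : R) ^+ n by rewrite exprn_gt0.
have tel n k : (N <= n)%N -> `|u (n + k)%N - u n| <= 2 * 2^-1 ^+ n - 2 * 2^-1 ^+ (n + k).
  move=> Nn; elim: k => [|k ih]; first by rewrite addn0 !subrr normr0.
  have := uN (n + k)%N (leq_trans Nn (leq_addr _ _)).
  have := ler_distD (u (n + k)%N) (u (n + k).+1) (u n).
  rewrite addnS exprS; move: ih; set a := 2^-1 ^+ n; set b := 2^-1 ^+ (n + k); lra.
have tel' n m : (N <= n)%N -> (n <= m)%N -> `|u m - u n| <= 2 * 2^-1 ^+ n.
  move=> Nn nm; have := tel n (m - n)%N Nn; rewrite subnKC// => h.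
  by apply: (le_trans h); rewrite gerBl mulr_ge0// (ltW (h0 _)).
have cu : u n @[n --> \oo] --> limn u.
  apply: (@cauchy_cvg _ (u n @[n --> \oo])); apply/cauchyP => e e0.
  have [n Nn ne] : exists2 n, (N <= n)%N & 2 * (2^-1 : R) ^+ n < e.
    have := @cvg_geometric R 2 2^-1; rewrite ger0_norm// invf_lt1// ltr1n => /(_ isT).
    move=> /cvgrPdist_lt/(_ e e0)[n0 _ H]; exists (maxn N n0); first exact: leq_maxl.
    have := H (maxn N n0) (leq_maxr _ _); rewrite sub0r normrN ger0_norm//.
    by rewrite mulr_ge0// (ltW (h0 _)).
  exists (u n); exists n => // m /= nm; rewrite -ball_normE/= distrC.
  by apply: le_lt_trans ne; exact: tel'.
split => // n Nn; apply/ler_addgt0Pr => e e0.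
have /cvgrPdist_lt/(_ e e0)[m _ H] := cu.
have := H (maxn n m) (leq_maxr _ _) => /ltW h.
have := tel' n (maxn n m) Nn (leq_maxl _ _).
have := ler_distD (u (maxn n m)) (limn u) (u n); lra.
Qed.

(** Lebesgue numbers for a compact interval, in a form that keeps the centres of
    the finite subcover. Halving the radii leaves room for all points within m of
    the point u. *)
Lemma lebesgue_number (dl : R -> R) (t : R) : (forall s, 0 <= s <= t -> 0 < dl s) ->
  exists (D : seq R) m, [/\ 0 < m, forall s, s \in D -> 0 <= s <= t &
    forall u, 0 <= u <= t -> exists s,
      [/\ s \in D, s - dl s / 2 < u < s + dl s / 2 & m <= dl s / 2]].
Proof.
move=> hdl; have := @segment_compact R 0 t; rewrite compact_cover.
move=> /(_ _ [set s | 0 <= s <= t] (fun s => `](s - dl s / 2), (s + dl s / 2)[%classic)).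
case.
- by move=> s _; exact: itv_open.
- move=> s /=; rewrite in_itv/= => st; exists s => //=.
  by rewrite in_itv/= ltrDl ltrBlDr ltrDl divr_gt0// hdl.
move=> D' D't cov.
pose D := finmap.enum_fset D' : seq R.
have DD s : s \in D -> 0 <= s <= t by move=> /D't/set_mem.
pose m : R := \big[Num.min/1]_(s <- D) (dl s / 2).
have m0 : 0 < m.
  rewrite /m big_seq; elim/big_ind: _ => //.
    by move=> x y x0 y0; rewrite lt_min x0.
  by move=> s sD; rewrite divr_gt0// hdl// DD.
have mle s : s \in D -> m <= dl s / 2.
  rewrite /m; elim: (D) => // a r ih; rewrite inE big_cons ge_min.
  by move=> /orP[/eqP ->|/ih ->]; rewrite ?lexx ?orbT.
exists D, m; split => // u ut.
have : `[0, t]%classic u by rewrite /= in_itv/=.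
move=> /cov[s sD]; rewrite /= in_itv/= => hu.
by exists s; split => //; exact: mle.
Qed.

End real_line.

(** * Expectations *)

Section expectation.
Context d (T : measurableType d) (R : realType) (P : probability T R).
Implicit Types (f g h : T -> R) (A : set T).

Definition intble f := P.-integrable setT (EFin \o f).
Definition expect f : R := (\int[P]_w f w)%R.

Lemma EFin_expect f : intble f -> (expect f)%:E = (\int[P]_w (f w)%:E)%E.
Proof. by move=> fi; rewrite /expect /Rintegral fineK//; exact: integrable_fin_num. Qed.

Lemma intble_measurable f : intble f -> measurable_fun setT f.
Proof. by move=> /integrableP[/measurable_EFinP]. Qed.

Lemma eq_intble f g : f =1 g -> intble f -> intble g.
Proof. by move=> fg; rewrite /intble (funext fg). Qed.

Lemma eq_expect f g : f =1 g -> expect f = expect g.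
Proof. by move=> fg; rewrite (funext fg). Qed.

Lemma intbleD f g : intble f -> intble g -> intble (fun w => f w + g w).
Proof. by move=> fi gi; have := integrableD measurableT fi gi. Qed.

Lemma intbleB f g : intble f -> intble g -> intble (fun w => f w - g w).
Proof. by move=> fi gi; have := integrableB measurableT fi gi. Qed.

Lemma intbleZ k f : intble f -> intble (fun w => k * f w).
Proof. by move=> fi; have := integrableZl measurableT k fi. Qed.

Lemma intble_le f g : measurable_fun setT f -> (forall w, `|f w| <= g w) ->
  intble g -> intble f.
Proof.
move=> mf fg gi; apply: (le_integrable _ _ _ gi) => //.
  exact/measurable_EFinP.
by move=> w _; rewrite /= lee_fin (le_trans (fg w))// ler_norm.
Qed.

Lemma intble_cst k : intble (fun=> k).
Proof. exact: finite_measure_integrable_cst. Qed.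

Lemma intble_bounded K f : measurable_fun setT f -> (forall w, `|f w| <= K) ->
  intble f.
Proof. by move=> mf fK; apply: (intble_le mf fK); exact: intble_cst. Qed.

Lemma intble_norm f : intble f -> intble (fun w => `|f w|).
Proof. by move=> fi; have := integrable_norm fi. Qed.

Lemma intbleM K h f : measurable_fun setT h -> (forall w, `|h w| <= K) ->
  intble f -> intble (fun w => h w * f w).
Proof.
move=> mh hK fi; apply: (intble_le (g := fun w => K * `|f w|)).
- by apply: measurable_funM => //; exact: intble_measurable.
- by move=> w; rewrite normrM ler_wpM2r.
- exact/intbleZ/intble_norm.
Qed.

Lemma intble_sum (I : Type) (r : seq I) (F : I -> T -> R) :
  (forall i, intble (F i)) -> intble (fun w => \sum_(i <- r) F i w).
Proof.
move=> Fi; elim: r => [|i r ih].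
  by apply: eq_intble (intble_cst 0) => w; rewrite big_nil.
by apply: eq_intble (intbleD (Fi i) ih) => w; rewrite big_cons.
Qed.

Lemma expectD f g : intble f -> intble g ->
  expect (fun w => f w + g w) = expect f + expect g.
Proof. by move=> fi gi; rewrite /expect RintegralD. Qed.

Lemma expectB f g : intble f -> intble g ->
  expect (fun w => f w - g w) = expect f - expect g.
Proof. by move=> fi gi; rewrite /expect RintegralB. Qed.

Lemma expectZ k f : intble f -> expect (fun w => k * f w) = k * expect f.
Proof. by move=> fi; rewrite /expect RintegralZl. Qed.

Lemma expect_sum (I : Type) (r : seq I) (F : I -> T -> R) :
  (forall i, intble (F i)) ->
  expect (fun w => \sum_(i <- r) F i w) = \sum_(i <- r) expect (F i).
Proof.
move=> Fi; elim: r => [|i r ih].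
  rewrite big_nil -[RHS](mul0r (fine (P setT))) -Rintegral_cst//.
  by apply: eq_expect => w; rewrite big_nil.
rewrite big_cons -ih -expectD//; last exact: intble_sum.
by apply: eq_expect => w; rewrite big_cons.
Qed.

Lemma expect_cst k : expect (fun=> k) = k.
Proof. by rewrite /expect Rintegral_cst//= probability_setT mulr1. Qed.

Lemma le_expect f g : intble f -> intble g -> (forall w, f w <= g w) ->
  expect f <= expect g.
Proof. by move=> fi gi fg; apply: le_Rintegral. Qed.

Lemma expect_ge0 f : (forall w, 0 <= f w) -> 0 <= expect f.
Proof. by move=> f0; apply: Rintegral_ge0. Qed.

Lemma le_norm_expect f : intble f -> `|expect f| <= expect (fun w => `|f w|).
Proof. by move=> fi; apply: le_normr_Rintegral. Qed.

(** The way in which an estimate of a lower integral becomes integrability. *)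
Lemma intble_ge0 f C : measurable_fun setT f -> (forall w, 0 <= f w) ->
  (\int[P]_w (f w)%:E <= C%:E)%E -> intble f /\ expect f <= C.
Proof.
move=> mf f0 fC; have fi : intble f.
  apply/integrableP; split; first exact/measurable_EFinP.
  under eq_integral do rewrite /= ger0_norm//.
  exact: le_lt_trans fC (ltry _).
by split => //; rewrite -lee_fin EFin_expect.
Qed.

(** A process that is known only outside a null set inherits integrability and
    expectation from its formula there. *)
Lemma ae_eq_intble f g : intble f -> measurable_fun setT g ->
  {ae P, forall w, f w = g w} -> intble g /\ expect g = expect f.
Proof.
move=> fi mg fg.
have mf := intble_measurable fi.
have fg' : ae_eq P setT (EFin \o f) (EFin \o g).
  by apply: filterS fg => w /= -> _.
have e : (\int[P]_w (g w)%:E = \int[P]_w (f w)%:E)%E.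
  by apply/esym; apply: ae_eq_integral => //; exact/measurable_EFinP.
have ea : (\int[P]_w `|(g w)%:E| = \int[P]_w `|(f w)%:E|)%E.
  apply: ae_eq_integral => //.
  - by apply: measurableT_comp => //; exact/measurable_EFinP.
  - by apply: measurableT_comp => //; exact/measurable_EFinP.
  - by apply: filterS fg => w /= -> _.
split; last by rewrite /expect /Rintegral e.
apply/integrableP; split; first exact/measurable_EFinP.
by rewrite ea; have /integrableP[] := fi.
Qed.

Lemma expect_dominated (F : nat -> T -> R) f g :
  (forall n, measurable_fun setT (F n)) -> measurable_fun setT f ->
  {ae P, forall w, F n w @[n --> \oo] --> f w} ->
  intble g -> (forall n w, `|F n w| <= g w) ->
  intble f /\ expect (F n) @[n --> \oo] --> expect f.
Proof.
move=> mF mf Ff gi Fg.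
have [] := @dominated_convergence _ _ _ P setT measurableT
  (fun n => EFin \o F n) (EFin \o f) (EFin \o g) _ _ _ gi.
- by move=> n; exact/measurable_EFinP.
- exact/measurable_EFinP.
- by apply: filterS Ff => w /= h _; apply/fine_cvgP; split => //; near=> n.
- by apply: aeW => w n _; rewrite lee_fin.
move=> fi _ h; split => //.
have Fi n : intble (F n) by apply: intble_le gi.
move: h; rewrite -EFin_expect//.
rewrite (_ : [sequence _]_n = EFin \o (fun n => expect (F n))).
  by move=> /fine_cvgP[].
by apply/funext => n /=; rewrite EFin_expect.
Unshelve. all: by end_near. Qed.

Lemma expect_fatou (F : nat -> T -> R) f C :
  (forall n, intble (F n)) -> (forall n w, 0 <= F n w) ->
  measurable_fun setT f -> (forall w, 0 <= f w) ->
  {ae P, forall w, F n w @[n --> \oo] --> f w} ->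
  (forall n, expect (F n) <= C) -> intble f /\ expect f <= C.
Proof.
move=> Fi F0 mf f0 Ff FC; apply: intble_ge0 => //.
have mF n : measurable_fun setT (EFin \o F n).
  by apply/measurable_EFinP; exact: intble_measurable.
have mi : measurable_fun setT (fun w => limn_einf ((fun n => EFin \o F n) ^~ w)).
  under eq_fun do rewrite -[limn_einf _]oppeK -limn_esupN.
  apply: measurableT_comp => //; apply: measurable_fun_limn_esup => n.
  by apply: measurableT_comp => //; exact: mF.
have := @fatou _ _ _ P setT measurableT (fun n => EFin \o F n) mF.
have F0' n w : setT w -> (0 <= (EFin \o F n) w)%E by move=> _; rewrite lee_fin.
move=> /(_ F0') h.
have : (\int[P]_w (f w)%:E <= \int[P]_w limn_einf (fun n => (F n w)%:E))%E.
  apply: ae_ge0_le_integral => //.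
  - by move=> w _; rewrite lee_fin.
  - exact/measurable_EFinP.
  - move=> w _; rewrite limn_einf_lim; apply: lime_ge; first exact: is_cvg_einfs.
    by apply: nearW => n; apply: le_ereal_inf_tmp => _ [m _ <-]; rewrite lee_fin.
  - apply: filterS Ff => w /= hw _.
    have /cvg_limn_einf_sup[-> _] // : (F n w)%:E @[n --> \oo] --> (f w)%:E.
    by apply/fine_cvgP; split => //; near=> n.
move=> /le_trans; apply; apply: (le_trans h).
rewrite limn_einf_lim; apply: lime_le; first exact: is_cvg_einfs.
apply: nearW => n; apply: ereal_inf_le.
by exists (expect (F n))%:E; [exists n => //=; rewrite EFin_expect|rewrite lee_fin].
Unshelve. all: by end_near. Qed.

Lemma expect_indic A : measurable A -> expect \1_A = fine (P A).
Proof. by move=> mA; rewrite /expect /Rintegral integral_indic// setIT. Qed.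

Lemma intble_indic A : measurable A -> intble \1_A.
Proof.
move=> mA; apply: (@intble_bounded 1) => // w.
by rewrite ger0_norm// indicE; case: (w \in A).
Qed.

Lemma expect_markov A f c : measurable A -> intble f -> (forall w, 0 <= f w) ->
  (forall w, A w -> c <= f w) -> 0 < c -> (P A <= (expect f / c)%:E)%E.
Proof.
move=> mA fi f0 Af c0.
rewrite -[P A]fineK ?fin_num_measure// lee_fin ler_pdivlMr// -expect_indic//.
rewrite mulrC -expectZ; last exact: intble_indic.
apply: le_expect => //; first exact/intbleZ/intble_indic.
move=> w; rewrite indicE; case: (boolP (w \in A)) => [/[!inE] wA|_]; rewrite ?mulr1 ?mulr0//.
exact: Af.
Qed.

Lemma expect_eq0 f : intble f -> (forall w, 0 <= f w) -> expect f = 0 ->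
  {ae P, forall w, f w = 0}.
Proof.
move=> fi f0 ef; have mf := intble_measurable fi.
have /ae_eq_integral_abs : measurable_fun setT (EFin \o f) by exact/measurable_EFinP.
move=> /(_ P measurableT)[+ _].
have -> : (\int[P]_w `|(EFin \o f) w| = 0)%E.
  under eq_integral do rewrite /= ger0_norm//.
  by rewrite -EFin_expect// ef.
by move=> /(_ erefl); apply: filterS => w /= h; have [] := h Logic.I.
Qed.

End expectation.

(** * Sigma-algebras and the usual conditions *)

Section sigma_algebra_facts.
Context {T : pointedType} (G : set (set T)).
Hypothesis sG : sigma_algebra setT G.

Lemma sigma_measurableE :
  (@measurable _ (g_sigma_algebraType G) : set (set T)) = G.
Proof. exact: sigma_algebra_id. Qed.

Lemma sigma_setC A : G A -> G (~` A).
Proof. by rewrite -sigma_measurableE; exact: measurableC. Qed.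

Lemma sigma_setT : G setT.
Proof. by rewrite -sigma_measurableE; exact: measurableT. Qed.

Lemma sigma_set0 : G set0.
Proof. by rewrite -sigma_measurableE; exact: measurable0. Qed.

Lemma sigma_setI A B : G A -> G B -> G (A `&` B).
Proof. by rewrite -sigma_measurableE; exact: measurableI. Qed.

Lemma sigma_setU A B : G A -> G B -> G (A `|` B).
Proof. by rewrite -sigma_measurableE; exact: measurableU. Qed.

Lemma sigma_setD A B : G A -> G B -> G (A `\` B).
Proof. by rewrite -sigma_measurableE; exact: measurableD. Qed.

Lemma sigma_bigcup (I : countType) (D : set I) (A : I -> set T) :
  (forall i, D i -> G (A i)) -> G (\bigcup_(i in D) A i).
Proof.
move=> GA; rewrite bigcup_mkcond -sigma_measurableE.
apply: countable_bigcupT_measurable => //= i.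
rewrite [X in X _]sigma_measurableE; case: ifPn => [/[!inE]/GA//|_].
exact: sigma_set0.
Qed.

Lemma sigma_bigcap (I : countType) (D : set I) (A : I -> set T) :
  (forall i, D i -> G (A i)) -> G (\bigcap_(i in D) A i).
Proof.
move=> GA; rewrite -[X in G X]setCK; apply: sigma_setC.
rewrite setC_bigcap; apply: sigma_bigcup => // i Di.
exact/sigma_setC/GA.
Qed.

Lemma sigma_funP dV (V : measurableType dV) (f : T -> V) :
  (forall B, measurable B -> G (f @^-1` B)) <->
  measurable_fun (setT : set (g_sigma_algebraType G)) f.
Proof.
split=> [h _ B mB|h B mB].
  by rewrite setTI [X in X _]sigma_measurableE; exact: h.
have := h measurableT B mB.
by rewrite setTI [X in X _]sigma_measurableE.
Qed.

End sigma_algebra_facts.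

(** The usual conditions, for the times t >= 0 only. The null sets are those of
    the ambient sigma-algebra. *)
Record usual_filtration {R : realType} {disp} {T : measurableType disp}
    (P : probability T R) (F : R -> set (set T)) : Prop := {
  usual_sigma : forall t, 0 <= t -> sigma_algebra setT (F t) ;
  usual_mono : forall s t, 0 <= s -> s <= t -> F s `<=` F t ;
  usual_meas : forall t, 0 <= t -> F t `<=` measurable ;
  usual_right : forall t A, 0 <= t -> (forall u, t < u -> F u A) -> F t A ;
  usual_null : forall t A, 0 <= t -> measurable A -> P A = 0%E -> F t A }.

(** * Cadlag paths and stopping *)

Section cadlag_facts.
Context {R : realType} {V : normedModType R}.
Implicit Types f : R -> V.

Lemma cadlag_right f t e : cadlag f -> 0 <= t -> 0 < e ->
  exists2 dl, 0 < dl & forall u, t <= u -> u < t + dl -> `|f u - f t| < e.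
Proof.
move=> [fr _] t0 e0; have /cvgrPdist_lt/(_ e e0) := fr t t0.
rewrite -/(nbhs _ _) => -[dl /= dl0 h]; exists dl => // u tu udl.
have [<-|tu'] := eqVneq t u; first by rewrite subrr normr0.
rewrite distrC; apply: h; last by rewrite lt_neqAle tu' tu.
by rewrite /= distrC ger0_norm ?subr_ge0// ltrBlDl.
Qed.

Lemma cadlag_left f t : cadlag f -> 0 < t ->
  forall e, 0 < e -> exists2 dl, 0 < dl &
    forall u, t - dl < u -> u < t -> `|f u - lim (f v @[v --> t^'-])| < e.
Proof.
move=> [_ fl] t0 e e0; have /cvgrPdist_lt/(_ e e0) := fl t t0.
rewrite -/(nbhs _ _) => -[dl /= dl0 h]; exists dl => // u udl ut.
rewrite distrC; apply: h => //.
by rewrite /= ger0_norm ?subr_ge0 1?ltW// ltrBlDr -ltrBlDl.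
Qed.

(** The left limits are supplied as a function l, so that they need not be computed
    from the definition of a limit. *)
Lemma cadlagI f (l : R -> V) :
  (forall t e, 0 <= t -> 0 < e -> exists2 dl, 0 < dl &
    forall u, t < u -> u < t + dl -> `|f u - f t| < e) ->
  (forall t e, 0 < t -> 0 < e -> exists2 dl, 0 < dl &
    forall u, t - dl < u -> u < t -> `|f u - l t| < e) -> cadlag f.
Proof.
move=> fr fl; split=> [t t0|t t0].
  apply/cvgrPdist_lt => e e0; have [dl dl0 h] := fr t e t0 e0.
  exists dl => //= u /=; rewrite distrC => udl tu.
  rewrite distrC h//; move: udl; rewrite ger0_norm ?subr_ge0 1?ltW//.
  by rewrite ltrBlDl.
apply/cvg_ex; exists (l t); apply/cvgrPdist_lt => e e0.
have [dl dl0 h] := fl t e t0 e0.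
exists dl => //= u /= udl tu; rewrite distrC h//.
by move: udl; rewrite ger0_norm ?subr_ge0 1?ltW// ltrBlDr -ltrBlDl.
Qed.

End cadlag_facts.

Section stopping.
Context {R : realType} {disp} {T : measurableType disp}.
Implicit Types (Y : R -> T -> R) (tau : T -> \bar R).

(** The time at which a process stopped at tau is read: min(t, tau), as a real. *)
Definition stop_at tau (t : R) w : R := fine (Order.min t%:E (tau w)).

Lemma stoppedE Y tau t w : stopped Y tau t w = Y (stop_at tau t w) w.
Proof. by []. Qed.

Variant stop_at_spec tau t w : R -> Type :=
  | StopAfter of (t%:E <= tau w)%E : stop_at_spec tau t w t
  | StopBefore r of tau w = r%:E & r < t & 0 <= r : stop_at_spec tau t w r.

(** Case analysis on whether stopping has occurred before t. *)
Lemma stop_atP tau t w : (0 <= tau w)%E ->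
  stop_at_spec tau t w (stop_at tau t w).
Proof.
rewrite /stop_at => tau0; have [h|] := leP t%:E (tau w).
  by constructor.
case e : (tau w) tau0 => [r|//|//]; rewrite lee_fin lte_fin => r0 rt.
by constructor.
Qed.

Lemma stop_at_le tau t w : (0 <= tau w)%E -> stop_at tau t w <= t.
Proof. by move=> h; case: stop_atP => // r _ /ltW. Qed.

Lemma stop_at_ge0 tau t w : (0 <= tau w)%E -> 0 <= t -> 0 <= stop_at tau t w.
Proof. by move=> h; case: stop_atP. Qed.

Lemma stop_at0 tau w : (0 <= tau w)%E -> stop_at tau 0 w = 0.
Proof.
by move=> h; case: stop_atP => // r _ r0 /le_lt_trans/(_ r0); rewrite ltxx.
Qed.

Lemma stop_at_id tau t w : (t%:E <= tau w)%E -> stop_at tau t w = t.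
Proof. by move=> h; rewrite /stop_at min_l. Qed.

Lemma stop_at_eq tau t r w : tau w = r%:E -> r <= t -> stop_at tau t w = r.
Proof. by move=> h rt; rewrite /stop_at h min_r ?lee_fin. Qed.

Lemma stop_atI tau1 tau2 t w : (0 <= tau1 w)%E -> (0 <= tau2 w)%E ->
  stop_at tau2 (stop_at tau1 t w) w =
  stop_at (fun w => Order.min (tau1 w) (tau2 w)) t w.
Proof.
move=> h1 h2; case: (stop_atP t h1) => [h|r e rt r0].
  by rewrite /stop_at minA (min_l h).
by rewrite /stop_at e minA (@min_r _ _ t%:E r%:E) ?lee_fin ?ltW.
Qed.

(** Up to tau the path agrees with the original one, and it is constant afterwards;
    each point t has a one-sided neighbourhood on which only one case occurs. *)
Lemma cadlag_stopped Y tau w : (0 <= tau w)%E -> cadlag (Y ^~ w) ->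
  cadlag ((stopped Y tau) ^~ w).
Proof.
move=> tau0 cY; pose l t := if (tau w < t%:E)%E then Y (stop_at tau t w) w
   else lim (Y v w @[v --> t^'-]).
apply: (@cadlagI _ _ _ l) => t e t0 e0.
  rewrite [stopped _ _ t w]stoppedE; case: (stop_atP t tau0) => [h|r e' rt r0].
    have [dl dl0 H] := cadlag_right cY t0 e0; exists dl => // u tu udl.
    rewrite stoppedE; case: (stop_atP u tau0) => [h'|r e' ru r0].
      exact/H/udl/ltW.
    apply: H; last exact: lt_trans udl.
    by move: h; rewrite e' lee_fin.
  exists 1 => // u tu _; rewrite stoppedE (stop_at_eq e') ?subrr ?normr0//.
  by rewrite ltW// (lt_trans rt).
rewrite /l; case: ifPn => [|]; last rewrite -leNgt; move=> h.
  case e' : (tau w) h tau0 => [r|//|//]; rewrite lte_fin lee_fin => h tau0.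
  exists (t - r); first by rewrite subr_gt0.
  move=> u; rewrite opprB addrC subrK => ru ut; rewrite stoppedE.
  by rewrite !(stop_at_eq e') ?subrr ?normr0// ltW.
have [dl dl0 H] := cadlag_left cY t0 e0; exists dl => // u tu ut.
by rewrite stoppedE stop_at_id ?H// (le_trans _ h)// lee_fin ltW.
Qed.

End stopping.

Lemma measurable_fun_if_in d (U : measurableType d) d' (V : measurableType d')
    (f g : U -> V) (A : set U) : measurable A ->
  measurable_fun setT f -> measurable_fun setT g ->
  measurable_fun setT (fun w => if w \in A then f w else g w).
Proof.
move=> mA mf mg; apply: (@measurable_fun_ifT _ _ _ _ f g (fun w => w \in A)) => //.
apply: (measurable_fun_bool true); rewrite setTI.
rewrite (_ : _ @^-1` _ = A)//.
by apply/seteqP; split=> w /=; [move/set_mem|move/mem_set].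
Qed.

(** * Optional stopping *)

Section grid_stopping.
Context {R : realType} {disp} {T : measurableType disp}.
Variables (P : probability T R) (F : R -> set (set T)).
Hypothesis uF : usual_filtration P F.
Implicit Types (Y : R -> T -> R) (tau : T -> \bar R) (A : set T) (s t u dl : R).

Lemma usual_sigma_fun dV (V : measurableType dV) (f : T -> V) t : 0 <= t ->
  (forall B, measurable B -> F t (f @^-1` B)) <->
  measurable_fun (setT : set (g_sigma_algebraType (F t))) f.
Proof. by move=> t0; exact: (sigma_funP (usual_sigma uF t0)). Qed.

Lemma usual_fun_measurable dV (V : measurableType dV) (f : T -> V) t : 0 <= t ->
  measurable_fun (setT : set (g_sigma_algebraType (F t))) f ->
  measurable_fun (setT : set T) f.
Proof.
move=> t0 /usual_sigma_fun -/(_ t0) h _ B mB; rewrite setTI.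
by apply: (usual_meas uF t0); exact: h.
Qed.

Lemma usual_fun_mono dV (V : measurableType dV) (f : T -> V) s t : 0 <= s -> s <= t ->
  measurable_fun (setT : set (g_sigma_algebraType (F s))) f ->
  measurable_fun (setT : set (g_sigma_algebraType (F t))) f.
Proof.
move=> s0 st /usual_sigma_fun -/(_ s0) h.
apply/usual_sigma_fun => [|B mB]; first exact: le_trans st.
by apply: (usual_mono uF s0 st); exact: h.
Qed.

Lemma adapted_measurable Y t : adapted F Y -> 0 <= t ->
  measurable_fun (setT : set T) (Y t).
Proof.
move=> aY t0; apply: (usual_fun_measurable t0); apply/usual_sigma_fun => //.
exact: aY.
Qed.

Lemma usual_set_fun A t : 0 <= t -> F t A ->
  measurable (A : set (g_sigma_algebraType (F t))).
Proof. by move=> t0 FA; rewrite [X in X _](sigma_measurableE (usual_sigma uF t0)). Qed.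

Lemma usual_fun_if (f g : T -> R) A t : 0 <= t -> F t A ->
  measurable_fun (setT : set (g_sigma_algebraType (F t))) f ->
  measurable_fun (setT : set (g_sigma_algebraType (F t))) g ->
  measurable_fun (setT : set (g_sigma_algebraType (F t)))
    (fun w => if w \in A then f w else g w).
Proof.
move=> t0 FA mf mg.
exact: (@measurable_fun_if_in _ (g_sigma_algebraType (F t)) _ _ _ _ _
  (usual_set_fun t0 FA) mf mg).
Qed.

Lemma usual_setT t : 0 <= t -> F t setT.
Proof. by move=> t0; exact: (sigma_setT (usual_sigma uF t0)). Qed.

Lemma martingale_expect Y s t A : martingale P F Y -> 0 <= s -> s <= t ->
  F s A -> expect P (fun w => \1_A w * Y t w) = expect P (fun w => \1_A w * Y s w).
Proof.
move=> [aY _ iY mY] s0 st FA; have t0 := le_trans s0 st.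
have e u : 0 <= u -> expect P (fun w => \1_A w * Y u w) =
    fine (\int[P]_(w in A) (Y u w)%:E)%E.
  move=> u0; rewrite /expect /Rintegral [in RHS]integral_mkcond; congr fine.
  apply: eq_integral => w _; rewrite /patch indicE; case: ifPn => _.
    by rewrite mul1r.
  by rewrite mul0r.
by rewrite !e// (mY s t).
Qed.

(** The process read at the first point of the grid r that is not before tau, or at
    t if there is none: the stopping time is replaced by a larger one with finitely
    many values. *)
Fixpoint stop_grid Y tau (t : R) (r : seq R) w : R :=
  if r is u :: r' then
    if (tau w <= u%:E)%E then Y u w else stop_grid Y tau t r' w
  else Y t w.

(** A path of [grid_step dl] is a subdivision of mesh at most dl. *)
Definition grid_step (dl : R) : rel R := fun a b => (a <= b) && (b <= a + dl).

Lemma grid_exists dl s t : 0 < dl -> s <= t ->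
  exists2 r, path (grid_step dl) s r & last s r = t.
Proof.
move=> dl0 st.
have [N hN] : exists N : nat, t - s <= N%:R * dl.
  exists (Num.truncn ((t - s) / dl)).+1; rewrite -ler_pdivrMr//.
  by rewrite ltW// truncnS_gt.
elim: N s st hN => [|N ih] s st hN.
  exists [::] => //=; apply/eqP; rewrite eq_le st/=.
  by move: hN; rewrite mul0r subr_le0.
have [h|h] := leP t (s + dl).
  by exists [:: t] => //=; rewrite /grid_step st h.
have [||r pr lr] := ih (s + dl); first exact: ltW.
  by move: hN; rewrite -natr1 mulrDl mul1r; lra.
by exists (s + dl :: r) => //=; rewrite /grid_step lexx lerDl ltW.
Qed.

(** Rounding tau up to the grid moves it by at most the mesh, and from above; so
    right-continuity is enough to pass to the limit. *)
Lemma stop_grid_near Y tau dl s t r w : 0 <= dl -> path (grid_step dl) s r -> last s r = t ->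
  (s%:E < tau w)%E -> s <= t ->
  exists u, [/\ stop_grid Y tau t r w = Y u w, stop_at tau t w <= u &
    u <= stop_at tau t w + dl].
Proof.
move=> dl0; elim: r s => [|u r ih] s /=.
  move=> _ <- h _; exists s; rewrite (stop_at_id (ltW h)).
  by split => //; rewrite lerDl.
case/andP=> /andP[su usd] pr lr h st.
have ut : u <= t.
  rewrite -lr; elim: (r) (u) pr => //= a r' ih' b /andP[/andP[ba _] /ih'].
  exact: le_trans.
case: ifPn => [hu|]; last by rewrite -ltNge => hu; exact: (ih u).
exists u; split => //.
  case e : (tau w) h hu => [x| |]//; rewrite lte_fin lee_fin => sx xu.
  by rewrite (stop_at_eq e)// (le_trans xu).
case e : (tau w) h hu => [x| |]//; rewrite lte_fin lee_fin => sx xu.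
by rewrite (stop_at_eq e) ?(le_trans xu)// (le_trans usd)// lerD2r ltW.
Qed.

Lemma stop_grid_measurable Y tau dl s t r : 0 <= s -> adapted F Y ->
  stopping_time F tau -> path (grid_step dl) s r -> last s r = t -> s <= t ->
  measurable_fun (setT : set (g_sigma_algebraType (F t))) (stop_grid Y tau t r).
Proof.
move=> s0 aY [_ st]; elim: r s s0 => [|u r ih] s s0 /=.
  by move=> _ <- _; apply/usual_sigma_fun => //; exact: aY.
case/andP=> /andP[su usd] pr lr h.
have u0 := le_trans s0 su.
have ut : u <= t.
  rewrite -lr; elim: (r) (u) pr => //= a r' ih' b /andP[/andP[ba _] /ih'].
  exact: le_trans.
have t0 := le_trans u0 ut.
have := @usual_fun_if (Y u) (stop_grid Y tau t r)
  [set w | (tau w <= u%:E)%E] t t0.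
rewrite (_ : (fun w => if w \in _ then _ else _) =
   fun w => if (tau w <= u%:E)%E then Y u w else stop_grid Y tau t r w); last first.
  by apply/funext => w; rewrite mem_setE.
apply.
- by apply: (usual_mono uF u0 ut); exact: st.
- by apply: (usual_fun_mono u0 ut); apply/usual_sigma_fun => //; exact: aY.
- exact: (ih u).
Qed.

Lemma grid_le dl s r : path (grid_step dl) s r -> s <= last s r.
Proof.
by elim: r s => //= a r ih b /andP[/andP[ba _] /ih]; exact: le_trans.
Qed.

(** Optional stopping at finitely many times, by induction on the grid from its last
    point: the event that tau has occurred at u belongs to F u, and on its complement
    the induction hypothesis applies from u on. *)
Lemma martingale_grid Y tau dl s t r (B : set T) : 0 <= s -> martingale P F Y ->
  stopping_time F tau -> path (grid_step dl) s r -> last s r = t -> F s B ->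
  intble P (stop_grid Y tau t r) /\
  expect P (fun w => \1_B w * stop_grid Y tau t r w) =
  expect P (fun w => \1_B w * Y t w).
Proof.
move=> s0 mY stau; have [aY cY iY eY] := mY; elim: r s s0 B => [|u r ih] s s0 B.
  by move=> _ /= <- FB; split => //; exact: iY.
move=> pr lr FB; have := grid_le pr; rewrite lr => st; have := pr.
move=> /= /andP[/andP[su usd] pr']; have u0 := le_trans s0 su.
have lr' : last u r = t by [].
have ut : u <= t by rewrite -lr'; exact: grid_le pr'.
have t0 := le_trans u0 ut.
set A := [set w | (tau w <= u%:E)%E].
have FA : F u A by apply: stau.2.
have inA w : (w \in A) = (tau w <= u%:E)%E.
  by apply/idP/idP => [/set_mem|/mem_set].
have FB' : F u B by exact: (usual_mono uF s0 su).
have [ri re] := ih u u0 (B `\` A) pr' lr' (sigma_setD (usual_sigma uF u0) FB' FA).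
have mA : measurable A by exact: (usual_meas uF u0).
have mB : measurable B by exact: (usual_meas uF u0).
have i1 (C : set T) f : measurable C -> intble P f -> intble P (fun w => \1_C w * f w).
  by move=> mC; apply: (@intbleM _ _ _ _ 1) => // w; rewrite indicE; case: (w \in C);
    rewrite ?normr1 ?normr0.
have gi : intble P (stop_grid Y tau t (u :: r)).
  have := intbleD (i1 A _ mA (iY u u0)) (i1 (~` A) _ (measurableC mA) ri).
  apply: eq_intble => w /=; rewrite !indicE in_setC inA.
  by case: ifPn => _; rewrite ?mul1r ?mul0r ?addr0 ?add0r.
split => //.
transitivity (expect P (fun w => \1_(B `&` A) w * Y u w + \1_(B `\` A) w * stop_grid Y tau t r w)).
  apply: eq_expect => w; rewrite !indicE in_setD in_setI inA /=.
  by case: (w \in B); case: ifPn => _; rewrite ?(mul1r,mul0r,addr0,add0r).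
rewrite expectD; [|by apply: i1 => //; [exact: measurableI|exact: iY]|
  by apply: i1 => //; exact: measurableD].
rewrite re -(martingale_expect mY u0 ut) -?expectD.
- apply: eq_expect => w; rewrite !indicE in_setD in_setI inA /=.
  by case: (w \in B); case: (tau w <= u%:E)%E; rewrite ?(mul1r,mul0r,addr0,add0r).
- by apply: i1; [exact: measurableI|exact: iY].
- by apply: i1; [exact: measurableD|exact: iY].
- exact: (sigma_setI (usual_sigma uF u0)).
Qed.

End grid_stopping.

Lemma dist_le_continuous {R : realType} (V W : normedModType R) (f : V -> W) (k : R) :
  0 < k -> (forall x y, `|f x - f y| <= k * `|x - y|) -> continuous f.
Proof.
move=> k0 fk x; apply/cvgrPdist_lt => e e0; near=> y.
apply: (le_lt_trans (fk x y)); rewrite -ltr_pdivlMl// mulrC.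
near: y; apply/nbhs_ballP; exists (e / k); first by rewrite /= divr_gt0.
by move=> z; rewrite -ball_normE.
Unshelve. all: by end_near. Qed.

Section optional_stopping.
Context {R : realType} {disp} {T : measurableType disp}.
Variables (P : probability T R) (F : R -> set (set T)).
Hypothesis uF : usual_filtration P F.
Implicit Types (Y : R -> T -> R) (tau : T -> \bar R) (A : set T) (s t u dl c : R).

(** The part of |y| above the level c. Being convex in y, it gives a submartingale,
    which replaces an argument by conditional expectations in the proof that the
    stopped values are uniformly integrable. *)
Definition excess c (y : R) : R := Num.max 0 (`|y| - c).
(** Truncation at the level c: it differs from the identity by the excess, and makes
    dominated convergence available. *)
Definition clip c (y : R) : R := Num.min c (Num.max (- c) y).

Lemma excess_ge0 c y : 0 <= excess c y.
Proof. by rewrite /excess le_max lexx. Qed.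

Lemma excess_le c y : 0 <= c -> excess c y <= `|y|.
Proof. by move=> c0; rewrite /excess ge_max normr_ge0/= lerBlDr lerDl. Qed.

Lemma clip_bound c y : 0 <= c -> `|clip c y| <= c.
Proof.
move=> c0; rewrite /clip ler_norml ge_min lexx /= andbT le_min le_max lexx andbT.
by rewrite ge0_cp.
Qed.

Lemma clip_near c y : 0 <= c -> `|y - clip c y| <= excess c y.
Proof.
move=> c0; rewrite /clip /excess ler_norml.
by case: (leP (- c) y) => h1; case: (leP c _) => h2; case: (ger0P y) => h3;
  case: (leP 0 _) => h4; apply/andP; split; lra.
Qed.

Lemma continuous_excess c : continuous (excess c).
Proof.
apply: (@dist_le_continuous _ _ _ _ 1) => // x y; rewrite mul1r /excess.
apply: le_trans (ler_dist_dist x y); rewrite ler_norml.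
by case: (leP 0 (`|x| - c)) => h1; case: (leP 0 (`|y| - c)) => h2;
  case: (ger0P (`|x| - `|y|)) => h3; apply/andP; split; lra.
Qed.

Lemma continuous_clip c : continuous (clip c).
Proof.
apply: (@dist_le_continuous _ _ _ _ 1) => // x y; rewrite mul1r /clip ler_norml.
by case: (leP (- c) x) => h1; case: (leP c _) => h2; case: (leP (- c) y) => h3;
  case: (leP c _) => h4; case: (ger0P (x - y)) => h5; apply/andP; split; lra.
Qed.

Lemma measurable_excess c : measurable_fun setT (excess c).
Proof. by apply: continuous_measurable_fun; exact: continuous_excess. Qed.

Lemma measurable_clip c : measurable_fun setT (clip c).
Proof. by apply: continuous_measurable_fun; exact: continuous_clip. Qed.

Lemma intble_excess c f : 0 <= c -> intble P f -> intble P (fun w => excess c (f w)).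
Proof.
move=> c0 fi; apply: (intble_le _ _ (intble_norm fi)).
  exact: measurableT_comp (measurable_excess c) (intble_measurable fi).
by move=> w; rewrite ger0_norm ?excess_ge0// excess_le.
Qed.

Lemma intble_indicM A f : measurable A -> intble P f -> intble P (fun w => \1_A w * f w).
Proof.
move=> mA; apply: (@intbleM _ _ _ _ 1) => // w; rewrite indicE.
by case: (w \in A); rewrite ?normr1 ?normr0.
Qed.

(** The convex function [excess c] is the maximum of three affine functions. The
    proof selects, according to the value at time s, the affine function that
    attains the maximum at s; at time t it is only a lower bound, while its
    expectation has not changed. *)
Lemma martingale_excess Y s t A c : 0 <= c -> martingale P F Y -> 0 <= s -> s <= t ->
  F s A -> expect P (fun w => \1_A w * excess c (Y s w)) <=
           expect P (fun w => \1_A w * excess c (Y t w)).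
Proof.
move=> c0 mY s0 st FA; have [aY cY iY _] := mY.
have t0 := le_trans s0 st; have mA := usual_meas uF s0 FA.
pose A1 := A `&` (Y s @^-1` `]c, +oo[); pose A2 := A `&` (Y s @^-1` `]-oo, - c[).
have FA1 : F s A1 by apply: (sigma_setI (usual_sigma uF s0)) => //; exact: aY.
have FA2 : F s A2 by apply: (sigma_setI (usual_sigma uF s0)) => //; exact: aY.
have mA1 := usual_meas uF s0 FA1; have mA2 := usual_meas uF s0 FA2.
have in1 w : (w \in A1) = (w \in A) && (c < Y s w).
  rewrite in_setI; congr (_ && _).
  by apply/idP/idP => [/set_mem|h]; [|apply/mem_set]; rewrite /= in_itv/= andbT.
have in2 w : (w \in A2) = (w \in A) && (Y s w < - c).
  rewrite in_setI; congr (_ && _).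
  by apply/idP/idP => [/set_mem|h]; [|apply/mem_set]; rewrite /= in_itv/=.
have i1 u (B : set T) : 0 <= u -> measurable B -> intble P (fun w => \1_B w * Y u w).
  by move=> u0 mB; apply: intble_indicM => //; exact: iY.
have ic (B : set T) : measurable B -> intble P (fun w => c * \1_B w).
  by move=> mB; exact/intbleZ/intble_indic.
(* On A, G s is the excess at time s, and G t bounds the excess at time t from
   below. *)
pose G u w := \1_A1 w * Y u w - \1_A2 w * Y u w - c * \1_A1 w - c * \1_A2 w.
have iG u : 0 <= u -> intble P (G u).
  by move=> u0; do 3?apply: intbleB; [exact: i1|exact: i1|exact: ic|exact: ic].
have eG u : 0 <= u -> expect P (G u) =
    expect P (fun w => \1_A1 w * Y u w) - expect P (fun w => \1_A2 w * Y u w)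
    - expect P (fun w => c * \1_A1 w) - expect P (fun w => c * \1_A2 w).
  move=> u0; rewrite expectB//; [|by do 2?apply: intbleB; [exact: i1|exact: i1|exact: ic]|exact: ic].
  rewrite expectB//; [|by apply: intbleB; exact: i1|exact: ic].
  by rewrite expectB//; exact: i1.
have -> : expect P (fun w => \1_A w * excess c (Y s w)) = expect P (G s).
  apply: eq_expect => w; rewrite /G !indicE in1 in2.
  case: (w \in A) => /=; last by rewrite !mul0r !mulr0; lra.
  rewrite /excess; case: (ltP c (Y s w)) => y1; case: (ltP (Y s w) (- c)) => y2;
    case: (leP 0 (`|Y s w| - c)) => y3; rewrite /= ?(mulr1, mulr0, mul0r, mul1r);
    move: y3; case: (ger0P (Y s w)) => y4 y3; lra.
have -> : expect P (G s) = expect P (G t).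
  by rewrite !eG// -(martingale_expect mY s0 st FA1) -(martingale_expect mY s0 st FA2).
apply: le_expect; [exact: iG|by apply: intble_indicM => //; apply: intble_excess => //; exact: iY|].
move=> w; rewrite /G !indicE in1 in2; case: (w \in A) => /=; last by rewrite !mul0r !mulr0; lra.
rewrite /excess; case: (ltP c (Y s w)) => y1; case: (ltP (Y s w) (- c)) => y2;
  case: (leP 0 (`|Y t w| - c)) => y3; rewrite /= ?(mulr1, mulr0, mul0r, mul1r);
  move: y3; case: (ger0P (Y t w)) => y4 y3; lra.
Qed.

(** The same induction on the grid as for [martingale_grid], with the submartingale
    inequality in place of the martingale equality. *)
Lemma martingale_grid_excess Y tau dl s t r (B : set T) c : 0 <= c -> 0 <= s ->
  martingale P F Y ->
  stopping_time F tau -> path (grid_step dl) s r -> last s r = t -> F s B ->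
  expect P (fun w => \1_B w * excess c (stop_grid Y tau t r w)) <=
  expect P (fun w => \1_B w * excess c (Y t w)).
Proof.
move=> c0 s0 mY stau; have [aY cY iY eY] := mY; elim: r s s0 B => [|u r ih] s s0 B.
  by move=> _ /= <- FB.
move=> pr lr FB; have := grid_le pr; rewrite lr => st; have := pr.
move=> /= /andP[/andP[su usd] pr']; have u0 := le_trans s0 su.
have lr' : last u r = t by [].
have ut : u <= t by rewrite -lr'; exact: grid_le pr'.
have t0 := le_trans u0 ut.
set A := [set w | (tau w <= u%:E)%E].
have FA : F u A by apply: stau.2.
have inA w : (w \in A) = (tau w <= u%:E)%E.
  by apply/idP/idP => [/set_mem|/mem_set].
have FB' : F u B by exact: (usual_mono uF s0 su).
have FBA : F u (B `&` A) by exact: (sigma_setI (usual_sigma uF u0)).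
have FBA' : F u (B `\` A) by exact: (sigma_setD (usual_sigma uF u0)).
have re := ih u u0 (B `\` A) pr' lr' FBA'.
have [ri _] := martingale_grid uF u0 mY stau pr' lr' FBA'.
have m1 := usual_meas uF u0 FBA; have m2 := usual_meas uF u0 FBA'.
have -> : expect P (fun w => \1_B w * excess c
      (if (tau w <= u%:E)%E then Y u w else stop_grid Y tau t r w)) =
    expect P (fun w => \1_(B `&` A) w * excess c (Y u w) +
      \1_(B `\` A) w * excess c (stop_grid Y tau t r w)).
  apply: eq_expect => w; rewrite !indicE in_setD in_setI inA /=.
  by case: (w \in B); case: ifPn => _; rewrite ?(mul1r,mul0r,addr0,add0r).
have -> : expect P (fun w => \1_B w * excess c (Y t w)) =
    expect P (fun w => \1_(B `&` A) w * excess c (Y t w) +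
      \1_(B `\` A) w * excess c (Y t w)).
  apply: eq_expect => w; rewrite !indicE in_setD in_setI inA /=.
  by case: (w \in B); case: (tau w <= u%:E)%E; rewrite ?(mul1r,mul0r,addr0,add0r).
have iE f (C : set T) : measurable C -> intble P f -> intble P (fun w => \1_C w * excess c (f w)).
  by move=> mC fi; apply: intble_indicM => //; exact: intble_excess.
rewrite !expectD; [|by apply: iE => //; exact: iY|by apply: iE => //; exact: iY|
  by apply: iE => //; exact: iY|exact: iE].
by apply: lerD => //; exact: martingale_excess.
Qed.

Lemma expect_excess_cvg0 f : intble P f ->
  expect P (fun w => excess n%:R (f w)) @[n --> \oo] --> (0 : R).
Proof.
move=> fi.
have [] := @expect_dominated _ _ _ P (fun n w => excess n%:R (f w)) (fun=> 0)
  (fun w => `|f w|) _ _ _ (intble_norm fi) _ => //.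
- move=> n; exact: measurableT_comp (measurable_excess _) (intble_measurable fi).
- apply: aeW => w; apply/cvgrPdist_lt => e e0; near=> n.
  rewrite sub0r normrN ger0_norm ?excess_ge0// /excess max_l//.
  rewrite subr_le0; near: n; exact: nbhs_infty_ger.
- by move=> n w; rewrite ger0_norm ?excess_ge0// excess_le.
by rewrite expect_cst.
Unshelve. all: by end_near. Qed.

(** The grid points chosen converge to min(t, tau) from the right, hence
    right-continuity is what is used. *)
Lemma stopped_grid_cvg Y tau s t (r : nat -> seq R) w :
  0 <= s -> s <= t -> (s%:E < tau w)%E -> cadlag (Y ^~ w) ->
  (forall n, path (grid_step n.+1%:R^-1) s (r n)) -> (forall n, last s (r n) = t) ->
  stop_grid Y tau t (r n) w @[n --> \oo] --> stopped Y tau t w.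
Proof.
move=> s0 st sw cY pr lr; apply/cvgrPdist_lt => e e0.
have tau0 : (0 <= tau w)%E by rewrite (le_trans _ (ltW sw))// lee_fin.
have [dl dl0 H] := cadlag_right cY (stop_at_ge0 tau0 (le_trans s0 st)) e0.
near=> n; rewrite distrC.
have dn : 0 <= n.+1%:R^-1 :> R by [].
have [u [-> ? ud]] := stop_grid_near Y dn (pr n) (lr n) sw st.
apply: H => //; apply: le_lt_trans ud _; rewrite ltrD2l.
near: n; exact: near_infty_natSinv_lt (PosNum dl0).
Unshelve. all: by end_near. Qed.

Lemma grids_exist s t : s <= t -> exists r : nat -> seq R,
  forall n, path (grid_step n.+1%:R^-1) s (r n) /\ last s (r n) = t.
Proof.
move=> st.
have h n : exists r, path (grid_step n.+1%:R^-1) s r /\ last s r = t.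
  by have [||r ? ?] := @grid_exists _ n.+1%:R^-1 s t => //; exists r.
by have [r hr] := choice h; exists r.
Qed.

(** The stopped variable is a limit of variables stopped on grids of [0, t], apart
    from the event that tau = 0. *)
Lemma adapted_stopped Y tau : adapted F Y -> (forall w, cadlag (Y ^~ w)) ->
  stopping_time F tau -> adapted F (stopped Y tau).
Proof.
move=> aY cY stau t t0; have [r hr] := grids_exist t0.
apply/(usual_sigma_fun uF _ t0).
have FA : F t [set w | (tau w <= 0%:E)%E] by apply: (usual_mono uF _ t0) => //; exact: stau.2.
have m0 : measurable_fun (setT : set (g_sigma_algebraType (F t))) (Y 0).
  by apply: (usual_fun_mono uF _ t0) => //; apply/(usual_sigma_fun uF) => //; exact: aY.
apply: (@measurable_fun_cvg _ (g_sigma_algebraType (F t)) R setT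
  (fun n => fun w => if w \in [set w | (tau w <= 0%:E)%E] then Y 0 w else stop_grid Y tau t (r n) w)).
  move=> n; apply: (usual_fun_if uF t0) => //.
  by apply: (stop_grid_measurable uF _ aY stau) (hr n).1 (hr n).2 t0.
move=> w _; case: (boolP (w \in [set w | (tau w <= 0%:E)%E])) => [/set_mem/= h|/negP h].
  have e : tau w = 0%:E by apply/eqP; rewrite eq_le h/= stau.1.
  have -> : stopped Y tau t w = Y 0 w by rewrite /stopped e min_r ?lee_fin.
  exact: cvg_cst.
have {}h : (0%:E < tau w)%E by rewrite ltNge; apply/negP => h'; apply/h/mem_set.
exact: (stopped_grid_cvg (lexx 0) t0 h (cY w) (fun n => (hr n).1) (fun n => (hr n).2)).
Qed.

(** Stop on finer and finer grids. The values on the grids converge pointwise, and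
    their excesses over c are all bounded in expectation by that of Y t, which is
    small for c large; between the levels -c and c dominated convergence applies. *)
Lemma martingale_stopped_after Y tau s t (B : set T) : 0 <= s -> s <= t ->
  martingale P F Y -> stopping_time F tau -> F s B ->
  (forall w, B w -> (s%:E < tau w)%E) ->
  intble P (fun w => \1_B w * stopped Y tau t w) /\
  expect P (fun w => \1_B w * stopped Y tau t w) =
  expect P (fun w => \1_B w * Y t w).
Proof.
move=> s0 st mY stau FB Bs; have [aY cY iY eY] := mY; have t0 := le_trans s0 st.
have [r hr] := grids_exist st.
pose v n := stop_grid Y tau t (r n).
have mB := usual_meas uF s0 FB.
have ig n : intble P (v n) by have [] := martingale_grid uF s0 mY stau (hr n).1 (hr n).2 FB.
have eg n : expect P (fun w => \1_B w * v n w) = expect P (fun w => \1_B w * Y t w).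
  by have [] := martingale_grid uF s0 mY stau (hr n).1 (hr n).2 FB.
have xg n c : 0 <= c -> expect P (fun w => \1_B w * excess c (v n w)) <=
    expect P (fun w => excess c (Y t w)).
  move=> c0; apply: (le_trans (martingale_grid_excess c0 s0 mY stau (hr n).1 (hr n).2 FB)).
  apply: le_expect; first by apply: intble_indicM => //; apply: intble_excess => //; exact: iY.
    by apply: intble_excess => //; exact: iY.
  by move=> w; rewrite indicE; case: (w \in B); rewrite ?mul1r ?mul0r// excess_ge0.
have mS : measurable_fun setT (stopped Y tau t).
  by apply: (adapted_measurable uF) => //; exact: adapted_stopped.
have vc w : \1_B w * v n w @[n --> \oo] --> \1_B w * stopped Y tau t w.
  rewrite indicE; case: (boolP (w \in B)) => [/set_mem/Bs h|_].
    apply: cvgM; first exact: cvg_cst.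
    exact: (stopped_grid_cvg s0 st h (cY w) (fun n => (hr n).1) (fun n => (hr n).2)).
  by rewrite mul0r; under eq_fun do rewrite mul0r; exact: cvg_cst.
have xS c : 0 <= c -> intble P (fun w => \1_B w * excess c (stopped Y tau t w)) /\
    expect P (fun w => \1_B w * excess c (stopped Y tau t w)) <=
    expect P (fun w => excess c (Y t w)).
  move=> c0; have b0 f w : 0 <= \1_B w * excess c (f w).
    by rewrite mulr_ge0 ?excess_ge0// indicE.
  apply: (@expect_fatou _ _ _ P (fun n w => \1_B w * excess c (v n w))) => //.
  - by move=> n; apply: intble_indicM => //; exact: intble_excess.
  - by apply: measurable_funM => //; exact: measurableT_comp (measurable_excess c) mS.
  - apply: aeW => w; have e y : \1_B w * excess c y = \1_B w * excess c (\1_B w * y).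
      by rewrite indicE; case: (w \in B); rewrite ?mul1r ?mul0r.
    rewrite e; under eq_fun do rewrite e.
    apply: cvgM; first exact: cvg_cst.
    exact: (cvg_comp _ _ (vc w) (@continuous_excess c _)).
  - by move=> n; exact: xg.
have iS : intble P (fun w => \1_B w * stopped Y tau t w).
  have [h _] := xS 0 (lexx 0); apply: (intble_le _ _ h).
    by apply: measurable_funM.
  move=> w; rewrite normrM ger0_norm; last by rewrite indicE.
  rewrite ler_wpM2l//.
  by rewrite /excess le_max subr0 lexx orbT.
split => //; apply/eqP; rewrite eq_sym -subr_eq0 -normr_eq0 -[_ == _]negbK; apply/negP => n0.
set D := `|_| in n0; have D0 : 0 < D by rewrite lt_neqAle eq_sym n0 normr_ge0.
have := expect_excess_cvg0 (iY t t0).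
move=> /cvgrPdist_lt/(_ (D / 2 / 2)) []; first by rewrite !divr_gt0.
move=> N _ /(_ N (leqnn N)) /=.
rewrite sub0r normrN ger0_norm; last by apply: expect_ge0 => w; exact: excess_ge0.
(* The level c is chosen so that the excesses account for less than half of D. *)
set c : R := N%:R => hc; have c0 : 0 <= c by [].
suff : D <= 2 * expect P (fun w => excess c (Y t w)).
  move=> hD; move: hc hD D0; set e := expect P (fun w => excess c (Y t w)).
  by move: (D) => D'; lra.
have iclip n : intble P (fun w => \1_B w * clip c (v n w)).
  apply: intble_indicM => //; apply: (@intble_bounded _ _ _ _ c) => [|w]; last exact: clip_bound.
  exact: measurableT_comp (measurable_clip c) (intble_measurable (ig n)).
have iclipS : intble P (fun w => \1_B w * clip c (stopped Y tau t w)).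
  apply: intble_indicM => //; apply: (@intble_bounded _ _ _ _ c) => [|w]; last exact: clip_bound.
  exact: measurableT_comp (measurable_clip c) mS.
have near1 f : intble P (fun w => \1_B w * f w) -> intble P (fun w => \1_B w * clip c (f w)) ->
    intble P (fun w => \1_B w * excess c (f w)) ->
    `|expect P (fun w => \1_B w * f w) - expect P (fun w => \1_B w * clip c (f w))|
    <= expect P (fun w => \1_B w * excess c (f w)).
  move=> i1 i2 i3; rewrite -expectB//; apply: (le_trans (le_norm_expect _)).
    exact: intbleB.
  apply: le_expect => //; first exact/intble_norm/intbleB.
  move=> w; rewrite -mulrBr normrM ger0_norm; last by rewrite indicE.
  by rewrite ler_wpM2l// clip_near.
have [_ cc] : intble P (fun w => \1_B w * clip c (stopped Y tau t w)) /\
   expect P (fun w => \1_B w * clip c (v n w)) @[n --> \oo] -->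
   expect P (fun w => \1_B w * clip c (stopped Y tau t w)).
  apply: (@expect_dominated _ _ _ P (fun n w => \1_B w * clip c (v n w)) _ (fun=> c)).
  - by move=> n; exact: intble_measurable (iclip n).
  - exact: intble_measurable iclipS.
  - apply: aeW => w; have e y : \1_B w * clip c y = \1_B w * clip c (\1_B w * y).
      by rewrite indicE; case: (w \in B); rewrite ?mul1r ?mul0r.
    rewrite e; under eq_fun do rewrite e.
    apply: cvgM; first exact: cvg_cst.
    exact: (cvg_comp _ _ (vc w) (@continuous_clip c _)).
  - exact: intble_cst.
  - move=> n w; rewrite normrM ger0_norm; last by rewrite indicE.
    by rewrite indicE; case: (w \in B); rewrite ?mul1r ?mul0r//; exact: clip_bound.
have h1 := near1 _ iS iclipS (xS c c0).1.
have h2 n := near1 _ (intble_indicM mB (ig n)) (iclip n) (intble_indicM mB (intble_excess c0 (ig n))).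
apply/ler_addgt0Pr => e e0.
move/cvgrPdist_lt: cc => /(_ e e0)[M _ /(_ M (leqnn M)) /= hM].
have := h2 M; rewrite eg => h2'.
have h3 := le_trans h1 (xS c c0).2; have h4 := le_trans h2' (xg M c c0).
rewrite /D.
set p := expect P (fun w => \1_B w * Y t w) in h4 *.
set q := expect P (fun w => \1_B w * stopped Y tau t w) in h3 *.
set p' := expect P (fun w => \1_B w * clip c (v M w)) in h4 hM *.
set q' := expect P (fun w => \1_B w * clip c (stopped Y tau t w)) in h3 hM *.
have -> : p - q = (p - p') + (q' - q) - (q' - p') by ring.
apply: (le_trans (ler_normB _ _)); apply: lerD; last exact: ltW.
apply: (le_trans (ler_normD _ _)); rewrite mulrDl mul1r; apply: lerD => //.
by rewrite distrC.
Qed.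

(** Optional stopping for cadlag martingales. On the event that tau has occurred at
    time s, the stopped process is constant after s; on its complement
    [martingale_stopped_after] applies. *)
Lemma martingale_stopped Y tau : martingale P F Y -> stopping_time F tau ->
  martingale P F (stopped Y tau).
Proof.
move=> mY stau; have [aY cY iY eY] := mY.
have aS : adapted F (stopped Y tau) by exact: adapted_stopped.
have iS t : 0 <= t -> intble P (stopped Y tau t).
  move=> t0; set A := [set w | (tau w <= 0%:E)%E].
  have FA : F 0 A by exact: stau.2.
  have mA := usual_meas uF (lexx 0) FA.
  have [h _] := martingale_stopped_after (lexx 0) t0 mY stau
    (sigma_setC (usual_sigma uF (lexx 0)) FA) (fun w (h : ~ A w) => ltac:(by rewrite ltNge; apply/negP)).
  apply: eq_intble (intbleD h (intble_indicM mA (iY 0 (lexx 0)))) => w.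
  rewrite !indicE in_setC; case: (boolP (w \in A)) => [/set_mem/= wA|_].
    have e : tau w = 0%:E by apply/eqP; rewrite eq_le wA/= stau.1.
    by rewrite stoppedE (stop_at_eq e t0) /= mul0r mul1r add0r.
  by rewrite /= mul0r mul1r addr0.
split; [exact: aS|by move=> w; apply: cadlag_stopped; [exact: stau.1|exact: cY]|exact: iS|].
move=> s t A s0 st FA; have t0 := le_trans s0 st.
have mA := usual_meas uF s0 FA.
have e u : 0 <= u -> (\int[P]_(w in A) (stopped Y tau u w)%:E)%E =
    (expect P (fun w => \1_A w * stopped Y tau u w))%:E.
  move=> u0; rewrite EFin_expect; last by apply: intble_indicM => //; exact: iS.
  rewrite integral_mkcond; apply: eq_integral => w _.
  by rewrite /patch indicE; case: ifPn => _; rewrite ?mul1r ?mul0r.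
rewrite (e t t0) (e s s0); congr EFin.
set B := [set w | (tau w <= s%:E)%E].
have FB : F s B by exact: stau.2.
have mB := usual_meas uF s0 FB.
have FAB := sigma_setD (usual_sigma uF s0) FA FB.
have mAB := usual_meas uF s0 FAB.
have [_ h] := martingale_stopped_after s0 st mY stau FAB
  (fun w (h : (A `\` B) w) => ltac:(by rewrite ltNge; apply/negP; exact: h.2)).
have spl u : 0 <= u -> expect P (fun w => \1_A w * stopped Y tau u w) =
   expect P (fun w => \1_(A `\` B) w * stopped Y tau u w) +
   expect P (fun w => \1_(A `&` B) w * stopped Y tau u w).
  move=> u0; rewrite -expectD.
  - apply: eq_expect => w; rewrite !indicE in_setD in_setI.
    by case: (w \in A); case: (w \in B); rewrite ?(mul1r,mul0r,addr0,add0r).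
  - by apply: intble_indicM => //; exact: iS.
  - by apply: intble_indicM => //; [exact: measurableI|exact: iS].
rewrite (spl t t0) (spl s s0) h (martingale_expect mY s0 st FAB); congr (_ + _); apply: eq_expect => w.
  rewrite indicE in_setD; case: (boolP (w \in A)) => //=; rewrite ?mul0r// => _.
  case: (boolP (w \in B)) => [|/negP wB] /=; rewrite ?mul0r// stoppedE stop_at_id//.
  by rewrite leNgt; apply/negP => h'; apply/wB/mem_set; rewrite /B /= ltW.
rewrite indicE in_setI; case: (boolP (w \in B)) => [/set_mem/= wB|_]; last by rewrite andbF !mul0r.
congr (_ * _).
have {}wB : (tau w <= s%:E)%E := wB.
case ew : (tau w) wB (stau.1 w) => [x| |]//; rewrite !lee_fin => xs x0.
by rewrite !stoppedE !(stop_at_eq ew)// (le_trans xs).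
Qed.

Lemma martingale_increment Y s t A : martingale P F Y -> 0 <= s -> s <= t ->
  F s A -> intble P (fun w => \1_A w * (Y t w - Y s w)) /\
    expect P (fun w => \1_A w * (Y t w - Y s w)) = 0.
Proof.
move=> mY s0 st FA; have [_ _ iY _] := mY; have t0 := le_trans s0 st.
have mA := usual_meas uF s0 FA.
have it : intble P (fun w => \1_A w * Y t w) by apply: intble_indicM => //; exact: iY.
have is' : intble P (fun w => \1_A w * Y s w) by apply: intble_indicM => //; exact: iY.
have eE w : \1_A w * Y t w - \1_A w * Y s w = \1_A w * (Y t w - Y s w) by rewrite mulrBr.
split; first by apply: eq_intble (intbleB it is').
by rewrite -(eq_expect P eE) expectB// (martingale_expect mY s0 st FA) subrr.
Qed.

(** Stopping a stopped process is stopping at the minimum; this serves to localise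
    several processes by one sequence. *)
Lemma martingale_stopped_min Y tau1 tau2 : stopping_time F tau1 ->
  stopping_time F tau2 -> martingale P F (stopped Y tau1) ->
  martingale P F (stopped Y (fun w => Order.min (tau1 w) (tau2 w))).
Proof.
move=> [h1 s1] st2 mY; have := martingale_stopped mY st2.
rewrite (_ : stopped (stopped Y tau1) tau2 = stopped Y (fun w => Order.min (tau1 w) (tau2 w)))//.
apply/funext => t; apply/funext => w; rewrite !stoppedE; congr (Y _ w).
rewrite stop_atI//; last exact: st2.1.
by congr (stop_at _ t w); apply/funext => v; rewrite minC.
Qed.

(** A nonnegative martingale started at 0 has expectation 0. This is the only use of
    the second characteristic: if it is zero, so is the continuous martingale
    part. *)
Lemma square_martingale_null Y t : adapted F Y ->
  (forall w, Y 0 w = 0) -> local_martingale P F (fun t w => Y t w * Y t w) -> 0 <= t ->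
  {ae P, forall w, Y t w = 0}.
Proof.
move=> aY Y0 [_ _ [tau [stau ntau ctau mtau]]] t0.
have h k : {ae P, forall w, stopped (fun t w => Y t w * Y t w) (tau k) t w = 0}.
  have [_ _ iY _] := mtau k; apply: expect_eq0; first exact: iY.
    by move=> w; rewrite stoppedE -expr2 sqr_ge0.
  have := martingale_expect (mtau k) (lexx 0) t0 (usual_setT uF (lexx 0)).
  under eq_expect do rewrite indicT mul1r.
  move=> ->; rewrite -[RHS](expect_cst P 0); apply: eq_expect => w.
  by rewrite indicT mul1r stoppedE (stop_at0 ((stau k).1 w)) Y0 mulr0.
apply: filterS2 (ae_foralln h) ctau => w hw /cvgeyPge/(_ t)[k _ hk].
have := hw k; rewrite stoppedE stop_at_id; last by apply: hk => /=.
by move/eqP; rewrite mulf_eq0 orbb => /eqP.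
Qed.

End optional_stopping.

(** * Exit levels *)

Section exit_times.
Context {R : realType} {disp} {T : measurableType disp}.
Variables (P : probability T R) (F : R -> set (set T)).
Hypothesis uF : usual_filtration P F.
Implicit Types (Y : R -> T -> R) (tau : T -> \bar R) (s t u K : R).

Definition exit_level Y K w : \bar R :=
  ereal_inf [set s%:E | s in [set s | 0 <= s /\ K < `|Y s w|]].

Lemma exit_level_ge0 Y K w : (0 <= exit_level Y K w)%E.
Proof. by apply: le_ereal_inf_tmp => _ [s [s0 _] <-]; rewrite lee_fin. Qed.

Lemma exit_level_before Y K s w : 0 <= s -> (s%:E < exit_level Y K w)%E ->
  `|Y s w| <= K.
Proof.
move=> s0 h; rewrite leNgt; apply/negP => h'; move: h; apply/negP; rewrite -leNgt.
by apply: ereal_inf_lbound; exists s.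
Qed.

Lemma exit_levelP Y K x w : (exit_level Y K w < x%:E)%E ->
  exists s, [/\ 0 <= s, s < x & K < `|Y s w|].
Proof.
by move=> /ereal_inf_lt[_ [s [s0 Ks] <-]]; rewrite lte_fin => sx; exists s.
Qed.

(** Right-continuity at the exit time; the inequality may be an equality. *)
Lemma exit_level_at Y K r w : cadlag (Y ^~ w) -> exit_level Y K w = r%:E ->
  K <= `|Y r w|.
Proof.
move=> cY er; rewrite leNgt; apply/negP => h.
have r0 : 0 <= r by rewrite -lee_fin -er exit_level_ge0.
have e0 : 0 < K - `|Y r w| by rewrite subr_gt0.
have [dl dl0 H] := cadlag_right cY r0 e0.
have [|s [s0 sx]] := @exit_levelP Y K (r + dl) w; first by rewrite er lte_fin ltrDl.
move=> Ks; have rs : r <= s.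
  by rewrite -lee_fin -er; apply: ereal_inf_lbound; exists s.
have := H s rs sx; have := ler_distD 0 (Y s w) (Y r w).
have := lerB_dist (Y s w) (Y r w); lra.
Qed.

(** Right-continuity lets rational times detect the exit. *)
Lemma exit_level_ltP Y K x w : cadlag (Y ^~ w) ->
  (exit_level Y K w < x%:E)%E <->
  exists q : rat, [/\ 0 <= (ratr q : R), ratr q < x & K < `|Y (ratr q) w|].
Proof.
move=> cY; split=> [/exit_levelP[s [s0 sx Ks]]|[q [q0 qx Kq]]]; last first.
  apply: (@le_lt_trans _ _ (ratr q)%:E); last by rewrite lte_fin.
  by apply: ereal_inf_lbound; exists (ratr q).
have e0 : 0 < `|Y s w| - K by rewrite subr_gt0.
have [dl dl0 H] := cadlag_right cY s0 e0.
have : s < Num.min (s + dl) x by rewrite lt_min ltrDl dl0.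
move=> /rat_in_itvoo[q]; rewrite in_itv/= lt_min => /andP[sq /andP[qd qx]].
exists q; split => //; first by rewrite (le_trans s0)// ltW.
have := H _ (ltW sq) qd; have := lerB_dist (Y s w) (Y (ratr q) w).
by rewrite distrC; lra.
Qed.

Lemma measurable_norm_gt K : measurable [set y : R | K < `|y|].
Proof.
rewrite (_ : [set y | _] = (Num.norm : R -> R) @^-1` `]K, +oo[).
  rewrite -[X in measurable X]setTI; apply: continuous_measurable_fun => //.
  exact: norm_continuous.
by apply/seteqP; split=> y /=; rewrite in_itv/= andbT.
Qed.

(** The event that the exit occurs no later than t is decided by the values at
    rational times before t + 1/n for large n: it lies in F u for all u > t, and the
    filtration is right-continuous. *)
Lemma exit_level_stopping Y K : adapted F Y -> (forall w, cadlag (Y ^~ w)) ->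
  stopping_time F (exit_level Y K).
Proof.
move=> aY cY; split=> [w|t t0]; first exact: exit_level_ge0.
apply: (usual_right uF t0) => u tu; have u0 := le_trans t0 (ltW tu).
pose I n := t + n.+1%:R^-1 <= u.
have -> : [set w | (exit_level Y K w <= t%:E)%E] =
    \bigcap_(n in [set n | I n]) \bigcup_(q in [set q : rat |
      0 <= (ratr q : R) /\ ratr q < t + n.+1%:R^-1])
        (Y (ratr q) @^-1` [set y | K < `|y|]).
  apply/seteqP; split=> w /= h.
    move=> n _ /=; have : (exit_level Y K w < (t + n.+1%:R^-1)%:E)%E.
      by apply: (le_lt_trans h); rewrite lte_fin ltrDl.
    by move=> /exit_level_ltP -/(_ (cY w))[q [q0 qx Kq]]; exists q.
  apply/lee_addgt0Pr => e e0; have m0 : 0 < Num.min e (u - t) by rewrite lt_min e0 subr_gt0.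
  have [n _ /(_ n (leqnn n)) /=] := near_infty_natSinv_lt (PosNum m0).
  rewrite /= lt_min => /andP[ne nu].
  have /(_ n) [|q [q0 qx] Kq] := h; first by rewrite /I /= -lerBrDl ltW.
  apply: (@le_trans _ _ (ratr q)%:E).
    by apply: ereal_inf_lbound; exists (ratr q).
  by rewrite -EFinD lee_fin ltW// (lt_trans qx)// ltrD2l.
apply: (sigma_bigcap (usual_sigma uF u0)) => n In.
apply: (sigma_bigcup (usual_sigma uF u0)) => q [q0 qx].
have qu : ratr q <= u by rewrite ltW// (lt_le_trans qx).
apply: (usual_mono uF q0 qu); apply: (aY _ q0).
exact: measurable_norm_gt.
Qed.

Lemma stopping_time_min tau1 tau2 : stopping_time F tau1 -> stopping_time F tau2 ->
  stopping_time F (fun w => Order.min (tau1 w) (tau2 w)).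
Proof.
move=> [h1 s1] [h2 s2]; split=> [w|t t0]; first by rewrite le_min h1 h2.
rewrite (_ : [set w | _] = [set w | (tau1 w <= t%:E)%E] `|` [set w | (tau2 w <= t%:E)%E]).
  by apply: (sigma_setU (usual_sigma uF t0)); [exact: s1|exact: s2].
by apply/seteqP; split=> w /=; rewrite ge_min => /orP.
Qed.

Lemma stopping_time_pinfty : stopping_time F (fun=> +oo%E).
Proof.
split=> // t t0; rewrite (_ : [set w | _] = set0); first exact: (sigma_set0 (usual_sigma uF t0)).
by apply/seteqP; split=> w //=; rewrite leye_eq.
Qed.

Lemma exit_level_after Y K t w : (forall s, 0 <= s -> s <= t -> `|Y s w| <= K) ->
  (t%:E <= exit_level Y K w)%E.
Proof.
move=> YK; apply: le_ereal_inf_tmp => _ [s [s0 Ks] <-]; rewrite lee_fin leNgt.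
by apply/negP => st; have := YK s s0 (ltW st); rewrite leNgt Ks.
Qed.

Lemma exceed_setE Y K t : (forall w, cadlag (Y ^~ w)) -> 0 <= t ->
  [set w | exists s, [/\ 0 <= s, s <= t & K < `|Y s w|]] =
  \bigcup_(q in [set q : rat | 0 <= (ratr q : R) /\ ratr q < t]) (Y (ratr q) @^-1` [set y | K < `|y|])
   `|` Y t @^-1` [set y | K < `|y|].
Proof.
move=> cY t0; apply/seteqP; split=> w /=.
  move=> [s [s0]]; rewrite le_eqVlt => /predU1P[-> Kt|st Ks]; first by right.
  left; have : (exit_level Y K w < t%:E)%E.
    apply: (@le_lt_trans _ _ s%:E); last by rewrite lte_fin.
    by apply: ereal_inf_lbound; exists s.
  by move=> /(exit_level_ltP _ _ (cY w))[q [q0 qt Kq]]; exists q.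
move=> [[q [q0 qt] Kq]|Kt]; last by exists t.
by exists (ratr q); split => //; exact: ltW.
Qed.

Lemma exceed_measurable Y K t : adapted F Y -> (forall w, cadlag (Y ^~ w)) -> 0 <= t ->
  F t [set w | exists s, [/\ 0 <= s, s <= t & K < `|Y s w|]].
Proof.
move=> aY cY t0; rewrite exceed_setE//; apply: (sigma_setU (usual_sigma uF t0)).
  apply: (sigma_bigcup (usual_sigma uF t0)) => q [q0 qt].
  by apply: (usual_mono uF q0 (ltW qt)); apply: aY => //; exact: measurable_norm_gt.
by apply: aY => //; exact: measurable_norm_gt.
Qed.

End exit_times.

(** * The augmented natural filtration *)

Section augmented_filtration.
Context {R : realType} {disp} {T : measurableType disp}.
Variables (P : probability T R).
Context {dV : measure_display} {V : measurableType dV} (X : R -> T -> V).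
Hypothesis mX : forall t, 0 <= t -> measurable_fun setT (X t).
Local Notation F := (natural_filtration X).

Lemma natural_filtration_sigma t : sigma_algebra setT (F t).
Proof. exact: smallest_sigma_algebra. Qed.

Lemma natural_filtration_measurable t : F t `<=` measurable.
Proof.
apply: smallest_sub; first exact: sigma_algebra_measurable.
move=> A [u /= us [B mB <-]]; apply: mX => //.
by move: us; rewrite in_itv/= => /andP[].
Qed.

(** An event of the augmentation at every u > t coincides, up to null sets, with
    events B_n of the natural filtration immediately after t + 1/n; their upper
    limit belongs to the natural filtration immediately after t. *)
Lemma augmentation_usual : usual_filtration P (augmentation P F).
Proof.
have sF u := natural_filtration_sigma u.
have Fcap t : sigma_algebra setT (\bigcap_(u in `]t, +oo[) F u).
  split.
  - by move=> u _; exact: (sigma_set0 (sF u)).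
  - by move=> A hA u ut; rewrite setTD; exact: (sigma_setC (sF u) (hA u ut)).
  - by move=> A hA u ut; apply: (sigma_bigcup (sF u)) => n _; exact: (hA n u ut).
have capm t : \bigcap_(u in `]t, +oo[) F u `<=` measurable.
  move=> A hA; apply: (natural_filtration_measurable (t := t + 1)).
  by apply: hA; rewrite /= in_itv/= andbT ltrDl.
split.
- move=> t t0; split.
  + split; first exact: measurable0.
    exists set0; first exact: (sigma_set0 (Fcap t)).
    by rewrite setYK measure0.
  + move=> A [mA [B hB AB]]; rewrite setTD; split; first exact: measurableC.
    exists (~` B); first exact: (sigma_setC (Fcap t)).
    rewrite (_ : _ `+` _ = A `+` B)//; apply/seteqP; split=> w; rewrite /setY /=.
      by case=> [[a nb]|[nb na]]; [right; split => //; exact: contrapT|left; split => //; exact: contrapT].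
    by case=> [[a nb]|[b na]]; [right|left]; split => //; apply.
  + move=> A hA; split; first by apply: bigcupT_measurable => n; have [] := hA n.
    have /choice[B hB] n : exists B, (\bigcap_(u in `]t, +oo[) F u) B /\ P (A n `+` B) = 0%E.
      by have [_ [B ? ?]] := hA n; exists B.
    exists (\bigcup_n B n).
      by apply: (sigma_bigcup (Fcap t)) => n _; have [] := hB n.
    have mAB n : measurable (A n `+` B n).
      have mA : measurable (A n) by have [] := hA n.
      have mB : measurable (B n) by exact: (capm _ _ (hB n).1).
      by apply: measurableU; exact: measurableD.
    have sub : \bigcup_n A n `+` \bigcup_n B n `<=` \bigcup_n (A n `+` B n).
      move=> w [[[n _ An] nB]|[[n _ Bn] nA]]; exists n => //.
        by left; split => // Bn; apply: nB; exists n.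
      by right; split => // An; apply: nA; exists n.
    have mU : measurable (\bigcup_n A n `+` \bigcup_n B n).
      have mUA : measurable (\bigcup_n A n).
        by apply: bigcupT_measurable => n; have [] := hA n.
      have mUB : measurable (\bigcup_n B n).
        by apply: bigcupT_measurable => n; exact: (capm _ _ (hB n).1).
      by apply: measurableU; exact: measurableD.
    apply/eqP; rewrite eq_le measure_ge0 andbT.
    have := @measure_sigma_subadditive _ _ _ P _ _ mAB mU sub.
    by rewrite eseries0// => n _ _; exact: (hB n).2.
- move=> s t s0 st A [mA [B hB AB]]; split => //; exists B => // u.
  by rewrite /= in_itv/= andbT => tu; apply: hB; rewrite /= in_itv/= andbT (le_lt_trans st).
- by move=> t t0 A [].
- move=> t A t0 hA.
  have mA : measurable A by have [] := hA (t + 1); rewrite ?ltrDl.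
  split => //.
  pose v n : R := t + n.+1%:R^-1.
  have tv n : t < v n by rewrite /v ltrDl.
  have /choice[B hB] n : exists B, (\bigcap_(u in `]v n, +oo[) F u) B /\ P (A `+` B) = 0%E.
    by have [_ [B ? ?]] := hA (v n) (tv n); exists B.
  have mB n : measurable (B n) by exact: (capm _ _ (hB n).1).
  (* Only the indices n >= N matter for the upper limit, and B n is then known
     before u. *)
  exists (\bigcap_k \bigcup_(n in [set n | (k <= n)%N]) B n).
    move=> u; rewrite /= in_itv/= andbT => tu.
    have ut0 : 0 < u - t by rewrite subr_gt0.
    have [N _ HN] := near_infty_natSinv_lt (PosNum ut0).
    rewrite (_ : \bigcap_k _ = \bigcap_(k in [set k | (N <= k)%N]) \bigcup_(n in [set n | (k <= n)%N]) B n).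
      apply: (sigma_bigcap (sF u)) => k /= Nk; apply: (sigma_bigcup (sF u)) => n /= kn.
      apply: (hB n).1; rewrite /= in_itv/= andbT /v -ltrBrDl.
      by apply: HN => /=; exact: leq_trans kn.
    apply/seteqP; split=> w h k; first by move=> _; exact: h.
    move=> _; have [n /= kn Bn] := h (maxn N k) (leq_maxl _ _).
    by exists n => //=; apply: leq_trans kn; exact: leq_maxr.
  have mAB n : measurable (A `+` B n).
    by apply: measurableU; exact: measurableD.
  set L := \bigcap_k _.
  have mL : measurable L.
    apply: bigcapT_measurable => k; apply: bigcup_measurable => n _; exact: mB.
  have sub : A `+` L `<=` \bigcup_n (A `+` B n).
    move=> w [[Aw nL]|[Lw nA]].
      apply: contrapT => h; apply: nL => k _; exists k => //=.
      by apply: contrapT => nB; apply: h; exists k => //; left.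
    have [n _ Bn] := Lw 0%N Logic.I; exists n => //; right; split => //.
  apply/eqP; rewrite eq_le measure_ge0 andbT.
  have mAL : measurable (A `+` L) by apply: measurableU; exact: measurableD.
  have := @measure_sigma_subadditive _ _ _ P _ _ mAB mAL sub.
  by rewrite eseries0// => n _ _; exact: (hB n).2.
- move=> t A t0 mA A0; split => //; exists set0; first exact: (sigma_set0 (Fcap t)).
  by rewrite setY0.
Qed.

Lemma augmentation_adapted t B : 0 <= t -> measurable B ->
  augmentation P F t (X t @^-1` B).
Proof.
move=> t0 mB; have FB u : t <= u -> F u (X t @^-1` B).
  move=> tu; apply: sub_sigma_algebra; exists t; first by rewrite /= in_itv/= t0.
  by exists B => //; rewrite setTI.
split; first exact: (natural_filtration_measurable (FB t (lexx t))).
exists (X t @^-1` B); last by rewrite setYK measure0.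
by move=> u; rewrite /= in_itv/= andbT => tu; apply: FB; exact: ltW.
Qed.

End augmented_filtration.

(** * Jumps of a cadlag path and their sums *)

Section cadlag_jumps.
Context {R : realType} {d : nat}.
Implicit Types (f : R -> 'cV[R]_d) (s t u v eta dl e : R) (g : 'cV[R]_d -> R).

(** The basic regularity of cadlag paths, by compactness: outside finitely many
    times the path oscillates little. Each s has one-sided neighbourhoods on which
    the oscillation is less than eta, and an interval that contains no centre of the
    finite subcover lies on one side of the centre that covers it. *)
Lemma cadlag_oscillation f t eta : cadlag f -> 0 <= t -> 0 < eta ->
  exists (D : seq R) dl, [/\ 0 < dl, forall s, s \in D -> 0 <= s <= t &
    forall u v, 0 <= u -> u <= v -> v <= t -> v - u < dl ->
      (forall s, s \in D -> ~~ (u < s <= v)) -> `|f v - f u| < eta].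
Proof.
move=> cf t0 eta0.
pose Q s dl := [/\ 0 < dl,
  forall u v, s <= u -> u < s + dl -> s <= v -> v < s + dl -> `|f u - f v| < eta &
  forall u v, 0 <= u -> s - dl < u -> u < s -> 0 <= v -> s - dl < v -> v < s -> `|f u - f v| < eta].
have e2 : 0 < eta / 2 by rewrite divr_gt0.
have exQ s : exists dl, 0 <= s <= t -> Q s dl.
  have [s0|] := boolP (0 <= s <= t); last by exists 1.
  have /andP[{}s0 st] := s0.
  have [d1 d10 H1] := cadlag_right cf s0 e2.
  have H1' u v : s <= u -> u < s + d1 -> s <= v -> v < s + d1 -> `|f u - f v| < eta.
    move=> su ud sv vd; have := H1 u su ud; have := H1 v sv vd.
    by have := ler_distD (f s) (f u) (f v); rewrite (distrC (f s) (f v)); lra.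
  have [s00|sp] := eqVneq s 0.
    by exists d1 => _; split => // u v u0 _; rewrite s00 ltNge u0.
  have {}sp : 0 < s by rewrite lt_neqAle eq_sym sp.
  have [d2 d20 H2] := cadlag_left cf sp e2.
  exists (Num.min d1 d2) => _; split; first by rewrite lt_min d10.
    by move=> u v su ud sv vd; apply: H1' => //;
      [apply: (lt_le_trans ud)|apply: (lt_le_trans vd)]; rewrite lerD2l ge_min lexx.
  move=> u v _ ud us _ vd vs.
  have h x : s - Num.min d1 d2 < x -> s - d2 < x.
    by apply: le_lt_trans; rewrite lerD2l lerN2 ge_min lexx orbT.
  have := H2 u (h _ ud) us; have := H2 v (h _ vd) vs.
  set l := lim _; have := ler_distD l (f u) (f v); rewrite (distrC l (f v)); lra.
have [dl hdl] := choice exQ.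
have dl0' s : 0 <= s <= t -> 0 < dl s by move=> /hdl[].
have [D [m [m0 DD cov]]] := lebesgue_number dl0'.
exists D, m; split => // u v u0 uv vt uvm nD.
have [|s [sD /andP[su us] ms]] := cov u; first by rewrite u0 (le_trans uv).
have [dl0 Hr Hl] := hdl s (DD s sD).
have vs : v < s + dl s by lra.
have su' : s - dl s < u by lra.
have [h|h] := leP s u.
  by rewrite distrC; apply: Hr => //; lra.
have {}h : v < s by rewrite ltNge; apply: contra (nD s sD) => ->; rewrite h.
by rewrite distrC; apply: Hl => //; lra.
Qed.

(** The list r may also contain times of small or zero jumps; it is enough that no
    jump of size at least e is missing. *)
Definition big_jumps_in f (e t : R) (r : seq R) : Prop :=
  [/\ sorted <%R r, forall s, s \in r -> 0 < s <= t &
      forall s, 0 < s -> s <= t -> s \notin r -> `|jump f s| < e].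

Lemma jump_le_oscillation f s e : cadlag f -> 0 < s ->
  (exists2 dl, 0 < dl & forall u, 0 <= u -> s - dl < u -> u < s -> `|f s - f u| <= e) ->
  `|jump f s| <= e.
Proof.
move=> cf s0 [dl dl0 H]; apply/ler_addgt0Pr => e' e0.
have [d1 d10 H1] := cadlag_left cf s0 e0.
have m0 : 0 < Num.min s (Num.min dl d1) by rewrite !lt_min s0 dl0 d10.
pose u := s - Num.min s (Num.min dl d1) / 2.
have m1 : Num.min s (Num.min dl d1) <= s by rewrite ge_min lexx.
have m2 : Num.min s (Num.min dl d1) <= dl by rewrite !ge_min lexx orbT.
have m3 : Num.min s (Num.min dl d1) <= d1 by rewrite !ge_min lexx !orbT.
have h1 : `|f s - f u| <= e by apply: H; rewrite /u; lra.
have h2 := H1 u; rewrite /jump.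
have {}h2 : `|f u - lim (f v @[v --> s^'-])| < e' by apply: h2; rewrite /u; lra.
set l := lim _ in h2 *; have := ler_distD (f u) (f s) l; lra.
Qed.

Lemma big_jumps_exist f e t : cadlag f -> 0 < e -> 0 <= t ->
  exists r, big_jumps_in f e t r.
Proof.
move=> cf e0 t0; have e2 : 0 < e / 2 by rewrite divr_gt0.
have [D [dl [dl0 Dt H]]] := cadlag_oscillation cf t0 e2.
exists (sort <=%R (undup [seq s <- D | 0 < s])); split.
- by rewrite sort_lt_sorted undup_uniq.
- move=> s; rewrite mem_sort mem_undup mem_filter => /andP[-> /Dt /andP[]//].
- move=> s s0 st; rewrite mem_sort mem_undup mem_filter s0/= => nD.
  apply: (@le_lt_trans _ _ (e / 2)); last by lra.
  apply: jump_le_oscillation => //.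
  have Dm : exists2 m, 0 < m & forall x, x \in D -> x < s -> m <= s - x.
    elim: (D) => [|a r [m m0 hm]]; first by exists 1.
    have [as'|as'] := ltP a s.
      exists (Num.min m (s - a)); first by rewrite lt_min m0 subr_gt0.
      move=> x; rewrite inE => /orP[/eqP -> _|xr xs]; first by rewrite ge_min lexx orbT.
      by rewrite ge_min hm.
    exists m => // x; rewrite inE => /orP[/eqP ->|]; last exact: hm.
    by rewrite ltNge as'.
  have [m m0 hm] := Dm.
  exists (Num.min dl m); first by rewrite lt_min dl0.
  move=> u u0; rewrite ltrBlDr -ltrBlDl lt_min => /andP[udl um] us; apply/ltW/H => //.
    exact: ltW.
  move=> x xD; apply/negP => /andP[ux xs].
  have xs' : x < s.
    by rewrite lt_neqAle xs andbT; apply: contraNneq nD => <-.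
  by have := hm x xD xs'; lra.
Qed.

End cadlag_jumps.

Section jump_sums.
Context {R : realType} {d : nat}.
Implicit Types (f : R -> 'cV[R]_d) (s t u v e N dl : R) (g : 'cV[R]_d -> R) (r : seq R).

Definition vanish_near0 g e := forall y, `|y| < e -> g y = 0.

(** The support of g (jump f s) on ]0, t] is finite when f is cadlag and g vanishes
    near 0, so that the sum is a genuine one. *)
Definition jump_sum g f t : R := \sum_(s \in `]0, t]) g (jump f s).

(** The left limit at t of the sum of jumps. *)
Definition jump_sum_left g f t : R := jump_sum g f t - g (jump f t).

Lemma jump_sumE g f e N r t : vanish_near0 g e -> big_jumps_in f e N r ->
  t <= N -> jump_sum g f t = \sum_(s <- r | s <= t) g (jump f s).
Proof.
move=> ge [sr r0 rj] tN.
have ur : uniq r by exact: (sorted_uniq lt_trans ltxx sr).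
have inE' s : (s \in `]0, t]%classic) = (0 < s <= t) by rewrite mem_setE in_itv.
rewrite /jump_sum (fsbigE [seq s <- r | s <= t]).
- rewrite big_filter_cond big_seq_cond [RHS]big_seq_cond; apply: eq_bigl => s.
  rewrite inE'; case: (boolP (s \in r)) => //= /r0/andP[-> _] /=.
  by rewrite andbb.
- by rewrite filter_uniq.
- move=> s /=; rewrite mem_filter => /andP[st /r0/andP[s0 _]].
  by rewrite /= in_itv/= s0.
- move=> s /=; rewrite in_itv/= mem_filter => /andP[s0 st]; rewrite st/= => nr.
  by apply: ge; apply: rj => //; rewrite (le_trans st).
Qed.

Lemma sum_le_lt (a : R -> R) r s : uniq r -> (s \notin r -> a s = 0) ->
  \sum_(x <- r | x <= s) a x - a s = \sum_(x <- r | x < s) a x.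
Proof.
move=> ur as0; rewrite (bigID (fun x => x == s))/=.
rewrite (eq_bigl (fun x => x == s)); last first.
  by move=> x; case: eqVneq => [->|]; rewrite ?lexx ?andbF.
rewrite -big_filter (_ : [seq x <- r | x == s] = if s \in r then [:: s] else [::]); last first.
  case: ifPn => srr; first by rewrite filter_pred1_uniq.
  by apply/eqP; rewrite -(negbK (_ == _)) -has_filter; apply: contra srr => /hasP[x xr /eqP <-].
rewrite [X in _ + X - _](eq_bigl (fun x => x < s)); last first.
  by move=> x; rewrite lt_neqAle andbC.
case: ifPn => srr; first by rewrite big_seq1 addrAC subrr add0r.
by rewrite big_nil add0r as0 ?subr0.
Qed.

Lemma jump_sum_leftE g f e N r s : vanish_near0 g e -> big_jumps_in f e N r ->
  0 < s -> s <= N -> jump_sum_left g f s = \sum_(x <- r | x < s) g (jump f x).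
Proof.
move=> ge rN s0 sN; rewrite /jump_sum_left (jump_sumE ge rN sN).
have [sr r0 rj] := rN.
apply: (@sum_le_lt (fun x => g (jump f x))) => [|srr].
  exact: (sorted_uniq lt_trans ltxx sr).
by apply: ge; apply: rj.
Qed.

Lemma big_gap r s : exists2 dl, 0 < dl & forall x, x \in r -> x != s -> dl <= `|x - s|.
Proof.
elim: r => [|a r [m m0 hm]]; first by exists 1.
have [->|as'] := eqVneq a s.
  by exists m => // x; rewrite inE => /orP[/eqP ->|]; [rewrite eqxx|exact: hm].
exists (Num.min m `|a - s|); first by rewrite lt_min m0 normr_gt0 subr_eq0.
move=> x; rewrite inE => /orP[/eqP -> _|xr xs]; first by rewrite ge_min lexx orbT.
by rewrite ge_min hm.
Qed.

(** A sum over the big jumps is a step function, constant to the right of each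
    time. *)
Lemma jump_sum_near_right g f e t : cadlag f -> 0 < e -> vanish_near0 g e -> 0 <= t ->
  exists2 dl, 0 < dl & forall u, t <= u -> u < t + dl -> jump_sum g f u = jump_sum g f t.
Proof.
move=> cf e0 ge t0; have [r rN] := big_jumps_exist cf e0 (addr_ge0 t0 ler01).
have [m m0 hm] := big_gap r t.
exists (Num.min 1 m); first by rewrite lt_min ltr01.
move=> u tu; rewrite -ltrBlDl lt_min => /andP[u1 um].
rewrite !(jump_sumE ge rN) ?lerDl//; last by lra.
rewrite big_seq_cond [RHS]big_seq_cond; apply: eq_bigl => s.
case: (boolP (s \in r)) => //= sr; apply/idP/idP => [su|st]; last exact: le_trans tu.
rewrite leNgt; apply/negP => ts; have := hm s sr; rewrite gt_eqF// => /(_ isT).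
by rewrite ger0_norm ?subr_ge0 ?(ltW ts)//; lra.
Qed.

Lemma jump_sum_near_left g f e t : cadlag f -> 0 < e -> vanish_near0 g e -> 0 < t ->
  exists2 dl, 0 < dl & forall u, 0 <= u -> t - dl < u -> u < t -> jump_sum g f u = jump_sum_left g f t.
Proof.
move=> cf e0 ge t0; have [r rN] := big_jumps_exist cf e0 (ltW t0).
have [m m0 hm] := big_gap r t.
exists m => // u u0 um ut.
rewrite (jump_sumE ge rN) ?(jump_sum_leftE ge rN) ?(ltW ut)//.
rewrite big_seq_cond [RHS]big_seq_cond; apply: eq_bigl => s.
case: (boolP (s \in r)) => //= sr; apply/idP/idP => [su|st]; first exact: le_lt_trans ut.
rewrite leNgt; apply/negP => us; have := hm s sr; rewrite lt_eqF// => /(_ isT).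
by rewrite ltr0_norm ?subr_lt0//; lra.
Qed.

Lemma jump_sum0 g f : jump_sum g f 0 = 0.
Proof.
rewrite /jump_sum (_ : `]0, 0]%classic = set0) ?fsbig_set0//.
by apply/seteqP; split=> x //=; rewrite in_itv/= => /andP[/lt_le_trans h /h]; rewrite ltxx.
Qed.

Lemma cadlag_jump_sum g f e : cadlag f -> 0 < e -> vanish_near0 g e ->
  cadlag (jump_sum g f).
Proof.
move=> cf e0 ge; apply: (@cadlagI _ _ _ (jump_sum_left g f)) => t e' t0 e'0.
  have [dl dl0 H] := jump_sum_near_right cf e0 ge t0.
  by exists dl => // u tu ud; rewrite H ?ltW// subrr normr0.
have [dl dl0 H] := jump_sum_near_left cf e0 ge t0.
exists (Num.min t dl); first by rewrite lt_min t0.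
move=> u; rewrite ltrBlDr -ltrBlDl lt_min => /andP[h1 h2] ut.
by rewrite H ?subrr ?normr0//; lra.
Qed.

(** The square of a sum along an increasing list: each term meets twice the sum of
    its predecessors, and itself. This is Ito's formula for a step function. *)
Lemma sum_sqr_sorted (a : R -> R) r : sorted <%R r ->
  (\sum_(s <- r) a s) ^+ 2 =
  \sum_(s <- r) (2 * (\sum_(x <- r | x < s) a x) * a s + a s ^+ 2).
Proof.
elim: r => [|b r ih] sr; first by rewrite !big_nil expr0n.
have [br sr'] : all (> b) r /\ sorted <%R r.
  by move: sr; rewrite /= lt_path_sortedE => /andP[].
have h0 : \sum_(x <- b :: r | x < b) a x = 0.
  rewrite big_cons ltxx big_seq_cond big1// => x /andP[/(allP br) bx].
  by rewrite ltNge ltW.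
have hs s : s \in r -> \sum_(x <- b :: r | x < s) a x = a b + \sum_(x <- r | x < s) a x.
  by move=> /(allP br) /= bs; rewrite big_cons bs.
rewrite [RHS]big_cons h0 mulr0 mul0r add0r big_cons sqrrD (ih sr') -addrA; congr (_ + _).
rewrite [RHS](eq_big_seq (fun s => 2 * a b * a s +
    (2 * (\sum_(x <- r | x < s) a x) * a s + a s ^+ 2))).
  by rewrite [RHS]big_split/= -mulr_sumr -mulr_natl mulrA.
by move=> s sr0; rewrite hs// mulrDr mulrDl addrA.
Qed.

(** The square of a sum of jumps is itself a sum over jumps, with a predictable
    factor: this is what gives access to the variance through the compensator. *)
Lemma jump_sum_sqr g f e N r t : vanish_near0 g e -> big_jumps_in f e N r ->
  t <= N -> jump_sum g f t ^+ 2 =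
  \sum_(s <- r | s <= t) (2 * jump_sum_left g f s * g (jump f s) + g (jump f s) ^+ 2).
Proof.
move=> ge rN tN; have [sr r0 rj] := rN.
rewrite (jump_sumE ge rN tN) -[in LHS]big_filter -[in RHS]big_filter.
rewrite (sum_sqr_sorted (fun s => g (jump f s))); last by rewrite sorted_filter//; exact: lt_trans.
apply: eq_big_seq => s; rewrite mem_filter => /andP[st /r0 /andP[s0 sN]].
rewrite (jump_sum_leftE ge rN s0 sN) big_filter_cond; congr (2 * _ * _ + _).
apply: eq_bigl => x; case: (ltP x s) => xs; last by rewrite andbF.
by rewrite andbT ltW// (lt_le_trans xs).
Qed.

Lemma esum_jumps f r (W : R -> \bar R) : uniq r -> (forall s, (0 <= W s)%E) ->
  (forall s, s \in r -> 0 < s) ->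
  (forall s, s \in r -> jump f s = 0 -> W s = 0%E) ->
  (forall s, 0 < s -> s \notin r -> W s = 0%E) ->
  (\esum_(s in [set s : R | 0 < s /\ jump f s != 0%R]%R) W s = \sum_(s <- r) W s)%E.
Proof.
move=> ur W0 r0 rj rW.
have -> : (\esum_(s in [set s : R | 0 < s /\ jump f s != 0%R]%R) W s =
    \esum_(s in [set` r]) W s)%E.
  rewrite esum_mkcond [RHS]esum_mkcond; apply: eq_esum => s _.
  have [sr|sr] := boolP (s \in r).
    rewrite [X in _ = if X then _ else _]mem_set//.
    case: ifPn => // /negP h; apply/esym/rj => //; apply: contrapT => j0.
    by apply: h; apply/mem_set; split; [exact: r0|exact/eqP].
  rewrite [X in _ = if X then _ else _]memNset ?(negbTE sr)//=; last exact/negP.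
  by case: ifPn => // /set_mem[/= s0 _]; exact: rW.
rewrite esum_fset; [|exact: finite_seq|by move=> i _; exact: W0].
exact/esym/fsbig_seq.
Qed.

Lemma sum_iota_map (I : eqType) (K : I -> nat) (D : seq I) (n : nat) (F : nat -> R) :
  uniq D -> {in D &, injective K} -> (forall i, i \in D -> (K i < n)%N) ->
  (forall k, (k < n)%N -> (forall i, i \in D -> K i != k) -> F k = 0) ->
  \sum_(k < n) F k = \sum_(i <- D) F (K i).
Proof.
move=> uD Kinj Kn F0; rewrite -(big_mkord xpredT) /index_iota subn0 -(big_map K xpredT).
rewrite -(@big_rmcond_in _ _ _ _ (iota 0 n) (fun k => k \in map K D)).
  rewrite -big_filter; apply: perm_big; apply: uniq_perm.
  - by rewrite filter_uniq// iota_uniq.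
  - by rewrite map_inj_in_uniq.
  - move=> k; rewrite mem_filter mem_iota/= add0n; case: (boolP (k \in map K D)) => //=.
    by move=> /mapP[i iD ->]; rewrite Kn.
move=> k; rewrite mem_iota add0n => /andP[_ kn] kD; apply: F0 => // i iD.
by apply: contraNneq kD => <-; apply: map_f.
Qed.

Lemma grid_index t s n : 0 < t -> 0 < s -> s <= t ->
  exists k : nat, [/\ (k < n.+1)%N, t * k%:R / n.+1%:R < s & s <= t * k.+1%:R / n.+1%:R].
Proof.
move=> t0 s0 st; pose P k := s <= t * k.+1%:R / n.+1%:R.
have exP : exists k, P k by exists n; rewrite /P mulfK.
case: (ex_minnP exP) => k Pk kmin; exists k; split => //.
  by rewrite ltnS; apply: kmin; rewrite /P mulfK.
rewrite ltNge; apply/negP; case: k Pk kmin => [|k] Pk kmin h.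
  by move: h; rewrite mulr0 mul0r leNgt s0.
by have := kmin k h; rewrite ltnn.
Qed.

Lemma cvg_sum_seq (I : eqType) (D : seq I) (a : I -> nat -> R) (l : I -> R) :
  (forall i, i \in D -> a i n @[n --> \oo] --> l i) ->
  \sum_(i <- D) a i n @[n --> \oo] --> \sum_(i <- D) l i.
Proof.
elim: D => [|i D ih] h.
  by rewrite big_nil; under eq_fun do rewrite big_nil; exact: cvg_cst.
rewrite big_cons; under eq_fun do rewrite big_cons.
apply: cvgD; first by apply: h; rewrite mem_head.
by apply: ih => j jD; apply: h; rewrite inE jD orbT.
Qed.

(** On a fine grid, each big jump falls in one cell and distinct ones in distinct
    cells; there the increment of f tends to the jump. In the other cells the
    increment is too small to be seen by g. Hence a sum of jumps is a limit of
    functions of finitely many values of the path, which proves it adapted. *)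
Lemma jump_sum_riemann g f e t : cadlag f -> continuous g -> 0 < e ->
  vanish_near0 g e -> 0 <= t ->
  \sum_(k < n.+1) g (f (t * k.+1%:R / n.+1%:R) - f (t * k%:R / n.+1%:R)) @[n --> \oo]
    --> jump_sum g f t.
Proof.
move=> cf cg e0 ge t0.
have [->|tn0] := eqVneq t 0.
  rewrite jump_sum0 (_ : (fun n => _) = fun=> 0); first exact: cvg_cst.
  by apply/funext => n; rewrite big1// => k _; rewrite !mul0r subrr ge// normr0.
have {tn0}tp : 0 < t by rewrite lt_neqAle eq_sym tn0.
have [D [dl [dl0 Dt H]]] := cadlag_oscillation cf t0 e0.
have [r rt] := big_jumps_exist cf e0 t0; have [sr r0 rj] := rt.
(* D' contains the times of the big jumps and those around which f oscillates. *)
pose D' := undup ([seq s <- D | 0 < s] ++ r).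
have D't s : s \in D' -> 0 < s <= t.
  rewrite mem_undup mem_cat mem_filter => /orP[/andP[-> /Dt/andP[_ ->]]//|/r0//].
have JD : jump_sum g f t = \sum_(s <- D') g (jump f s).
  rewrite /jump_sum (fsbigE D' _); first last.
  - move=> s; rewrite /= in_itv/= => /andP[s0 st] sD; apply/ge/rj => //.
    by apply: contra sD => sr'; rewrite mem_undup mem_cat sr' orbT.
  - by move=> s /= /D't; rewrite in_itv.
  - exact: undup_uniq.
  rewrite big_seq_cond [RHS]big_seq_cond; apply: eq_bigl => s.
  case: (boolP (s \in D')) => //= /D't h; apply/mem_set.
  by rewrite /= in_itv.
have [m m0 hm] : exists2 m, 0 < m & forall x y, x \in D' -> y \in D' -> x != y -> m <= `|x - y|.
  have : forall l : seq R, exists2 m, 0 < m & forall x y, x \in D' -> y \in l -> x != y -> m <= `|x - y|.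
    elim=> [|a l [m m0 hm]]; first by exists 1.
    have [m' m'0 hm'] := big_gap D' a; exists (Num.min m m'); first by rewrite lt_min m0.
    move=> x y xD; rewrite inE => /orP[/eqP -> xa|yl xy]; first by rewrite ge_min hm' ?orbT.
    by rewrite ge_min hm.
  by move=> /(_ D').
pose u n k : R := t * k%:R / n.+1%:R.
have uS n k : u n k.+1 = u n k + t / n.+1%:R.
  by rewrite /u -natr1 mulrDr mulr1 mulrDl.
have [K hK] : exists K : nat -> R -> nat, forall n s, s \in D' ->
    [/\ (K n s < n.+1)%N, u n (K n s) < s & s <= u n (K n s).+1].
  have ex (p : nat * R) : exists k : nat, p.2 \in D' ->
      [/\ (k < p.1.+1)%N, u p.1 k < p.2 & p.2 <= u p.1 k.+1].
    have [/D't/andP[s0 st]|] := boolP (p.2 \in D'); last by exists 0%N.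
    by have [k hk] := grid_index p.1 tp s0 st; exists k.
  by have [K hK] := choice ex; exists (fun n s => K (n, s)) => n s sD; exact: (hK (n, s)).
have u0 n k : 0 <= u n k by rewrite /u !mulr_ge0.
have ut n k : (k <= n.+1)%N -> u n k <= t.
  by move=> kn; rewrite /u ler_pdivrMr// ler_wpM2l// ler_nat.
have ule n k l : (k <= l)%N -> u n k <= u n l.
  by move=> kl; rewrite /u ler_wpM2r// ler_wpM2l// ler_nat.
have mesh x : 0 < x -> \forall n \near \oo, t / n.+1%:R < x.
  move=> x0; have xt : 0 < x / t by rewrite divr_gt0.
  near=> n; rewrite -ltr_pdivlMl// mulrC.
  by near: n; exact: near_infty_natSinv_lt (PosNum xt).
have cvK s : s \in D' -> g (f (u n (K n s).+1) - f (u n (K n s))) @[n --> \oo] --> g (jump f s).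
  move=> sD; have /andP[s0 st] := D't s sD.
  suff h : f (u n (K n s).+1) - f (u n (K n s)) @[n --> \oo] --> jump f s.
    exact: (cvg_comp _ _ h (cg _)).
  apply: cvgB; apply/cvgrPdist_lt => e' e'0.
    have [d1 d10 H1] := cadlag_right cf (ltW s0) e'0.
    near=> n; have [kn us su] := hK n s sD.
    rewrite distrC; apply: H1 => //; rewrite uS.
    have : t / n.+1%:R < d1 by near: n; exact: mesh.
    by move: (t / n.+1%:R) us => b us; lra.
  have [d1 d10 H1] := cadlag_left cf s0 e'0.
  near=> n; have [kn us su] := hK n s sD.
  rewrite distrC; apply: H1 => //; rewrite uS in su.
  have : t / n.+1%:R < d1 by near: n; exact: mesh.
  by move: (t / n.+1%:R) su us => b su us; lra.
rewrite JD.
have cvS : \sum_(s <- D') g (f (u n (K n s).+1) - f (u n (K n s))) @[n --> \oo] --> \sum_(s <- D') g (jump f s).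
  exact: (@cvg_sum_seq _ _ (fun s n => g (f (u n (K n s).+1) - f (u n (K n s))))).
apply: cvg_trans cvS; apply: near_eq_cvg; near=> n.
apply/esym; apply: (@sum_iota_map _ (K n) D' n.+1 (fun k => g (f (u n k.+1) - f (u n k)))).
- exact: undup_uniq.
- move=> x y xD yD Kxy; apply/eqP; apply: contrapT => /negP xy.
  have := hm x y xD yD xy; have [_ a1 a2] := hK n x xD; have [_ b1 b2] := hK n y yD.
  have : t / n.+1%:R < m by near: n; exact: mesh.
  rewrite Kxy in a1 a2; rewrite uS in a2 b2.
  by move: (t / n.+1%:R) a2 b2 => b a2 b2; case: (ger0P (x - y)); lra.
- by move=> s sD; have [] := hK n s sD.
- move=> k kn nK; apply: ge; apply: H => //.
  + exact: ule.
  + exact: ut.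
  + rewrite uS addrAC subrr add0r; near: n; exact: mesh.
  + move=> s sD; apply/negP => /andP[us su].
    have sD' : s \in D'.
      by rewrite mem_undup mem_cat mem_filter sD (le_lt_trans _ us).
    have := nK s sD'; have [_ a1 a2] := hK n s sD'; rewrite neq_ltn => /orP[h|h].
      by have := ule n _ _ h; lra.
    by have := ule n _ _ h; lra.
Unshelve. all: by end_near. Qed.

End jump_sums.

(** * Vectors: measurability and the Euclidean norm *)

Lemma measurable_open {R : realType} {m n} (A : set 'M[R]_(m, n)) : open A -> measurable A.
Proof. by move=> oA; exact: sub_sigma_algebra. Qed.

Lemma measurable_neq0 {R : realType} {d} : measurable [set y : 'cV[R]_d | y != 0].
Proof.
apply: measurable_open; rewrite (_ : [set y | _] = ~` [set 0]).
  by apply: closed_openC; apply: accessible_closed_set1;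
    apply: hausdorff_accessible; exact: norm_hausdorff.
by apply/seteqP; split=> y /= /eqP.
Qed.

Section vector_measurability.
Context {R : realType} {d : nat}.
Implicit Types (y v : 'cV[R]_d).

Lemma continuous_coord (i : 'I_d) : continuous (fun v : 'cV[R]_d => v i 0).
Proof. exact: coord_continuous. Qed.

Lemma norm_coord_le v i : `|v i 0| <= `|v|.
Proof. by rewrite [leRHS]/Num.norm/= mx_normrE; exact: (le_bigmax _ (fun ij => `|v ij.1 ij.2|) (i, 0)). Qed.

Lemma norm_coord_lt v e : 0 < e -> (forall i, `|v i 0| < e) -> `|v| < e.
Proof.
move=> e0 h; rewrite [ltLHS]/Num.norm/= mx_normrE; apply/bigmax_ltP; split => //= -[i j] _.
by rewrite ord1 h.
Qed.

Lemma continuous_measurable_vector (f : 'cV[R]_d -> R) : continuous f ->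
  measurable_fun setT f.
Proof.
move=> cf; apply: (measurability _ (RGenOInfty.measurableE R)) => // _ [_ [x ->] <-].
rewrite setTI; apply: measurable_open; apply: open_comp; last by rewrite set_itvE; exact: open_gt.
by move=> y _; exact: cf.
Qed.

(** Open sets are countable unions of boxes with rational centres. *)
Lemma measurable_vectorP dU (U : measurableType dU) (h : U -> 'cV[R]_d) :
  (forall i, measurable_fun setT (fun w => h w i 0)) -> measurable_fun setT h.
Proof.
move=> mh; apply: (measurability (@open 'cV[R]_d)) => //.
move=> _ [U0 oU <-]; rewrite setTI.
pose box (q : 'cV[rat]_d) (n : nat) : set 'cV[R]_d :=
  [set y | forall i, `|y i 0 - ratr (q i 0)| < n.+1%:R^-1].
rewrite (_ : h @^-1` U0 = \bigcup_(q in @setT 'cV[rat]_d) \bigcup_(n in [set n | box q n `<=` U0])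
    \bigcap_(i in @setT 'I_d) ((fun w => h w i 0) @^-1` `](ratr (q i 0) - n.+1%:R^-1), (ratr (q i 0) + n.+1%:R^-1)[%classic)).
  apply: countable_bigcupT_measurable => //= q; apply: bigcup_measurable => n _.
  apply: fin_bigcap_measurable => [|i _]; first exact: finite_finset.
  by rewrite -[X in measurable X]setTI; exact: mh.
have boxE q n w : box q n (h w) <-> forall i : 'I_d,
    (`](ratr (q i 0) - n.+1%:R^-1), (ratr (q i 0) + n.+1%:R^-1)[%classic : set R) (h w i 0).
  by split=> H i; have := H i; rewrite /= in_itv/= ltr_distl.
apply/seteqP; split=> w /=; last first.
  by move=> [q _ [n nO hq]]; apply: nO; apply/boxE => i; exact: hq.
move=> Ow.
have /nbhs_ballP[e /= e0 eO] : nbhs (h w) U0 by exact: open_nbhs_nbhs.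
have e2 : 0 < e / 2 by rewrite divr_gt0.
have [n _ /(_ n (leqnn n)) /= ne] := near_infty_natSinv_lt (PosNum e2).
have /choice[q hq] : forall i : 'I_d, exists q : rat, ratr q \in `](h w i 0 - n.+1%:R^-1), (h w i 0 + n.+1%:R^-1)[.
  by move=> i; apply: rat_in_itvoo; rewrite ltrBlDr -addrA ltrDl addr_gt0.
have qi i : `|h w i 0 - ratr (q i)| < n.+1%:R^-1.
  by have := hq i; rewrite in_itv/= -ltr_distl distrC.
exists (\col_i q i) => //; exists n.
  move=> y hy; apply: eO; rewrite -ball_normE /=; apply: norm_coord_lt => // i.
  rewrite !mxE; have := hy i; rewrite mxE; have := qi i.
  have := ler_distD (ratr (q i)) (h w i 0) (y i 0); rewrite (distrC (ratr (q i))).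
  by move: ne; move: (n.+1%:R^-1) => a; lra.
by move=> i _ /=; rewrite mxE in_itv/= -ltr_distl.
Qed.

Lemma enorm_ge0 v : 0 <= enorm v.
Proof. exact: sqrtr_ge0. Qed.

Lemma enormN v : enorm (- v) = enorm v.
Proof. by rewrite /enorm; congr Num.sqrt; apply: eq_bigr => i _; rewrite mxE sqrrN. Qed.

Lemma coord_le_enorm v i : `|v i 0| <= enorm v.
Proof.
rewrite -sqrtr_sqr ler_wsqrtr// (bigD1 i)//= lerDl.
by apply: sumr_ge0 => j _; exact: sqr_ge0.
Qed.

Lemma enorm_le_sum v : enorm v <= \sum_i `|v i 0|.
Proof.
have S0 : 0 <= \sum_i `|v i 0| by exact: sumr_ge0.
rewrite -(ger0_norm S0) -sqrtr_sqr ler_wsqrtr// expr2 mulr_suml.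
apply: ler_sum => i _; rewrite -real_normK ?num_real// expr2 ler_wpM2l//.
by rewrite (bigD1 i)//= lerDl sumr_ge0.
Qed.

(** The constant d is crude, but only its independence of v matters. *)
Lemma enorm_gt_coord v r : (0 < d)%N -> r < enorm v -> exists i : 'I_d, r / d%:R < `|v i 0|.
Proof.
move=> d0 rv; apply: contrapT => h.
have d0' : 0 < d%:R :> R by rewrite ltr0n.
have : enorm v <= \sum_(i < d) r / d%:R.
  apply: (le_trans (enorm_le_sum v)); apply: ler_sum => i _.
  by rewrite leNgt; apply/negP => h'; apply: h; exists i.
rewrite sumr_const card_ord -[_ *+ d]mulr_natr divfK ?gt_eqF//.
by rewrite leNgt rv.
Qed.

Lemma enorm_le_norm v : enorm v <= d%:R * `|v|.
Proof.
apply: (le_trans (enorm_le_sum v)); apply: (@le_trans _ _ (\sum_(i < d) `|v|)).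
  by apply: ler_sum => i _; exact: norm_coord_le.
by rewrite sumr_const card_ord mulr_natl.
Qed.

Lemma continuous_sum_seq (I : Type) (D : seq I) (f : I -> 'cV[R]_d -> R) :
  (forall i, continuous (f i)) -> continuous (fun v => \sum_(i <- D) f i v).
Proof.
move=> cf; elim: D => [|i D ih].
  rewrite (_ : (fun v => _) = fun=> 0); first exact: cst_continuous.
  by apply/funext => v; rewrite big_nil.
rewrite (_ : (fun v => _) = fun v => f i v + \sum_(i <- D) f i v).
  by move=> v; exact: (cvgD (cf i v) (ih v)).
by apply/funext => v; rewrite big_cons.
Qed.

Lemma continuous_enorm : continuous (@enorm R d).
Proof.
move=> v; apply: (@continuous_comp _ _ _ (fun v : 'cV[R]_d => \sum_i v i 0 ^+ 2) (@Num.sqrt R)).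
  apply: continuous_sum_seq => i {}v; apply: (@continuous_comp _ _ _ (fun v : 'cV[R]_d => v i 0) (fun x => x ^+ 2)).
    exact: continuous_coord.
  exact: exprn_continuous.
exact: sqrt_continuous.
Qed.

Lemma enorm_gt0 (y : 'cV[R]_d) : y != 0 -> 0 < enorm y.
Proof.
move=> y0; rewrite lt_neqAle enorm_ge0 andbT eq_sym; apply: contra y0 => /eqP ye.
apply/eqP/matrixP => j k; rewrite ord1 mxE; apply/eqP; rewrite -normr_le0 -ye.
exact: coord_le_enorm.
Qed.

Lemma measurable_enorm_gt (r : R) : measurable [set y : 'cV[R]_d | r < enorm y].
Proof.
apply: measurable_open; rewrite (_ : [set y | _] = (@enorm R d) @^-1` [set x | r < x])//.
by apply: open_comp; [move=> y _; exact: continuous_enorm|exact: open_gt].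
Qed.

End vector_measurability.

(** * Orthogonality of martingales *)

Section martingale_increments.
Context {R : realType} {disp} {T : measurableType disp}.
Variables (P : probability T R) (F : R -> set (set T)).
Hypothesis uF : usual_filtration P F.
Import HBNNSimple.
Implicit Types (Z f : T -> R) (s t u e : R).

(** The hypothesis says that f has conditional expectation 0 given F s; it extends
    from indicators to simple functions, then to Z by dominated convergence. *)
Lemma expect_orthogonal_ge0 s f Z : 0 <= s ->
  (forall A, F s A -> expect P (fun w => \1_A w * f w) = 0) -> intble P f ->
  measurable_fun (setT : set (g_sigma_algebraType (F s))) Z -> (forall w, 0 <= Z w) ->
  intble P (fun w => Z w * f w) -> expect P (fun w => Z w * f w) = 0.
Proof.
move=> s0 hf fi mZ Z0 Zfi.
have mZ' : measurable_fun (setT : set (g_sigma_algebraType (F s))) (EFin \o Z).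
  exact/measurable_EFinP.
pose h n := nnsfun_approx (@measurableT _ (g_sigma_algebraType (F s))) mZ' n.
have hZ w : h n w @[n --> \oo] --> Z w.
  have := @cvg_nnsfun_approx _ _ _ _ (@measurableT _ (g_sigma_algebraType (F s))) _ mZ' _ w Logic.I.
  move=> /(_ _)/fine_cvgP[]// x _; by rewrite lee_fin.
have hle n w : h n w <= Z w.
  have nd : nondecreasing_seq (fun n => h n w).
    by move=> a b ab; have /lefP/(_ w) := nd_nnsfun_approx (@measurableT _ (g_sigma_algebraType (F s))) mZ' ab.
  by rewrite -(cvg_lim _ (hZ w))//; apply: nondecreasing_cvgn_le => //; apply/cvg_ex; exists (Z w).
have mh n : measurable_fun (setT : set T) (h n).
  by apply: (usual_fun_measurable uF s0).
have hf0 n : expect P (fun w => h n w * f w) = 0.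
  have -> : (fun w => h n w * f w) = fun w => \sum_(y <- finmap.enum_fset (fset_set (range (h n)))) (y * (\1_(h n @^-1` [set y]) w * f w)).
    apply/funext => w; rewrite {1}(fimfunE (h n) w) fsbig_finite//= mulr_suml.
    by apply: eq_bigr => y _; rewrite mulrA.
  have mA y : F s (h n @^-1` [set y]).
    have : measurable (h n @^-1` [set y]) by exact: measurable_sfunP.
    by rewrite [X in X _](sigma_measurableE (usual_sigma uF s0)).
  rewrite expect_sum => [|y]; last first.
    by apply: intbleZ; apply: intble_indicM => //; exact: (usual_meas uF s0).
  rewrite big1// => y _; rewrite expectZ ?hf ?mulr0//.
  by apply: intble_indicM => //; exact: (usual_meas uF s0).
have mZT := usual_fun_measurable uF s0 mZ.
have [|||n w|_] := @expect_dominated _ _ _ P (fun n w => h n w * f w) (fun w => Z w * f w)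
  (fun w => `|Z w * f w|) _ _ _ (intble_norm Zfi).
- by move=> n; apply: measurable_funM; [exact: mh|exact: (intble_measurable fi)].
- exact: (intble_measurable Zfi).
- by apply: aeW => w; apply: cvgM; [exact: hZ|exact: cvg_cst].
- rewrite !normrM ler_wpM2r// ger0_norm// ger0_norm//; exact: hle.
under eq_fun do rewrite hf0.
by move=> /(cvg_lim (@Rhausdorff R)) <-; rewrite lim_cst.
Qed.

Lemma expect_orthogonal s f Z : 0 <= s ->
  (forall A, F s A -> expect P (fun w => \1_A w * f w) = 0) -> intble P f ->
  measurable_fun (setT : set (g_sigma_algebraType (F s))) Z ->
  intble P (fun w => Z w * f w) -> expect P (fun w => Z w * f w) = 0.
Proof.
move=> s0 hf fi mZ Zfi; pose Zp w := Num.max 0 (Z w); pose Zn w := Num.max 0 (- Z w).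
have mZp : measurable_fun (setT : set (g_sigma_algebraType (F s))) Zp.
  exact: (@measurable_maxr _ (g_sigma_algebraType (F s))).
have mZn : measurable_fun (setT : set (g_sigma_algebraType (F s))) Zn.
  apply: (@measurable_maxr _ (g_sigma_algebraType (F s))) => //.
  exact: (@measurableT_comp _ _ _ (g_sigma_algebraType (F s))).
have Zp0 w : 0 <= Zp w by rewrite le_max lexx.
have Zn0 w : 0 <= Zn w by rewrite le_max lexx.
have ip : intble P (fun w => Zp w * f w).
  apply: (intble_le _ _ (intble_norm Zfi)).
    by apply: measurable_funM; [exact: (usual_fun_measurable uF s0)|exact: (intble_measurable fi)].
  move=> w; rewrite !normrM ler_wpM2r// ger0_norm// /Zp ge_max normr_ge0.
  exact: ler_norm.
have in_ : intble P (fun w => Zn w * f w).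
  apply: (intble_le _ _ (intble_norm Zfi)).
    by apply: measurable_funM; [exact: (usual_fun_measurable uF s0)|exact: (intble_measurable fi)].
  move=> w; rewrite !normrM ler_wpM2r// ger0_norm// /Zn ge_max normr_ge0 -normrN.
  exact: ler_norm.
rewrite (@eq_expect _ _ _ _ _ (fun w => Zp w * f w - Zn w * f w)); last first.
  by move=> w; rewrite -mulrBl /Zp /Zn; case: (leP 0 (Z w)) => h1; case: (leP 0 (- Z w)) => h2;
    congr (_ * _); lra.
by rewrite expectB// (expect_orthogonal_ge0 s0 hf)// (expect_orthogonal_ge0 s0 hf)// subrr.
Qed.

Lemma martingale_orthogonal Y s t Z : martingale P F Y -> 0 <= s -> s <= t ->
  measurable_fun (setT : set (g_sigma_algebraType (F s))) Z ->
  intble P (fun w => Z w * (Y t w - Y s w)) ->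
  expect P (fun w => Z w * (Y t w - Y s w)) = 0.
Proof.
move=> mY s0 st mZ iZ; have [_ _ iY _] := mY; have t0 := le_trans s0 st.
apply: (expect_orthogonal s0 _ _ mZ iZ).
  move=> A FA; have mA := usual_meas uF s0 FA.
  rewrite -(subrr (expect P (fun w => \1_A w * Y s w))).
  rewrite -{1}(martingale_expect mY s0 st FA) -expectB.
  - by apply: eq_expect => w; rewrite mulrBr.
  - by apply: intble_indicM => //; exact: (iY t t0).
  - by apply: intble_indicM => //; exact: (iY s s0).
by apply: intbleB; [exact: (iY t t0)|exact: (iY s s0)].
Qed.

Variables (J Q : R -> T -> R) (K : R).
Hypotheses (mJ : martingale P F J) (mQ : martingale P F Q).
Hypothesis QK : forall t w, 0 <= t -> `|Q t w| <= K.

Let adaptedF Y t : martingale P F Y -> 0 <= t ->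
  measurable_fun (setT : set (g_sigma_algebraType (F t))) (Y t).
Proof. by move=> [aY _ _ _] t0; apply/(usual_sigma_fun uF _ t0); exact: aY. Qed.

Let iJ t : 0 <= t -> intble P (J t).
Proof. by have [_ _ h _] := mJ; exact: h. Qed.

Let iJQ s t : 0 <= s -> 0 <= t -> intble P (fun w => Q s w * J t w).
Proof.
move=> s0 t0; apply: (intbleM (K := K)) => //.
- exact: (usual_fun_measurable uF s0 (adaptedF mQ s0)).
- by move=> w; exact: QK.
- exact: iJ.
Qed.

(** The expectation of a product of increments is the increment of the expectation of
    the product, since each of the two martingales has increments orthogonal to the
    past. *)
Lemma product_increment s t : 0 <= s -> s <= t ->
  intble P (fun w => (J t w - J s w) * (Q t w - Q s w)) /\
  expect P (fun w => (J t w - J s w) * (Q t w - Q s w)) =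
  expect P (fun w => Q t w * J t w) - expect P (fun w => Q s w * J s w).
Proof.
move=> s0 st; have t0 := le_trans s0 st.
have e1 w : (J t w - J s w) * (Q t w - Q s w) =
  (Q t w * J t w - Q s w * J s w) - (Q t w * J s w - Q s w * J s w) -
  (Q s w * J t w - Q s w * J s w) by ring.
have i1 : intble P (fun w => Q t w * J t w - Q s w * J s w) by apply: intbleB; exact: iJQ.
have i2 : intble P (fun w => Q t w * J s w - Q s w * J s w) by apply: intbleB; exact: iJQ.
have i3 : intble P (fun w => Q s w * J t w - Q s w * J s w) by apply: intbleB; exact: iJQ.
split; first by apply: eq_intble (intbleB (intbleB i1 i2) i3) => w; rewrite e1.
rewrite (eq_expect P e1) expectB//; last exact: intbleB.
rewrite expectB// expectB; [|exact: iJQ|exact: iJQ].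
have -> : expect P (fun w => Q t w * J s w - Q s w * J s w) = 0.
  rewrite -(@martingale_orthogonal Q s t (J s))//; last 2 first.
  - exact: adaptedF.
  - by apply: eq_intble i2 => w; ring.
  by apply: eq_expect => w; ring.
have -> : expect P (fun w => Q s w * J t w - Q s w * J s w) = 0.
  rewrite -(@martingale_orthogonal J s t (Q s))//; last 2 first.
  - exact: adaptedF.
  - by apply: eq_intble i3 => w; ring.
  by apply: eq_expect => w; ring.
by rewrite !subr0.
Qed.

Hypothesis J0 : forall w, J 0 w = 0.
Hypothesis cQ : forall w t e, 0 <= t -> 0 < e -> exists2 dl, 0 < dl &
  forall u v, 0 <= u -> u <= v -> v <= t -> v - u < dl -> `|Q v w - Q u w| < e.

(** Summing over a subdivision, E[Q t * J t] equals the expectation of the sum of the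
    products of increments, for every mesh. Pathwise this sum is bounded by the
    variation of J times the largest increment of Q, which tends to 0 by uniform
    continuity; H dominates. *)
Lemma product_expect0 t (H : T -> R) : 0 <= t -> intble P H ->
  (forall n w, \sum_(k < n.+1)
     `|J (t * k.+1%:R / n.+1%:R) w - J (t * k%:R / n.+1%:R) w| <= H w) ->
  expect P (fun w => Q t w * J t w) = 0.
Proof.
move=> t0 iH JH.
pose u n k : R := t * k%:R / n.+1%:R.
have u0 n k : 0 <= u n k by rewrite /u !mulr_ge0.
have uS n k : u n k.+1 = u n k + t / n.+1%:R.
  by rewrite /u -natr1 mulrDr mulr1 mulrDl.
have ule n k : u n k <= u n k.+1 by rewrite uS lerDl divr_ge0.
have ut n k : (k <= n.+1)%N -> u n k <= t.
  by move=> kn; rewrite /u ler_pdivrMr// ler_wpM2l// ler_nat.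
pose S n w := \sum_(k < n.+1) (J (u n k.+1) w - J (u n k) w) * (Q (u n k.+1) w - Q (u n k) w).
have iS n : intble P (S n).
  by apply: intble_sum => k; have [] := product_increment (u0 n k) (ule n k).
have eS n : expect P (S n) = expect P (fun w => Q t w * J t w).
  rewrite /S expect_sum => [|k]; last by have [] := product_increment (u0 n k) (ule n k).
  transitivity (\sum_(k < n.+1) (expect P (fun w => Q (u n k.+1) w * J (u n k.+1) w) -
     expect P (fun w => Q (u n k) w * J (u n k) w))).
    by apply: eq_bigr => k _; have [] := product_increment (u0 n k) (ule n k).
  rewrite -(big_mkord xpredT (fun k => expect P (fun w => Q (u n k.+1) w * J (u n k.+1) w) -
     expect P (fun w => Q (u n k) w * J (u n k) w))).
  rewrite telescope_sumr//.
  have -> : u n n.+1 = t by rewrite /u mulfK.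
  have -> : u n 0%N = 0 by rewrite /u mulr0 mul0r.
  rewrite [X in _ - X](@eq_expect _ _ _ _ _ (fun=> 0)) ?expect_cst ?subr0//.
  by move=> w; rewrite J0 mulr0.
have K0 : 0 <= K by apply: le_trans (QK point t0).
have SH n w : `|S n w| <= 2 * K * H w.
  apply: (le_trans (ler_norm_sum _ _ _)).
  apply: (@le_trans _ _ (2 * K * \sum_(k < n.+1) `|J (u n k.+1) w - J (u n k) w|)).
    rewrite mulr_sumr; apply: ler_sum => k _; rewrite normrM mulrC ler_wpM2r//.
    apply: (le_trans (ler_normB _ _)).
    by have := QK w (u0 n k); have := QK w (u0 n k.+1); lra.
  by rewrite ler_wpM2l ?mulr_ge0// JH.
have [||||_] := @expect_dominated _ _ _ P S (fun=> 0) (fun w => 2 * K * H w) _ _ _ _ SH.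
- by move=> n; exact: (intble_measurable (iS n)).
- exact: measurable_cst.
- apply: aeW => w; apply/cvgrPdist_lt => e e0.
  have H0 : 0 <= H w by apply: le_trans (JH 0%N w); exact: sumr_ge0.
  have e1 : 0 < e / (H w + 1) by rewrite divr_gt0// ltr_wpDl.
  have [dl dl0 hdl] := cQ w t0 e1.
  have xt : 0 < dl / (t + 1) by rewrite divr_gt0// ltr_wpDl.
  near=> n; rewrite sub0r normrN.
  apply: (@le_lt_trans _ _ (e / (H w + 1) * H w)); last first.
    by rewrite mulrAC ltr_pdivrMr ?ltr_wpDl// ltr_pM2l// ltrDl.
  apply: (le_trans (ler_norm_sum _ _ _)).
  apply: (@le_trans _ _ (e / (H w + 1) * \sum_(k < n.+1) `|J (u n k.+1) w - J (u n k) w|)).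
    rewrite mulr_sumr; apply: ler_sum => k _; rewrite normrM mulrC ler_wpM2r// ltW//.
    apply: hdl => //; first exact: ut.
    rewrite uS addrAC subrr add0r.
    have : n.+1%:R^-1 < dl / (t + 1) by near: n; exact: near_infty_natSinv_lt (PosNum xt).
    rewrite ltr_pdivlMr ?ltr_wpDl// mulrC; apply: le_lt_trans.
    by rewrite ler_wpM2r// lerDl.
  by rewrite ler_wpM2l ?(ltW e1)// JH.
- exact: intbleZ.
under eq_fun do rewrite eS; rewrite expect_cst.
by move=> /(cvg_lim (@Rhausdorff R)) <-; rewrite lim_cst.
Unshelve. all: by end_near. Qed.

End martingale_increments.

(** * Continuous paths *)

Section uniform_continuity.
Context {R : realType}.
Implicit Types (f : R -> R) (s t u v e dl : R).

(** Continuity on [0, +oo[ with explicit neighbourhoods. *)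
Definition continuous_path_eps f := forall t e, 0 <= t -> 0 < e -> exists2 dl, 0 < dl &
  forall u, 0 <= u -> `|u - t| < dl -> `|f u - f t| < e.

Lemma continuous_pathP f : continuous_path f <-> continuous_path_eps f.
Proof.
split=> [/subspace_continuousP cf t e t0 e0|cf].
  have t0' : `[0, +oo[%classic t by rewrite /= in_itv/= t0.
  have /cvgrPdist_lt/(_ e e0) := cf t t0'.
  rewrite /within/= => /nbhs_ballP[dl /= dl0 H]; exists dl => // u u0 ut.
  rewrite distrC; apply: H; last by rewrite /= in_itv/= u0.
  by rewrite -ball_normE /= distrC.
apply/subspace_continuousP => t; rewrite /= in_itv/= andbT => t0.
apply/cvgrPdist_lt => e e0; have [dl dl0 H] := cf t e t0 e0.
apply/nbhs_ballP; exists dl => //= u; rewrite -ball_normE /= => ut.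
by rewrite in_itv/= andbT => u0; rewrite distrC H// distrC.
Qed.

Lemma continuous_path_uniform f t e : continuous_path_eps f -> 0 <= t -> 0 < e ->
  exists2 dl, 0 < dl &
  forall u v, 0 <= u -> u <= v -> v <= t -> v - u < dl -> `|f v - f u| < e.
Proof.
move=> cf t0 e0; have e2 : 0 < e / 2 by rewrite divr_gt0.
have exQ s : exists dl, 0 <= s <= t -> 0 < dl /\
    forall u, 0 <= u -> `|u - s| < dl -> `|f u - f s| < e / 2.
  have [/andP[s0 _]|] := boolP (0 <= s <= t); last by exists 1.
  by have [dl dl0 H] := cf s _ s0 e2; exists dl.
have [dl hdl] := choice exQ.
have dl0' s : 0 <= s <= t -> 0 < dl s by move=> /hdl[].
have [D [m [m0 DD cov]]] := lebesgue_number dl0'.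
exists m => // u v u0 uv vt uvm.
have [|s [sD /andP[su us] ms]] := cov u; first by rewrite u0 (le_trans uv).
have [dl0 H] := hdl s (DD s sD).
have hu : `|u - s| < dl s by rewrite ltr_distl; apply/andP; split; lra.
have hv : `|v - s| < dl s by rewrite ltr_distl; apply/andP; split; lra.
have h1 := H u u0 hu; have h2 := H v (le_trans u0 uv) hv.
have := ler_distD (f s) (f v) (f u); rewrite (distrC (f s) (f u)); lra.
Qed.

Lemma continuous_path_cadlag f : continuous_path_eps f -> cadlag f.
Proof.
move=> cf; apply: (@cadlagI _ _ _ f) => t e t0 e0.
  have [dl dl0 H] := cf t e t0 e0; exists dl => // u tu ud.
  apply: H; first by rewrite (le_trans t0)// ltW.
  by rewrite gtr0_norm ?subr_gt0// ltrBlDl.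
have [dl dl0 H] := cf t e (ltW t0) e0; exists (Num.min t dl); first by rewrite lt_min t0.
move=> u; rewrite ltrBlDr -ltrBlDl lt_min => /andP[h1 h2] ut.
apply: H; first by lra.
by rewrite ltr0_norm ?subr_lt0//; lra.
Qed.

Lemma continuous_path_stopped {disp} {T : measurableType disp} (Y : R -> T -> R)
    (tau : T -> \bar R) w : (0 <= tau w)%E ->
  continuous_path_eps (Y ^~ w) -> continuous_path_eps ((stopped Y tau) ^~ w).
Proof.
move=> tau0 cY t e t0 e0.
have [dl dl0 H] := cY (stop_at tau t w) e (stop_at_ge0 tau0 t0) e0.
exists dl => // u u0 ut; rewrite !stoppedE; apply: H; first exact: stop_at_ge0.
apply: le_lt_trans ut; case: (stop_atP u tau0) => [h|a ea ua a0].
  case: (stop_atP t tau0) => [h'|b eb tb b0] //.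
  move: h; rewrite eb lee_fin => ub; rewrite !ler0_norm ?subr_le0 ?(le_trans ub (ltW tb))//.
  by rewrite !opprB lerD2r ltW.
case: (stop_atP t tau0) => [h'|b eb tb b0].
  move: h'; rewrite ea lee_fin => ta; rewrite !ger0_norm ?subr_ge0 ?(le_trans ta (ltW ua))//.
  by rewrite lerD2r ltW.
by move: eb; rewrite ea => -[->]; rewrite subrr normr0.
Qed.

Lemma exit_level_continuous {disp} {T : measurableType disp} (Y : R -> T -> R) K t w :
  continuous_path_eps (Y ^~ w) -> `|Y 0 w| <= K -> 0 <= t ->
  (t%:E <= exit_level Y K w)%E -> `|Y t w| <= K.
Proof.
move=> cY Y0 t0 tK; have [->//|tn0] := eqVneq t 0.
have tp : 0 < t by rewrite lt_neqAle eq_sym tn0.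
apply/ler_addgt0Pr => e e0; have [dl dl0 H] := cY t e t0 e0.
have m0 : 0 < Num.min t dl by rewrite lt_min tp.
have m1 : Num.min t dl <= t by rewrite ge_min lexx.
have m2 : Num.min t dl <= dl by rewrite ge_min lexx orbT.
pose u := t - Num.min t dl / 2.
have u0 : 0 <= u by rewrite /u; lra.
have ut : u < t by rewrite /u; lra.
have h1 : `|Y u w| <= K.
  by apply: exit_level_before => //; apply: lt_le_trans tK; rewrite lte_fin.
have h2 : `|Y u w - Y t w| < e.
  by apply: H => //; rewrite ltr0_norm ?subr_lt0//; rewrite /u; lra.
have := lerB_dist (Y t w) (Y u w); rewrite distrC; lra.
Qed.

Lemma continuous_path_bounded f t : continuous_path_eps f -> 0 <= t ->
  exists K, forall s, 0 <= s -> s <= t -> `|f s| <= K.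
Proof.
move=> /continuous_pathP cf t0.
have cft : {within `[0, t], continuous f}.
  by apply: continuous_subspaceW cf => s /=; rewrite !in_itv/= => /andP[->].
have [c _ hc] := EVT_max t0 cft; have [b _ hb] := EVT_min t0 cft.
exists (Num.max (f c) (- f b)) => s s0 st.
have st' : s \in `[0, t] by rewrite in_itv/= s0.
by rewrite ler_norml lerNl !le_max lerN2 hb// hc// orbT.
Qed.

End uniform_continuity.

(** * Continuous cutoffs near the origin *)

Section cutoff.
Context {R : realType} {d : nat}.
Implicit Types (y : 'cV[R]_d) (e r : R) (i : 'I_d).

(** Continuous, so that sums of jumps are limits of Riemann sums; zero near the
    origin, so that they are finite; even, so that odd functions stay odd. *)
Definition cutoff e y : R := Num.min 1 (Num.max 0 (2 * enorm y / e - 1)).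

Lemma cutoff_ge0 e y : 0 <= cutoff e y.
Proof. by rewrite /cutoff le_min ler01 le_max lexx. Qed.

Lemma cutoff_le1 e y : cutoff e y <= 1.
Proof. by rewrite /cutoff ge_min lexx. Qed.

Lemma cutoff_near e y : 0 < e -> enorm y <= e / 2 -> cutoff e y = 0.
Proof.
move=> e0 ye; rewrite /cutoff (max_l (_ : _ <= 0)) ?min_r//.
by rewrite subr_le0 ler_pdivrMr//; lra.
Qed.

Lemma cutoff_far e y : 0 < e -> e <= enorm y -> cutoff e y = 1.
Proof.
move=> e0 ye; have h : 1 <= 2 * enorm y / e - 1.
  by rewrite lerBrDr ler_pdivlMr//; lra.
by rewrite /cutoff max_r ?min_l// (le_trans _ h).
Qed.

Lemma cutoffN e y : cutoff e (- y) = cutoff e y.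
Proof. by rewrite /cutoff enormN. Qed.

Lemma continuous_cutoff e : continuous (cutoff e).
Proof.
have cu : continuous (fun x : R => Num.min 1 (Num.max 0 x)).
  apply: (@dist_le_continuous _ _ _ _ 1) => // x y; rewrite mul1r ler_norml.
  have := ler_norm (x - y); have := ler_norm (y - x); rewrite (distrC y x).
  by move: `|x - y| => k; case: (leP 0 x) => ?; case: (leP 0 y) => ?; rewrite ?(min_r ler01);
    case: (leP 1 x) => ?; case: (leP 1 y) => ? ? ?; apply/andP; split; lra.
move=> y; apply: (@continuous_comp _ _ _ (fun y => 2 * enorm y / e - 1) (fun x : R => Num.min 1 (Num.max 0 x))); last exact: cu.
apply: (@continuousB _ _ _ (fun y => 2 * enorm y / e) (fun=> 1)); last exact: cst_continuous.
apply: (@continuousM _ _ (fun y => 2 * enorm y) (fun=> e^-1)); last exact: cst_continuous.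
apply: (@continuousM _ _ (fun=> 2) (@enorm R d)); first exact: cst_continuous.
exact: continuous_enorm.
Qed.

(** A radius in the maximum norm, which measures the jumps in [jump_sum]; the factor
    leaves room for the cutoffs both at e and at e / 2. *)
Definition cutoff_radius e : R := e / (4 * d.+1%:R).

Lemma cutoff_radius_gt0 e : 0 < e -> 0 < cutoff_radius e.
Proof. by move=> e0; rewrite /cutoff_radius divr_gt0. Qed.

Lemma enorm_lt_radius e y : 0 < e -> `|y| < cutoff_radius e -> enorm y <= e / 4.
Proof.
move=> e0; rewrite /cutoff_radius ltr_pdivlMr// => ye.
apply: (le_trans (enorm_le_norm y)).
rewrite ler_pdivlMr// mulrAC mulrC; apply: le_trans (ltW ye).
by rewrite ler_wpM2l// mulrC ler_wpM2l// ler_nat.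
Qed.

Lemma vanish_cutoff e : 0 < e -> vanish_near0 (cutoff (e / 2)) (cutoff_radius e).
Proof.
move=> e0 y ye; apply: cutoff_near; first by rewrite divr_gt0.
by apply: (le_trans (enorm_lt_radius e0 ye)); lra.
Qed.

(** A coordinate of the jumps, odd and continuous, without the jumps near 0. *)
Definition cut_coord i e y : R := y i 0 * cutoff e y.

Lemma continuous_cut_coord i e : continuous (cut_coord i e).
Proof. move=> y; apply: (@continuousM _ _ (fun y : 'cV[R]_d => y i 0) (cutoff e)).
  exact: continuous_coord.
exact: continuous_cutoff. Qed.

Lemma cut_coordN i e y : cut_coord i e (- y) = - cut_coord i e y.
Proof. by rewrite /cut_coord cutoffN mxE mulNr. Qed.

Lemma cut_coord_near i e y : 0 < e -> enorm y <= e / 2 -> cut_coord i e y = 0.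
Proof. by move=> e0 ye; rewrite /cut_coord cutoff_near// mulr0. Qed.

Lemma cut_coord_far i e y : 0 < e -> e <= enorm y -> cut_coord i e y = y i 0.
Proof. by move=> e0 ye; rewrite /cut_coord cutoff_far// mulr1. Qed.

Lemma cut_coord_rest i e y : 0 < e -> `|y i 0 - cut_coord i e y| <= e.
Proof.
move=> e0; have [ye|ye] := ltP (enorm y) e; last first.
  by rewrite cut_coord_far// subrr normr0 ltW.
rewrite /cut_coord -{1}[y i 0]mulr1 -mulrBr normrM.
apply: (@le_trans _ _ (enorm y * 1)); last by rewrite mulr1 ltW.
rewrite ler_pM// ?coord_le_enorm//.
by rewrite ger0_norm ?subr_ge0 ?cutoff_le1// gerBl cutoff_ge0.
Qed.

Lemma vanish_cut_coord i e : 0 < e -> vanish_near0 (cut_coord i e) (cutoff_radius e).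
Proof.
move=> e0 y ye; apply: cut_coord_near => //.
by apply: (le_trans (enorm_lt_radius e0 ye)); lra.
Qed.

(** For e <= r it keeps the jumps of size roughly between e and r. *)
Definition cut_coord_diff i e r y : R := cut_coord i e y - cut_coord i r y.

(** The bound does not depend on e: this keeps the variances bounded as e tends to
    0. *)
Lemma cut_coord_diff_le i e r y : 0 < e -> e <= r ->
  `|cut_coord_diff i e r y| <= Num.min (enorm y) r.
Proof.
move=> e0 er; have r0 := lt_le_trans e0 er.
have [yr|ry] := leP (enorm y) r; last first.
  rewrite /cut_coord_diff !cut_coord_far// ?subrr ?normr0 ?ltW//.
  exact: (le_lt_trans er ry).
rewrite /cut_coord_diff /cut_coord -mulrBr normrM.
apply: (@le_trans _ _ (enorm y * 1)); last by rewrite mulr1.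
rewrite ler_pM// ?coord_le_enorm// ler_norml.
have := cutoff_ge0 e y; have := cutoff_le1 e y; have := cutoff_ge0 r y; have := cutoff_le1 r y.
by lra.
Qed.

Lemma cut_coord_diff_le_cutoff i e r y : 0 < e -> e <= r ->
  `|cut_coord_diff i e r y| <= r * cutoff (e / 2) y.
Proof.
move=> e0 er; have r0 := lt_le_trans e0 er; have [ye|ye] := ltP (enorm y) (e / 2).
  have yr : enorm y <= r / 2 by lra.
  rewrite /cut_coord_diff (cut_coord_near i e0 (ltW ye)) (cut_coord_near i r0 yr).
  by rewrite subrr normr0 mulr_ge0 ?cutoff_ge0// (ltW r0).
rewrite [cutoff (e / 2) y]cutoff_far// ?divr_gt0// mulr1.
by apply: (le_trans (cut_coord_diff_le i y e0 er)); rewrite ge_min lexx orbT.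
Qed.

End cutoff.

(** * Probabilities of unions and lower limits of events *)

Lemma measure_big_union_le {R : realType} {disp} {T : measurableType disp}
    (P : probability T R) (I : Type) (r : seq I) (A : I -> set T) (c : R) :
  (forall i, measurable (A i)) -> (forall i, (P (A i) <= c%:E)%E) ->
  measurable (\big[setU/set0]_(i <- r) A i) /\
  (P (\big[setU/set0]_(i <- r) A i) <= ((size r)%:R * c)%:E)%E.
Proof.
move=> mA Ac; elim: r => [|i r [mr hr]]; first by rewrite big_nil measure0 mul0r.
rewrite big_cons; split; first exact: measurableU.
apply: (le_trans (measureU2 _ (mA i) mr)).
by rewrite /= -addn1 natrD mulrDl mul1r addrC EFinD leeD.
Qed.

(** Fatou's lemma for events. *)
Lemma measure_liminf_le {R : realType} {disp} {T : measurableType disp}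
    (P : probability T R) (A : nat -> set T) (c : \bar R) :
  (forall n, measurable (A n)) -> (forall n, (P (A n) <= c)%E) ->
  let B := \bigcup_N \bigcap_(n in [set n | (N <= n)%N]) A n in
  measurable B /\ (P B <= c)%E.
Proof.
move=> mA Ac B; have mN N : measurable (\bigcap_(n in [set n | (N <= n)%N]) A n).
  by apply: bigcap_measurable => [|n _]; [exists N => /=|exact: mA].
have mB : measurable B by apply: bigcup_measurable => N _; exact: mN.
split=> //; have cB : P (\bigcap_(n in [set n | (N <= n)%N]) A n) @[N --> \oo] --> P B.
  apply: nondecreasing_cvg_mu => // n m nm.
  by apply/subsetPset => w h k /= mk; apply: h => /=; exact: leq_trans mk.
rewrite -(cvg_lim _ cB)//; apply: lime_le; first by apply/cvg_ex; exists (P B).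
apply: nearW => N; apply: le_trans (Ac N); apply: le_measure; rewrite ?inE//.
by move=> w; apply => /=.
Qed.

(** * Predictable processes *)

Section predictable_processes.
Context {R : realType} {disp} {T : measurableType disp}.
Variables (P : probability T R) (F : R -> set (set T)).
Hypothesis uF : usual_filtration P F.
Implicit Types (Y : R -> T -> R) (tau : T -> \bar R) (A : set T) (s t u : R).

Local Notation pred := (predictable_sets F).

Lemma predictable_sigma : sigma_algebra (times_ge0 : set (R * T)) pred.
Proof. exact: smallest_sigma_algebra. Qed.

(** The predictable sets live on times s >= 0. Allowing arbitrary values at negative
    times turns them into a sigma-algebra on the whole product, for which the
    notion of measurable function is available. *)
Definition predictable_trace : set (set (R * T)) := [set D | pred (times_ge0 `&` D)].

Lemma predictable_trace_sigma : sigma_algebra setT predictable_trace.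
Proof.
have [h0 hC hU] := predictable_sigma; split.
- by rewrite /predictable_trace /= setI0.
- move=> D; rewrite /predictable_trace /= => /hC.
  by rewrite setTD setDIr setDv set0U setDE.
- by move=> D hD; rewrite /predictable_trace /= setI_bigcupr; exact: hU.
Qed.

Lemma predictable_rect s t A : 0 <= s -> F s A -> predictable_trace (`]s, t] `*` A).
Proof.
move=> s0 FA; have [ts|st] := ltP t s.
  rewrite set_itv_ge ?set0X; first exact: (sigma_set0 predictable_trace_sigma).
  by rewrite bnd_simp -leNgt ltW.
rewrite /predictable_trace /= (_ : _ `&` _ = `]s, t] `*` A).
  by apply: sub_sigma_algebra; right; exists s, t, A.
apply/seteqP; split=> [[x w]|[x w]] /=; first by case.
move=> [h wA]; split => //; move: h; rewrite in_itv/= /times_ge0 /= => /andP[sx _].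
by rewrite (le_trans s0)// ltW.
Qed.

Lemma predictable_ray s A : 0 <= s -> F s A -> predictable_trace (`]s, +oo[ `*` A).
Proof.
move=> s0 FA; rewrite (_ : `]s, +oo[ `*` A = \bigcup_(n in @setT nat) (`]s, n%:R] `*` A)).
  by apply: (sigma_bigcup predictable_trace_sigma) => n _; exact: predictable_rect.
apply/seteqP; split=> [[x w] [/= h wA]|[x w] [n _ [/= h wA]]].
  exists (Num.truncn x).+1 => //; split => //=; rewrite /= in_itv/= andbT in h; rewrite in_itv/= h/=.
  by rewrite ltW// truncnS_gt.
by split => //=; move: h; rewrite /= !in_itv/= => /andP[->].
Qed.

(** The complement, where tau has already occurred, is a union over rational q of the
    sets of times after q on the event that tau <= q, and these are predictable. *)
Lemma predictable_before tau : stopping_time F tau ->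
  predictable_trace [set p : R * T | (p.1%:E <= tau p.2)%E].
Proof.
move=> [tau0 ts]; rewrite -[X in predictable_trace X]setCK.
apply: (sigma_setC predictable_trace_sigma).
rewrite (_ : ~` _ = ([set p : R * T | p.1 < 0 /\ (tau p.2 < p.1%:E)%E]) `|`
   \bigcup_(q in [set q : rat | 0 <= (ratr q : R)]) (`]ratr q, +oo[ `*` [set w | (tau w <= (ratr q)%:E)%E])).
  apply: (sigma_setU predictable_trace_sigma).
    rewrite (_ : [set p | _] = set0); first exact: (sigma_set0 predictable_trace_sigma).
    apply/seteqP; split=> [[x w]|//] /= [x0 h]; move: (tau0 w); apply/negP.
    by rewrite -ltNge (lt_trans h)// lte_fin.
  apply: (sigma_bigcup predictable_trace_sigma) => q q0.
  by apply: predictable_ray => //; exact: ts.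
apply/seteqP; split=> [[x w]|[x w]] /=.
  move/negP; rewrite -ltNge => h; right; have := tau0 w.
  case e : (tau w) h => [r| |]//; rewrite lte_fin lee_fin => /rat_in_itvoo[q].
  rewrite in_itv/= => /andP[rq qx] r0; exists q => /=; first by rewrite (le_trans r0)// ltW.
  by rewrite in_itv/= andbT qx e lee_fin ltW.
move=> [[_ h]|[q q0 [/= h1 h2]]]; apply/negP; rewrite -ltNge//.
by apply: (le_lt_trans h2); move: h1; rewrite in_itv/= andbT lte_fin.
Qed.

(** A left limit is the pointwise limit of the processes that, on the cell
    ]k/n, (k+1)/n], take the value at k/n; these are predictable because Y is
    adapted. *)
Lemma predictable_left_limit Y (Z : R * T -> R) :
  adapted F Y ->
  (forall s w, 0 < s -> forall e, 0 < e -> exists2 dl, 0 < dl &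
     forall u, 0 <= u -> s - dl < u -> u < s -> `|Y u w - Z (s, w)| < e) ->
  (forall s w, s <= 0 -> Z (s, w) = 0) ->
  measurable_fun (setT : set (g_sigma_algebraType predictable_trace)) Z.
Proof.
move=> aY YZ Z0.
have [K hK] : exists K : nat -> R -> nat, forall n s, 0 < s ->
    (K n s)%:R / n.+1%:R < s /\ s <= (K n s).+1%:R / n.+1%:R.
  have ex (p : nat * R) : exists k : nat, 0 < p.2 ->
      k%:R / p.1.+1%:R < p.2 /\ p.2 <= k.+1%:R / p.1.+1%:R.
    have [p0|] := boolP (0 < p.2); last by exists 0%N.
    pose Q k := p.2 <= k.+1%:R / p.1.+1%:R.
    have exQ : exists k, Q k.
      exists (Num.truncn (p.2 * p.1.+1%:R)); rewrite /Q ler_pdivlMr//.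
      by rewrite ltW// truncnS_gt.
    case: (ex_minnP exQ) => j Qj jmin; exists j => _; split => //.
    rewrite ltNge; apply/negP; case: j Qj jmin => [|j] Qj jmin h.
      by move: h; rewrite mul0r leNgt p0.
    by have := jmin j h; rewrite ltnn.
  by have [K hK] := choice ex; exists (fun n s => K (n, s)) => n s; exact: (hK (n, s)).
pose Zn n (p : R * T) := if 0 < p.1 then Y ((K n p.1)%:R / n.+1%:R) p.2 else 0.
apply: (@measurable_fun_cvg _ (g_sigma_algebraType predictable_trace) R setT Zn).
  move=> n; apply/(sigma_funP predictable_trace_sigma) => B mB.
  rewrite (_ : Zn n @^-1` B = (\bigcup_(k in @setT nat) (`]k%:R / n.+1%:R, k.+1%:R / n.+1%:R] `*`
      (Y (k%:R / n.+1%:R) @^-1` B))) `|` ([set p : R * T | p.1 <= 0] `&` [set p | B 0])).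
    apply: (sigma_setU predictable_trace_sigma).
      apply: (sigma_bigcup predictable_trace_sigma) => k _.
      by apply: predictable_rect; [rewrite divr_ge0|apply: aY => //; rewrite divr_ge0].
    have h1 : predictable_trace [set p : R * T | p.1 <= 0].
      rewrite (_ : [set p | _] = ~` (`]0, +oo[ `*` setT)).
        apply: (sigma_setC predictable_trace_sigma); apply: predictable_ray => //.
        exact: (sigma_setT (usual_sigma uF (lexx 0))).
      apply/seteqP; split=> [[x w]|[x w]] /=; rewrite in_itv/= andbT ltNge.
        by move=> -> [].
      by apply: contra_notP => /negP ->; split.
    apply: (sigma_setI predictable_trace_sigma) => //.
    have [B0|B0] := pselect (B 0).
      rewrite (_ : [set p | B 0] = setT); first exact: (sigma_setT predictable_trace_sigma).
      by apply/seteqP; split.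
    rewrite (_ : [set p | B 0] = set0); first exact: (sigma_set0 predictable_trace_sigma).
    by apply/seteqP; split.
  apply/seteqP; split=> [[x w]|[x w]]; rewrite /Zn /=.
    case: ifPn => [x0 hB|]; last by rewrite -leNgt => x0 hB; right.
    left; exists (K n x) => //; split => //=; rewrite in_itv/=.
    by have [-> ->] := hK n x x0.
  move=> [[k _ [/= h hB]]|[x0 hB]]; last by rewrite ltNge x0.
  move: h; rewrite in_itv/= => /andP[kx xk].
  have x0 : 0 < x by apply: le_lt_trans kx; rewrite divr_ge0.
  rewrite x0; have [h1 h2] := hK n x x0.
  suff -> : K n x = k by [].
  have n0 : 0 < n.+1%:R^-1 :> R by rewrite invr_gt0.
  have a1 : (K n x < k.+1)%N by rewrite -(ltr_nat R) -(ltr_pM2r n0); exact: lt_le_trans xk.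
  have a2 : (k < (K n x).+1)%N by rewrite -(ltr_nat R) -(ltr_pM2r n0); exact: lt_le_trans h2.
  by apply/eqP; rewrite eqn_leq -ltnS a1 -ltnS a2.
move=> [x w] _; have [x0|x0] := ltP 0 x; last first.
  by rewrite Z0// /Zn/= ltNge x0; exact: cvg_cst.
apply/cvgrPdist_lt => e e0; have [dl dl0 H] := YZ x w x0 e e0.
near=> n; rewrite distrC /Zn/= x0; have [h1 h2] := hK n x x0.
apply: H => //.
have : n.+1%:R^-1 < dl by near: n; exact: near_infty_natSinv_lt (PosNum dl0).
move: h2; rewrite -[(K n x).+1%:R]natr1 mulrDl mul1r.
by move: (n.+1%:R^-1) (_ / _) => a b; lra.
Unshelve. all: by end_near. Qed.

Context {dV : measure_display} {V : measurableType dV}.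

(** The analogue of [predictable_trace] for functions of a time, a path and a jump. *)
Definition predictable_field_trace : set (set ((R * T) * V)) :=
  [set C | <<s times_ge0 `*` setT,
      [set D `*` A | D in predictable_sets F & A in @measurable _ V] >>
    ((times_ge0 `*` setT) `&` C)].

Lemma predictable_field_trace_sigma : sigma_algebra setT predictable_field_trace.
Proof.
have [h0 hC hU] := smallest_sigma_algebra (times_ge0 `*` setT : set ((R * T) * V))
  [set D `*` A | D in predictable_sets F & A in @measurable _ V].
split.
- by rewrite /predictable_field_trace /= setI0.
- move=> D; rewrite /predictable_field_trace /= => /hC.
  by rewrite setTD setDIr setDv set0U setDE.
- by move=> D hD; rewrite /predictable_field_trace /= setI_bigcupr; exact: hU.
Qed.

Lemma predictable_field_fst (f : R * T -> R) :
  measurable_fun (setT : set (g_sigma_algebraType predictable_trace)) f ->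
  measurable_fun (setT : set (g_sigma_algebraType predictable_field_trace)) (fun p => f p.1).
Proof.
move=> /(sigma_funP predictable_trace_sigma) mf.
apply/(sigma_funP predictable_field_trace_sigma) => B mB.
apply: sub_sigma_algebra; exists (times_ge0 `&` f @^-1` B); first exact: mf.
exists setT => //; apply/seteqP; split=> [[p y]|[p y]] /=; first by case=> [[]].
by case=> [[? _] ?].
Qed.

Lemma predictable_field_snd (g : V -> R) : measurable_fun setT g ->
  measurable_fun (setT : set (g_sigma_algebraType predictable_field_trace)) (fun p => g p.2).
Proof.
move=> mg; apply/(sigma_funP predictable_field_trace_sigma) => B mB.
have pT : predictable_sets F times_ge0.
  by have := sigma_setT predictable_trace_sigma; rewrite /predictable_trace /= setIT.
apply: sub_sigma_algebra; exists times_ge0 => //; exists (g @^-1` B).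
  by rewrite -[X in measurable X]setTI; exact: mg.
by apply/seteqP; split=> [[p y]|[p y]] /=; [case|case=> -[]].
Qed.

Lemma predictable_fieldI (D : set (R * T)) (Z : R * T -> R) (g : V -> R) (h : R -> R -> R) :
  predictable_trace D ->
  measurable_fun (setT : set (g_sigma_algebraType predictable_trace)) Z ->
  measurable_fun setT g ->
  measurable_fun setT (fun p : R * R => h p.1 p.2) ->
  predictable_field F (fun s w y => (\1_D (s, w) * h (Z (s, w)) (g y))%:E).
Proof.
move=> pD mZ mg mh B mB.
have mW : measurable_fun (setT : set (g_sigma_algebraType predictable_field_trace))
    (fun p => (\1_D p.1 * h (Z p.1) (g p.2))%:E).
  apply/measurable_EFinP; apply: measurable_funM.
    apply: predictable_field_fst.
    apply: (@measurable_indic _ (g_sigma_algebraType predictable_trace)).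
    by rewrite [X in X _](sigma_measurableE predictable_trace_sigma).
  have mp : measurable_fun (setT : set (g_sigma_algebraType predictable_field_trace))
      (fun p => (Z p.1, g p.2)).
    apply: measurable_fun_pair; first exact: predictable_field_fst.
    exact: predictable_field_snd.
  exact: (measurableT_comp mh mp).
have /(sigma_funP predictable_field_trace_sigma)/(_ B mB) := mW.
rewrite /predictable_field_trace /=; congr (<<s _, _>> _).
by apply/seteqP; split=> [[[x w] y]|[[x w] y]].
Qed.

End predictable_processes.

(** * Sums over the jumps of a process with symmetric compensator *)

Lemma max0_opp {R : realType} (a : R) : Num.max 0 a = Num.max 0 (- a) + a.
Proof. by case: (leP 0 a) => a0; case: (leP 0 (- a)) => a1; lra. Qed.

Lemma martingaleI {R : realType} {disp} {T : measurableType disp} (P : probability T R)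
    (F : R -> set (set T)) (Y : R -> T -> R) : usual_filtration P F -> adapted F Y ->
  (forall w, cadlag (Y ^~ w)) -> (forall t, 0 <= t -> intble P (Y t)) ->
  (forall s t (A : set T), 0 <= s -> s <= t -> F s A ->
     expect P (fun w => \1_A w * (Y t w - Y s w)) = 0) ->
  martingale P F Y.
Proof.
move=> uF aY cY iY eY; split => // s t A s0 st FA; have t0 := le_trans s0 st.
have mA := usual_meas uF s0 FA.
have e' u : 0 <= u -> (\int[P]_(w in A) (Y u w)%:E)%E =
    (expect P (fun w => \1_A w * Y u w))%:E.
  move=> u0; rewrite EFin_expect; last by apply: intble_indicM => //; exact: iY.
  rewrite integral_mkcond; apply: eq_integral => w _.
  by rewrite /patch indicE; case: ifPn => _; rewrite ?mul1r ?mul0r.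
rewrite (e' t t0) (e' s s0); congr EFin; apply/eqP; rewrite -subr_eq0; apply/eqP.
rewrite -expectB; [|by apply: intble_indicM => //; exact: iY|by apply: intble_indicM => //; exact: iY].
by rewrite -[RHS](eY s t A s0 st FA); apply: eq_expect => w; rewrite mulrBr.
Qed.

Section jump_processes.
Context {R : realType} {disp} {T : measurableType disp} {d : nat}.
Variables (P : probability T R) (F : R -> set (set T)) (X : R -> T -> 'cV[R]_d).
Variable phi : 'cV[R]_d -> {measure set 'cV[R]_d -> \bar R}.
Hypothesis uF : usual_filtration P F.
Hypothesis cX : forall w, cadlag (X ^~ w).
Hypothesis hK : jump_compensator P F X (fun s w => phi (X s w)).
Hypothesis phi_sym : forall x (f : 'cV[R]_d -> \bar R), measurable_fun setT f ->
  (forall y, 0 <= f y)%E ->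
  (\int[phi x]_(y in [set y | y != 0%R]) f (- y)%R = \int[phi x]_(y in [set y | y != 0%R]) f y)%E.
Implicit Types (g : 'cV[R]_d -> R) (tau : T -> \bar R) (s t u e v K c : R).

Definition jump_process g t w : R := jump_sum g (X ^~ w) t.

Definition jump_process_left g (p : R * T) : R :=
  if 0 < p.1 then jump_sum_left g (X ^~ p.2) p.1 else 0.

(** Bounds are required to be uniform in x: the Levy measure in force changes with
    the position of the process. *)
Definition levy_bound g v := forall x,
  (\int[phi x]_(y in [set y | y != 0%R]) (g y)%:E <= v%:E)%E.

(** The functions g of the jumps whose sums are well behaved. Oddness, with the
    symmetry of the Levy measures, makes the sum a martingale without
    compensation. *)
Record jump_functional g e : Prop := {
  jf_measurable : measurable_fun setT g ;
  jf_odd : forall y, g (- y) = - g y ;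
  jf_pos : 0 < e ;
  jf_vanish : vanish_near0 g e ;
  jf_levy : exists v, levy_bound (fun y => `|g y|) v ;
  jf_adapted : adapted F (jump_process g) }.

Lemma cadlag_jump_process g e w : jump_functional g e -> cadlag ((jump_process g) ^~ w).
Proof. by move=> h; exact: (cadlag_jump_sum (cX w) (jf_pos h) (jf_vanish h)). Qed.

Lemma jump_process_left_measurable g e : jump_functional g e ->
  measurable_fun (setT : set (g_sigma_algebraType (predictable_trace F))) (jump_process_left g).
Proof.
move=> h; apply: (@predictable_left_limit _ _ _ _ _ uF (jump_process g)).
- exact: jf_adapted h.
- move=> s w s0 e' e'0; have [dl dl0 H] := jump_sum_near_left (cX w) (jf_pos h) (jf_vanish h) s0.
  exists dl => // u u0 su us; rewrite /jump_process_left/= s0 /jump_process H//.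
  by rewrite subrr normr0.
- by move=> s w s0; rewrite /jump_process_left/= ltNge s0.
Qed.

(** Along a path the sum over all jumps reduces to the finitely many big ones. *)
Lemma compensator_path (D : set (R * T)) (z : R -> R) g (h : R -> R -> R) e t r w :
  (forall p, D p -> 0 < p.1 <= t) -> vanish_near0 g e -> 0 < e ->
  big_jumps_in (X ^~ w) e t r ->
  (forall a b, 0 <= h a b) -> (forall a, h a 0 = 0) ->
  (\esum_(s in [set s : R | 0 < s /\ jump (X ^~ w) s != 0%R]%R)
     (\1_D (s, w) * h (z s) (g (jump (X ^~ w) s)))%:E =
   (\sum_(s <- r) \1_D (s, w) * h (z s) (g (jump (X ^~ w) s)))%:E)%E.
Proof.
move=> Dt ge e0 [sr r0 rj] h0 ha0.
rewrite (@esum_jumps _ _ _ r).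
- by rewrite sumEFin.
- exact: (sorted_uniq lt_trans ltxx sr).
- by move=> s; rewrite lee_fin mulr_ge0.
- by move=> s /r0/andP[].
- by move=> s sr' ->; rewrite ge ?normr0// ha0 mulr0.
- move=> s s0 nr; have [st|ts] := leP s t.
    by rewrite (ge _ (rj s s0 st nr)) ha0 mulr0.
  rewrite indicE memNset ?mul0r//.
  by move=> /Dt /=; rewrite leNgt ts andbF.
Qed.

Lemma compensator_expect (D : set (R * T)) (Z : R * T -> R) g (h : R -> R -> R) :
  predictable_trace F D ->
  measurable_fun (setT : set (g_sigma_algebraType (predictable_trace F))) Z ->
  measurable_fun setT g ->
  measurable_fun setT (fun p : R * R => h p.1 p.2) ->
  (forall a b, 0 <= h a b) ->
  (\int[P]_w (\esum_(s in [set s : R | 0 < s /\ jump (X ^~ w) s != 0%R]%R)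
     (\1_D (s, w) * h (Z (s, w)) (g (jump (X ^~ w) s)))%:E) =
   \int[P]_w \int[lebesgue_measure]_(s in `]0%R, +oo[)
     \int[phi (X s w)]_(y in [set y | y != 0%R])
        (\1_D (s, w) * h (Z (s, w)) (g y))%:E)%E.
Proof.
move=> pD mZ mg mh h0.
have [] := hK (W := fun s w y => (\1_D (s, w) * h (Z (s, w)) (g y))%:E); last by [].
  by move=> s w y; rewrite lee_fin mulr_ge0.
exact: (predictable_fieldI pD mZ mg mh).
Qed.

Lemma integral_time_bound c t : 0 <= c -> 0 <= t ->
  (\int[lebesgue_measure]_(s in `]0%R, +oo[) (c * \1_(`]0%R, t]%classic) s)%:E = (c * t)%:E :> \bar R)%E.
Proof.
move=> c0 t0; under eq_integral do rewrite EFinM.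
rewrite ge0_integralZl//; last first.
  by apply/measurable_EFinP; apply: measurable_funTS; exact: measurable_indic.
rewrite integral_indic// EFinM; congr (_ * _)%E.
rewrite (_ : _ `&` _ = `]0, t]%classic); last first.
  apply/seteqP; split=> s /=; rewrite !in_itv/=; first by case.
  by move=> /andP[s0 st]; rewrite s0 st.
by rewrite [LHS]lebesgue_measure_itv/= lte_fin; case: ltP => [_|]; rewrite ?oppr0 ?adde0// => t0';
  congr EFin; apply/eqP; rewrite eq_le t0 t0'.
Qed.

(** The times in ]0, t] up to tau, over which the jumps are summed. *)
Definition stop_region t tau : set (R * T) :=
  [set p | 0 < p.1 <= t /\ (p.1%:E <= tau p.2)%E].

Lemma stop_regionP t tau s w : (0 <= tau w)%E -> 0 < s ->
  ((s, w) \in stop_region t tau) = (s <= stop_at tau t w).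
Proof.
move=> tau0 s0; apply/idP/idP => [/set_mem[/= /andP[_ st] h]|h].
  by case: stop_atP => // r er rt r0; move: h; rewrite er lee_fin.
apply/mem_set; split => /=.
  by rewrite s0 (le_trans h)// stop_at_le.
move: h; case: stop_atP => // [h|r er rt r0] sr; last by rewrite er lee_fin.
by rewrite (le_trans _ h)// lee_fin.
Qed.

Lemma predictable_stop_region t tau : stopping_time F tau ->
  predictable_trace F (stop_region t tau).
Proof.
move=> st; rewrite (_ : stop_region t tau = (`]0, t] `*` setT) `&` [set p : R * T | (p.1%:E <= tau p.2)%E]).
  apply: (sigma_setI (predictable_trace_sigma F)); last exact: predictable_before.
  by apply: predictable_rect => //; exact: (sigma_setT (usual_sigma uF (lexx 0))).
by apply/seteqP; split=> [[s w]|[s w]] /=; rewrite in_itv/=; [case|case=> -[]].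
Qed.

Let pdxp (f : 'cV[R]_d -> R) : measurable_fun setT f ->
  measurable_fun [set y : 'cV[R]_d | y != 0] (EFin \o f).
Proof.
by move=> mf; apply/measurable_EFinP; apply: measurable_funTS.
Qed.

(** Let J be the sum of the g-jumps. By [jump_sum_sqr], J^2 at the stopping time is a
    sum over jumps of 2 J_- g + g^2, where J_- is the left limit. Split 2 J_- g into
    positive and negative parts, in order to apply the compensator identity to
    nonnegative functions only. As g is odd and phi symmetric, both parts have the
    same compensator, so they cancel, and what remains is the compensator of g^2.
    The bound K on J_- makes the cancelled quantity finite. *)
Lemma jump_process_variance_bounded g e v K tau t : jump_functional g e ->
  levy_bound (fun y => g y ^+ 2) v -> stopping_time F tau ->
  (forall s w, 0 < s -> (s%:E <= tau w)%E -> `|jump_process_left g (s, w)| <= K) ->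
  0 <= t ->
  intble P (fun w => stopped (jump_process g) tau t w ^+ 2) /\
  expect P (fun w => stopped (jump_process g) tau t w ^+ 2) <= v * t.
Proof.
move=> jg gv stau gK t0; have [tau0 _] := stau.
have [v1 gv1] := jf_levy jg.
have v0 : 0 <= v.
  rewrite -lee_fin; apply: le_trans (gv 0); apply: integral_ge0 => y _.
  by rewrite lee_fin sqr_ge0.
have v10 : 0 <= v1.
  by rewrite -lee_fin; apply: le_trans (gv1 0); apply: integral_ge0 => y _.
have mg := jf_measurable jg.
(* With a the left limit of J and b the value of g at the jump,
   h1 a b - h2 a b = 2 a b + b^2. *)
pose h1 (a b : R) := Num.max 0 (2 * a * b) + b ^+ 2.
pose h2 (a b : R) := Num.max 0 (- (2 * a * b)).
have mab : measurable_fun setT (fun p : R * R => 2 * p.1 * p.2).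
  by apply: measurable_funM => //; apply: measurable_funM.
have mh1 : measurable_fun setT (fun p : R * R => h1 p.1 p.2).
  apply: measurable_funD; first exact: measurable_maxr.
  exact: measurable_funX.
have mh2 : measurable_fun setT (fun p : R * R => h2 p.1 p.2).
  by apply: measurable_maxr => //; exact: measurableT_comp.
have h10 a b : 0 <= h1 a b by rewrite addr_ge0 ?sqr_ge0// le_max lexx.
have h20 a b : 0 <= h2 a b by rewrite le_max lexx.
have h100 a : h1 a 0 = 0 by rewrite /h1 mulr0 expr0n addr0 maxxx.
have h200 a : h2 a 0 = 0 by rewrite /h2 mulr0 oppr0 maxxx.
pose D := stop_region t tau.
have pD : predictable_trace F D by exact: predictable_stop_region.
have Dt p : D p -> 0 < p.1 <= t by case.
pose Z := jump_process_left g.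
have mZ : measurable_fun (setT : set (g_sigma_algebraType (predictable_trace F))) Z.
  exact: jump_process_left_measurable jg.
have E1 := compensator_expect pD mZ mg mh1 h10.
have E2 := compensator_expect pD mZ mg mh2 h20.
pose e1 w := (\esum_(s in [set s : R | 0 < s /\ jump (X ^~ w) s != 0%R]%R)
     (\1_D (s, w) * h1 (Z (s, w)) (g (jump (X ^~ w) s)))%:E)%E.
pose e2 w := (\esum_(s in [set s : R | 0 < s /\ jump (X ^~ w) s != 0%R]%R)
     (\1_D (s, w) * h2 (Z (s, w)) (g (jump (X ^~ w) s)))%:E)%E.
have e20 w : (0 <= e2 w)%E.
  by apply: esum_ge0 => s _; rewrite lee_fin mulr_ge0.
have Jm : measurable_fun setT (fun w => stopped (jump_process g) tau t w ^+ 2).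
  apply: measurable_funX; apply: (adapted_measurable uF) => //.
  apply: (adapted_stopped uF) => //; first exact: jf_adapted jg.
  by move=> w; exact: cadlag_jump_process jg.
have e12 w : e1 w = (e2 w + (stopped (jump_process g) tau t w ^+ 2)%:E)%E.
  have [r rt] := big_jumps_exist (cX w) (jf_pos jg) t0.
  have vg := jf_vanish jg; have g0 := jf_pos jg.
  rewrite /e1 /e2 !(@compensator_path _ (fun s => Z (s, w)) _ _ e t r w)// -EFinD.
  congr EFin; rewrite stoppedE /jump_process.
  rewrite (jump_sum_sqr vg rt (stop_at_le _ (tau0 w))).
  rewrite [X in _ = _ + X]big_mkcond -big_split/=; apply: eq_big_seq => s sr.
  have [_ r0 _] := rt; have /andP[s0 st] := r0 s sr.
  rewrite indicE stop_regionP//; case: ifPn => _; rewrite ?mul0r ?addr0// !mul1r.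
  rewrite /h1 /h2 /Z /jump_process_left/= s0.
  by rewrite (max0_opp (2 * _ * _)) addrA.
pose a1 w s := (\int[phi (X s w)]_(y in [set y | y != 0%R])
        (\1_D (s, w) * h1 (Z (s, w)) (g y))%:E)%E.
pose a2 w s := (\int[phi (X s w)]_(y in [set y | y != 0%R])
        (\1_D (s, w) * h2 (Z (s, w)) (g y))%:E)%E.
have a20 w s : (0 <= a2 w s)%E by apply: integral_ge0 => y _; rewrite lee_fin mulr_ge0.
have a10 w s : (0 <= a1 w s)%E by apply: integral_ge0 => y _; rewrite lee_fin mulr_ge0.
have mhz (h : R -> R -> R) a : measurable_fun setT (fun p : R * R => h p.1 p.2) ->
    measurable_fun setT (fun y => h a (g y)).
  move=> mh; have mp : measurable_fun setT (fun y => (a, g y)).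
    by apply: measurable_fun_pair.
  exact: (measurableT_comp mh mp).
(* The reflection y -> - y exchanges the positive and negative parts of 2 a b. *)
have a12 w s : (a1 w s <= a2 w s + (v * \1_(`]0%R, t]%classic) s)%:E)%E.
  rewrite /a1 /a2 [\1_D _]indicE; case: (boolP ((s, w) \in D)) => [/set_mem[/= /andP[s0 st] _]|_].
    rewrite (_ : \1_(`]0, t]%classic) s = 1) ?mulr1; last first.
      by rewrite indicE mem_set//= in_itv/= s0.
    under eq_integral do rewrite mul1r.
    under [in leRHS]eq_integral do rewrite mul1r.
    set a := Z (s, w).
    under eq_integral do rewrite EFinD.
    rewrite ge0_integralD//; [|exact: measurable_neq0|by move=> y _; rewrite lee_fin le_max lexx|
      by apply: pdxp; apply: measurable_maxr => //; apply: measurable_funM|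
      by move=> y _; rewrite lee_fin sqr_ge0|by apply: pdxp; exact: measurable_funX].
    apply: leeD; last exact: gv.
    rewrite -(@phi_sym _ (fun y => (h2 a (g y))%:E)).
    - by under [leRHS]eq_integral do rewrite (jf_odd jg) /h2 mulrN opprK.
    - by apply/measurable_EFinP; exact: mhz.
    - by move=> y; rewrite lee_fin.
  under eq_integral do rewrite mul0r.
  rewrite integral0 adde_ge0//; last by rewrite lee_fin mulr_ge0.
  by apply: integral_ge0 => y _; rewrite mul0r.
have K0' : forall s w, D (s, w) -> `|Z (s, w)| <= K.
  by move=> s w [/= /andP[s0 _] st]; exact: gK.
have a2K w s : (a2 w s <= (`|K| * 2 * v1 * \1_(`]0%R, t]%classic) s)%:E)%E.
  rewrite /a2 [\1_D _]indicE; case: (boolP ((s, w) \in D)) => [/set_mem DD|_].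
    have [/= /andP[s0 st] _] := DD.
    rewrite (_ : \1_(`]0, t]%classic) s = 1) ?mulr1; last first.
      by rewrite indicE mem_set//= in_itv/= s0.
    under eq_integral do rewrite mul1r.
    apply: (@le_trans _ _ (\int[phi (X s w)]_(y in [set y | y != 0%R])
       ((`|K| * 2)%:E * `|g y|%:E))%E).
      apply: ge0_le_lower_integral => y _; first by rewrite lee_fin.
      rewrite -EFinM lee_fin /h2 ge_max !mulr_ge0//=.
      rewrite (le_trans (ler_norm _))// normrN !normrM (ger0_norm (_ : 0 <= 2))//.
      rewrite ler_wpM2r// mulrC ler_wpM2r// (le_trans (K0' _ _ DD))//.
      exact: ler_norm.
    rewrite ge0_integralZl//; [|exact: measurable_neq0|by apply: pdxp; exact: measurableT_comp].
    rewrite [leRHS]EFinM; apply: lee_wpmul2l; last exact: gv1.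
    by rewrite lee_fin mulr_ge0.
  under eq_integral do rewrite mul0r.
  by rewrite integral0 lee_fin !mulr_ge0.
pose I2 := (\int[P]_w \int[lebesgue_measure]_(s in `]0%R, +oo[) a2 w s)%E.
have I2fin : I2 \is a fin_num.
  rewrite ge0_fin_numE; last by apply: integral_ge0 => w _; apply: integral_ge0 => s _.
  apply: (@le_lt_trans _ _ (\int[P]_w (`|K| * 2 * v1 * t)%:E)%E); last first.
    by rewrite integral_cst//= probability_setT mule1 ltry.
  apply: ge0_le_lower_integral => w _; first by apply: integral_ge0 => s _.
  rewrite -(@integral_time_bound _ t)//; last by rewrite !mulr_ge0.
  by apply: ge0_le_lower_integral => s _.
apply: intble_ge0 => //; first by move=> w; exact: sqr_ge0.
rewrite -(@leeD2lE _ I2 _ _ I2fin).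
have <- : (\int[P]_w e1 w = I2 + \int[P]_w (stopped (jump_process g) tau t w ^+ 2)%:E)%E.
  rewrite /I2 -E2; under eq_integral do rewrite e12.
  rewrite ge0_lower_integralDr// => w _; exact: sqr_ge0.
rewrite E1 /I2.
have vt0 : 0 <= v * t by rewrite mulr_ge0.
have -> : (v * t)%:E = (\int[P]_w (v * t)%:E)%E.
  by rewrite integral_cst//= probability_setT mule1.
rewrite -ge0_lower_integralDr//; last by move=> w _; apply: integral_ge0 => s _; exact: a20.
apply: ge0_le_lower_integral => w _; first by apply: integral_ge0 => s _; exact: a10.
rewrite -(integral_time_bound v0 t0) -ge0_lower_integralDr//; last 2 first.
- by apply: measurable_funM => //; exact: measurable_funTS.
- by move=> s _; rewrite mulr_ge0.
by apply: ge0_le_lower_integral => s _; [exact: a10|exact: a12].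
Qed.

Lemma jump_process_bounded g e t w : jump_functional g e -> 0 <= t ->
  exists M, forall s, 0 <= s -> s <= t -> `|jump_process g s w| <= M.
Proof.
move=> jg t0; have [r rt] := big_jumps_exist (cX w) (jf_pos jg) t0.
exists (\sum_(x <- r) `|g (jump (X ^~ w) x)|) => s s0 st.
rewrite /jump_process (jump_sumE (jf_vanish jg) rt st).
apply: (le_trans (ler_norm_sum _ _ _)).
by rewrite [leRHS](bigID (fun x => x <= s))/= lerDl sumr_ge0.
Qed.

Lemma jump_process_left_le g e K s w : jump_functional g e -> 0 < s ->
  (s%:E <= exit_level (jump_process g) K w)%E -> `|jump_process_left g (s, w)| <= K.
Proof.
move=> jg s0 sK; rewrite /jump_process_left/= s0.
have [dl dl0 H] := jump_sum_near_left (cX w) (jf_pos jg) (jf_vanish jg) s0.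
have m0 : 0 < Num.min s dl by rewrite lt_min s0.
have m1 : Num.min s dl <= s by rewrite ge_min lexx.
have m2 : Num.min s dl <= dl by rewrite ge_min lexx orbT.
pose u := s - Num.min s dl / 2.
have u0 : 0 <= u by rewrite /u; lra.
have us : u < s by rewrite /u; lra.
rewrite -(H u)//; last by rewrite /u; lra.
apply: (@exit_level_before _ _ _ (jump_process g) K u w u0).
by apply: lt_le_trans sK; rewrite lte_fin.
Qed.

(** Stop moreover when J exceeds n; the stopped variables are eventually constant in
    n, and Fatou's lemma applies. *)
Lemma jump_process_variance g e v tau t : jump_functional g e ->
  levy_bound (fun y => g y ^+ 2) v -> stopping_time F tau -> 0 <= t ->
  intble P (fun w => stopped (jump_process g) tau t w ^+ 2) /\
  expect P (fun w => stopped (jump_process g) tau t w ^+ 2) <= v * t.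
Proof.
move=> jg gv stau t0; have [tau0 _] := stau.
have cJ w : cadlag ((jump_process g) ^~ w) by exact: cadlag_jump_process jg.
have aJ := jf_adapted jg.
pose en n := exit_level (jump_process g) n%:R.
have sen n : stopping_time F (en n) by exact: (exit_level_stopping uF _ aJ cJ).
pose sn n w := Order.min (tau w) (en n w).
have ssn n : stopping_time F (sn n) by exact: (stopping_time_min uF).
have bnd n : intble P (fun w => stopped (jump_process g) (sn n) t w ^+ 2) /\
    expect P (fun w => stopped (jump_process g) (sn n) t w ^+ 2) <= v * t.
  apply: (jump_process_variance_bounded (K := n%:R) jg gv (ssn n)) => // s w s0.
  by rewrite le_min => /andP[_ h]; exact: jump_process_left_le jg s0 h.
apply: (@expect_fatou _ _ _ P (fun n w => stopped (jump_process g) (sn n) t w ^+ 2)).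
- by move=> n; exact: (bnd n).1.
- by move=> n w; exact: sqr_ge0.
- apply: measurable_funX; apply: (adapted_measurable uF) => //.
  exact: (adapted_stopped uF).
- by move=> w; exact: sqr_ge0.
- apply: aeW => w; apply: cvg_near_cst.
  have [M hM] := jump_process_bounded w jg t0.
  near=> n; congr (_ ^+ 2); rewrite !stoppedE; congr (jump_process g _ w).
  rewrite /sn -(stop_atI _ (tau0 w) (exit_level_ge0 _ _ _)) stop_at_id//.
  apply: (@le_trans _ _ t%:E); first by rewrite lee_fin stop_at_le.
  apply: exit_level_after => s s0 st; apply: (le_trans (hM s s0 st)).
  near: n; exact: nbhs_infty_ger.
- by move=> n; exact: (bnd n).2.
Unshelve. all: by end_near. Qed.

(** Chebyshev's inequality for the process stopped when it first exceeds K. *)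
Lemma jump_process_maximal g e v K t : jump_functional g e ->
  levy_bound (fun y => g y ^+ 2) v -> 0 < K -> 0 <= t ->
  (P [set w | exists s, [/\ 0 <= s, s <= t & K < `|jump_process g s w|]%R] <=
    (v * t / K ^+ 2)%:E)%E.
Proof.
move=> jg gv K0 t0.
have cJ w : cadlag ((jump_process g) ^~ w) by exact: cadlag_jump_process jg.
have aJ := jf_adapted jg.
pose tau := exit_level (jump_process g) K.
have stau : stopping_time F tau by exact: (exit_level_stopping uF _ aJ cJ).
have [h1 h2] := jump_process_variance jg gv stau t0.
have mE := usual_meas uF t0 (exceed_measurable uF K aJ cJ t0).
apply: (@le_trans _ _ (expect P (fun w => stopped (jump_process g) tau t w ^+ 2) / K ^+ 2)%:E); last first.
  by rewrite lee_fin ler_wpM2r// invr_ge0 exprn_ge0// ltW.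
apply: expect_markov => //; last by rewrite exprn_gt0.
  by move=> w; exact: sqr_ge0.
move=> w [s [s0 st Ks]]; rewrite stoppedE.
have h : (tau w <= s%:E)%E by apply: ereal_inf_lbound; exists s.
case er : (tau w) h => [r| |]; last first.
- by move: (stau.1 w); rewrite er.
- by rewrite leye_eq.
rewrite lee_fin => rs; rewrite (stop_at_eq er (le_trans rs st)).
rewrite -[leRHS]real_normK ?num_real// ler_pXn2r// ?nnegrE ?(ltW K0)//.
exact: exit_level_at er.
Qed.

Lemma jump_increment_path g e tau s t r w : jump_functional g e -> (0 <= tau w)%E ->
  0 <= s -> s <= t -> big_jumps_in (X ^~ w) e t r ->
  stopped (jump_process g) tau t w - stopped (jump_process g) tau s w =
  \sum_(x <- r | (s < x) && (x <= stop_at tau t w)) g (jump (X ^~ w) x).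
Proof.
move=> jg tau0 s0 st rt; have vg := jf_vanish jg.
rewrite !stoppedE /jump_process (jump_sumE vg rt (stop_at_le _ tau0)).
rewrite (jump_sumE vg rt (le_trans (stop_at_le _ tau0) st)).
rewrite (bigID (fun x => x <= s))/= addrAC addrC.
rewrite (eq_bigl (fun x => (s < x) && (x <= stop_at tau t w))); last first.
  by move=> x; rewrite ltNge andbC.
rewrite -[RHS]addr0; congr (_ + _); apply/eqP; rewrite subr_eq0; apply/eqP.
apply: eq_bigl => x; case: (stop_atP t tau0) => [h|a ea ta a0].
  rewrite stop_at_id; last by rewrite (le_trans _ h)// lee_fin.
  by rewrite andbC; case: (leP x s) => //= xs; rewrite (le_trans xs).
case: (stop_atP s tau0) => [h|b eb sb b0].
  rewrite andbC; case: (leP x s) => //= xs; rewrite (le_trans xs)//.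
  by move: h; rewrite ea lee_fin.
have ba : b = a by move: eb; rewrite ea => -[].
by rewrite ba; case: (leP x a) => //= xa; rewrite (le_trans xa)// -ba ltW.
Qed.

(** The positive and the negative jumps have the same compensator, again by symmetry.
    The integrals of the two sums of jumps are lower integrals; they are compared
    after moving the measurable parts of the increment to opposite sides. *)
Lemma jump_process_compensated g e tau s t (A : set T) : jump_functional g e -> stopping_time F tau ->
  0 <= s -> s <= t -> F s A ->
  let D := fun w => \1_A w * (stopped (jump_process g) tau t w - stopped (jump_process g) tau s w) in
  intble P D /\ expect P D = 0.
Proof.
move=> jg stau s0 st FA Dl; have [tau0 _] := stau.
have t0 := le_trans s0 st.
have [v1 gv1] := jf_levy jg.
have v10 : 0 <= v1.
  by rewrite -lee_fin; apply: le_trans (gv1 0); apply: integral_ge0 => y _.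
have mg := jf_measurable jg.
pose h1 (a b : R) := Num.max 0 b.
pose h2 (a b : R) := Num.max 0 (- b).
have mh1 : measurable_fun setT (fun p : R * R => h1 p.1 p.2) by exact: measurable_maxr.
have mh2 : measurable_fun setT (fun p : R * R => h2 p.1 p.2).
  by apply: measurable_maxr => //; exact: measurableT_comp.
have h10 a b : 0 <= h1 a b by rewrite le_max lexx.
have h20 a b : 0 <= h2 a b by rewrite le_max lexx.
have h100 a : h1 a 0 = 0 by rewrite /h1 maxxx.
have h200 a : h2 a 0 = 0 by rewrite /h2 oppr0 maxxx.
pose D := stop_region t tau `&` (`]s, t] `*` A).
have pD : predictable_trace F D.
  apply: (sigma_setI (predictable_trace_sigma F)); first exact: predictable_stop_region.
  exact: predictable_rect.
have Dt p : D p -> 0 < p.1 <= t by case=> -[].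
pose Z := fun _ : R * T => 0 : R.
have mZ : measurable_fun (setT : set (g_sigma_algebraType (predictable_trace F))) Z.
  exact: measurable_cst.
have E1 := compensator_expect pD mZ mg mh1 h10.
have E2 := compensator_expect pD mZ mg mh2 h20.
pose e1 w := (\esum_(s in [set s : R | 0 < s /\ jump (X ^~ w) s != 0%R]%R)
     (\1_D (s, w) * h1 (Z (s, w)) (g (jump (X ^~ w) s)))%:E)%E.
pose e2 w := (\esum_(s in [set s : R | 0 < s /\ jump (X ^~ w) s != 0%R]%R)
     (\1_D (s, w) * h2 (Z (s, w)) (g (jump (X ^~ w) s)))%:E)%E.
have e10 w : (0 <= e1 w)%E by apply: esum_ge0 => x _; rewrite lee_fin mulr_ge0.
have e20 w : (0 <= e2 w)%E by apply: esum_ge0 => x _; rewrite lee_fin mulr_ge0.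
have mJ u : 0 <= u -> measurable_fun setT (fun w => stopped (jump_process g) tau u w).
  move=> u0; apply: (adapted_measurable uF) => //.
  apply: (adapted_stopped uF) => //; first exact: jf_adapted jg.
  by move=> w; exact: cadlag_jump_process jg.
have mA := usual_meas uF s0 FA.
have mDl : measurable_fun setT Dl.
  apply: measurable_funM => //.
  by apply: measurable_funB; exact: mJ.
have path w : exists a b : R, [/\ 0 <= a, 0 <= b, e1 w = a%:E, e2 w = b%:E & Dl w = a - b].
  have [r rt] := big_jumps_exist (cX w) (jf_pos jg) t0.
  have vg := jf_vanish jg; have g0 := jf_pos jg.
  rewrite /e1 /e2 !(@compensator_path _ (fun s => Z (s, w)) _ _ e t r w)//.
  eexists; eexists; split; [| |reflexivity|reflexivity|].
  - by apply: sumr_ge0 => x _; rewrite mulr_ge0.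
  - by apply: sumr_ge0 => x _; rewrite mulr_ge0.
  rewrite /Dl (jump_increment_path jg (tau0 w) s0 st rt) big_mkcond mulr_sumr -sumrB.
  apply: eq_big_seq => x xr; have [_ r0 _] := rt; have /andP[x0 xt] := r0 x xr.
  rewrite -mulrBr /h1 /h2 max0_opp addrAC subrr add0r.
  rewrite !indicE in_setI stop_regionP//.
  have -> : ((x, w) \in `]s, t] `*` A) = (s < x) && (w \in A).
    apply/idP/idP => [/set_mem[/=]|/andP[sx /set_mem wA]].
      by rewrite in_itv/= => /andP[-> _] /mem_set ->.
    by apply/mem_set; split => //=; rewrite in_itv/= sx xt.
  by case: (w \in A); case: (s < x); case: (x <= _); rewrite /= ?mulr0 ?mul0r.
pose a1 w s := (\int[phi (X s w)]_(y in [set y | y != 0%R])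
        (\1_D (s, w) * h1 (Z (s, w)) (g y))%:E)%E.
pose a2 w s := (\int[phi (X s w)]_(y in [set y | y != 0%R])
        (\1_D (s, w) * h2 (Z (s, w)) (g y))%:E)%E.
have a10 w x : (0 <= a1 w x)%E by apply: integral_ge0 => y _; rewrite lee_fin mulr_ge0.
have a12 w x : a1 w x = a2 w x.
  rewrite /a1 /a2; set c := \1_D _.
  rewrite -(@phi_sym _ (fun y => (c * h2 (Z (x, w)) (g y))%:E)).
  - by under [RHS]eq_integral do rewrite (jf_odd jg) /h2 opprK.
  - apply/measurable_EFinP; apply: measurable_funM => //.
    by apply: measurable_maxr => //; exact: measurableT_comp.
  - by move=> y; rewrite lee_fin mulr_ge0.
have a1K w x : (a1 w x <= (v1 * \1_(`]0%R, t]%classic) x)%:E)%E.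
  rewrite /a1 [\1_D _]indicE; case: (boolP ((x, w) \in D)) => [/set_mem/Dt/=/andP[x0 xt]|_].
    rewrite (_ : \1_(`]0, t]%classic) x = 1) ?mulr1; last first.
      by rewrite indicE mem_set//= in_itv/= x0.
    under eq_integral do rewrite mul1r.
    apply: le_trans (gv1 (X x w)); apply: ge0_le_lower_integral => y _; first by rewrite lee_fin.
    by rewrite lee_fin /h1 ge_max normr_ge0 ler_norm.
  under eq_integral do rewrite mul0r.
  by rewrite integral0 lee_fin mulr_ge0.
pose I := (\int[P]_w \int[lebesgue_measure]_(x in `]0%R, +oo[) a1 w x)%E.
have Ifin : I \is a fin_num.
  rewrite ge0_fin_numE; last by apply: integral_ge0 => w _; apply: integral_ge0 => x _.
  apply: (@le_lt_trans _ _ (\int[P]_w (v1 * t)%:E)%E); last first.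
    by rewrite integral_cst//= probability_setT mule1 ltry.
  apply: ge0_le_lower_integral => w _; first by apply: integral_ge0 => x _.
  rewrite -(integral_time_bound v10 t0).
  by apply: ge0_le_lower_integral => x _.
have I1 : (\int[P]_w e1 w = I)%E := E1.
have I2 : (\int[P]_w e2 w = I)%E.
  transitivity (\int[P]_w \int[lebesgue_measure]_(x in `]0%R, +oo[) a2 w x)%E; first exact: E2.
  apply: eq_integral => w _; apply: eq_integral => x _.
  by rewrite a12.
pose Dp w := Num.max 0 (Dl w); pose Dn w := Num.max 0 (- Dl w).
have mDp : measurable_fun setT Dp by exact: measurable_maxr.
have mDn : measurable_fun setT Dn by apply: measurable_maxr => //; exact: measurableT_comp.
have Dp0 w : 0 <= Dp w by rewrite le_max lexx.
have Dn0 w : 0 <= Dn w by rewrite le_max lexx.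
(* Dl = e1 - e2 = Dp - Dn: both sides now have a measurable summand. *)
have key : (\int[P]_w (e2 w + (Dp w)%:E) = \int[P]_w (e1 w + (Dn w)%:E))%E.
  apply: eq_integral => w _; have [a [b [a0 b0 -> -> eD]]] := path w.
  by rewrite -!EFinD /Dp max0_opp -/(Dn w) eD; congr EFin; ring.
move: key; rewrite !ge0_lower_integralDr// I1 I2.
have Dpi : intble P Dp /\ expect P Dp <= fine I.
  apply: intble_ge0 => //; rewrite fineK// -I1.
  apply: ge0_le_lower_integral => w _; first by rewrite lee_fin.
  have [a [b [a0 b0 -> _ eD]]] := path w.
  by rewrite lee_fin /Dp ge_max a0/= eD gerBl.
have Dni : intble P Dn /\ expect P Dn <= fine I.
  apply: intble_ge0 => //; rewrite fineK// -I2.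
  apply: ge0_le_lower_integral => w _; first by rewrite lee_fin.
  have [a [b [a0 b0 _ -> eD]]] := path w.
  by rewrite lee_fin /Dn ge_max b0/= eD opprB gerBl.
rewrite -EFin_expect; last exact: Dpi.1.
rewrite -EFin_expect; last exact: Dni.1.
rewrite -(fineK Ifin) -!EFinD => -[/addrI eqE].
have eD w : Dp w - Dn w = Dl w by rewrite /Dp max0_opp -/(Dn w) addrAC subrr add0r.
split; first by apply: eq_intble (intbleB Dpi.1 Dni.1) => w; exact: eD.
rewrite -(eq_expect _ eD) expectB; [|exact: Dpi.1|exact: Dni.1].
by rewrite eqE subrr.
Qed.

Lemma martingale_jump_process g e tau : jump_functional g e -> stopping_time F tau ->
  martingale P F (stopped (jump_process g) tau).
Proof.
move=> jg stau; have [tau0 _] := stau.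
have cJ w : cadlag ((jump_process g) ^~ w) by exact: cadlag_jump_process jg.
have F0 := usual_setT uF (lexx 0).
have S0 w : stopped (jump_process g) tau 0 w = 0.
  by rewrite stoppedE stop_at0// /jump_process jump_sum0.
have iS t : 0 <= t -> intble P (stopped (jump_process g) tau t).
  move=> t0; have [h _] := jump_process_compensated jg stau (lexx 0) t0 F0.
  by apply: eq_intble h => w; rewrite S0 subr0 indicT mul1r.
apply: (martingaleI uF).
- exact: (adapted_stopped uF (jf_adapted jg) cJ stau).
- by move=> w; exact: cadlag_stopped.
- exact: iS.
- move=> s t A s0 st FA.
  by have [] := jump_process_compensated jg stau s0 st FA.
Qed.

Hypothesis aX : forall t (B : set 'cV[R]_d), 0 <= t -> measurable B -> F t (X t @^-1` B).

(** Riemann sums depend on finitely many values of X up to time t. *)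
Lemma adapted_jump_process g e : continuous g -> 0 < e -> vanish_near0 g e ->
  adapted F (jump_process g).
Proof.
move=> cg e0 ge t t0; apply/(usual_sigma_fun uF _ t0).
apply: (@measurable_fun_cvg _ (g_sigma_algebraType (F t)) R setT
  (fun n w => \sum_(k < n.+1) g (X (t * k.+1%:R / n.+1%:R) w - X (t * k%:R / n.+1%:R) w))).
  move=> n; apply: (@measurable_sum _ (g_sigma_algebraType (F t))) => k.
  have mX' (j : nat) : (j <= n.+1)%N ->
      measurable_fun (setT : set (g_sigma_algebraType (F t))) (X (t * j%:R / n.+1%:R)).
    move=> jn; have j0 : 0 <= t * j%:R / n.+1%:R by rewrite !mulr_ge0.
    have jt : t * j%:R / n.+1%:R <= t by rewrite ler_pdivrMr// ler_wpM2l// ler_nat.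
    apply: (usual_fun_mono uF j0 jt); apply/(usual_sigma_fun uF _ j0) => B mB.
    exact: aX.
  have mXi (j : nat) i : (j <= n.+1)%N ->
      measurable_fun (setT : set (g_sigma_algebraType (F t))) (fun w => X (t * j%:R / n.+1%:R) w i 0).
    move=> jn; apply: (@measurableT_comp _ _ _ (g_sigma_algebraType (F t)) _ _ (fun v : 'cV[R]_d => v i 0)).
      by apply: continuous_measurable_vector; exact: continuous_coord.
    exact: mX'.
  apply: (@measurableT_comp _ _ _ (g_sigma_algebraType (F t)) _ _ g).
    exact: continuous_measurable_vector.
  apply: (@measurable_vectorP _ _ _ (g_sigma_algebraType (F t))) => i.
  under eq_fun do rewrite !mxE.
  by apply: (@measurable_funB _ (g_sigma_algebraType (F t))); apply: mXi => //; exact: ltnW.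
by move=> w _; exact: (jump_sum_riemann (cX w) cg e0 ge t0).
Qed.

Lemma jump_processB g1 g2 e1 e2 t w : 0 <= t -> 0 < e1 -> vanish_near0 g1 e1 ->
  0 < e2 -> vanish_near0 g2 e2 ->
  jump_process (fun y => g1 y - g2 y) t w = jump_process g1 t w - jump_process g2 t w.
Proof.
move=> t0 e10 v1 e20 v2; have m0 : 0 < Num.min e1 e2 by rewrite lt_min e10.
have [r rt] := big_jumps_exist (cX w) m0 t0.
have w1 : vanish_near0 g1 (Num.min e1 e2) by move=> y; rewrite lt_min => /andP[/v1].
have w2 : vanish_near0 g2 (Num.min e1 e2) by move=> y; rewrite lt_min => /andP[_ /v2].
have w3 : vanish_near0 (fun y => g1 y - g2 y) (Num.min e1 e2).
  by move=> y ym; rewrite w1// w2// subrr.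
by rewrite /jump_process (jump_sumE w1 rt)// (jump_sumE w2 rt)// (jump_sumE w3 rt)// sumrB.
Qed.

(** The compensator identity for a nonnegative function of the jumps. *)
Lemma jump_process_mean g e v t : measurable_fun setT g -> (forall y, 0 <= g y) ->
  0 < e -> vanish_near0 g e -> levy_bound g v -> adapted F (jump_process g) -> 0 <= t ->
  intble P (jump_process g t) /\ expect P (jump_process g t) <= v * t.
Proof.
move=> mg g0 e0 ge gv aJ t0.
have v0 : 0 <= v.
  rewrite -lee_fin; apply: le_trans (gv 0); apply: integral_ge0 => y _.
  by rewrite lee_fin.
pose h1 (a b : R) := Num.max 0 b.
have mh1 : measurable_fun setT (fun p : R * R => h1 p.1 p.2) by exact: measurable_maxr.
have h10 a b : 0 <= h1 a b by rewrite le_max lexx.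
have h100 a : h1 a 0 = 0 by rewrite /h1 maxxx.
pose D := stop_region t (fun _ : T => +oo%E).
have pD : predictable_trace F D by apply: predictable_stop_region; exact: (stopping_time_pinfty uF).
have Dt p : D p -> 0 < p.1 <= t by case.
pose Z := fun _ : R * T => 0 : R.
have mZ : measurable_fun (setT : set (g_sigma_algebraType (predictable_trace F))) Z.
  exact: measurable_cst.
have E1 := compensator_expect pD mZ mg mh1 h10.
pose e1 w := (\esum_(s in [set s : R | 0 < s /\ jump (X ^~ w) s != 0%R]%R)
     (\1_D (s, w) * h1 (Z (s, w)) (g (jump (X ^~ w) s)))%:E)%E.
have path w : e1 w = (jump_process g t w)%:E.
  have [r rt] := big_jumps_exist (cX w) e0 t0.
  rewrite /e1 (@compensator_path _ (fun s => Z (s, w)) _ _ e t r w)//.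
  rewrite /jump_process (jump_sumE ge rt (lexx t)) [in RHS]big_mkcond; congr EFin.
  apply: eq_big_seq => s sr; have [_ r0 _] := rt; have /andP[s0 st] := r0 s sr.
  rewrite st indicE mem_set ?mul1r /h1 ?max_r//.
  by split; rewrite /= ?s0// leey.
have J0 w : 0 <= jump_process g t w.
  rewrite -lee_fin -path; apply: esum_ge0 => s _; rewrite lee_fin mulr_ge0//.
apply: intble_ge0 => //; first by apply: (adapted_measurable uF).
have -> : (\int[P]_w (jump_process g t w)%:E = \int[P]_w e1 w)%E.
  by apply: eq_integral => w _; rewrite path.
rewrite [X in (X <= _)%E]E1.
have -> : (v * t)%:E = (\int[P]_w (v * t)%:E)%E.
  by rewrite integral_cst//= probability_setT mule1.
apply: ge0_le_lower_integral => w _.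
  by apply: integral_ge0 => s _; apply: integral_ge0 => y _; rewrite lee_fin mulr_ge0.
rewrite -(integral_time_bound v0 t0).
apply: ge0_le_lower_integral => s _.
  by apply: integral_ge0 => y _; rewrite lee_fin mulr_ge0.
rewrite [\1_D _]indicE; case: (boolP ((s, w) \in D)) => [/set_mem/Dt/=/andP[x0 xt]|_].
  rewrite (_ : \1_(`]0, t]%classic) s = 1) ?mulr1; last first.
    by rewrite indicE mem_set//= in_itv/= x0.
  under eq_integral do rewrite mul1r.
  apply: le_trans (gv (X s w)); apply: ge0_le_lower_integral => y _; first by rewrite lee_fin.
  by rewrite lee_fin /h1 max_r.
under eq_integral do rewrite mul0r.
by rewrite integral0 lee_fin mulr_ge0.
Qed.

(** The sum of the absolute values of the jumps dominates the variation along every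
    subdivision. *)
Lemma jump_process_variation g g0 e tau t w n : jump_functional g e -> (0 <= tau w)%E ->
  vanish_near0 g0 e -> (forall y, `|g y| <= g0 y) -> 0 <= t ->
  \sum_(k < n.+1) `|stopped (jump_process g) tau (t * k.+1%:R / n.+1%:R) w -
     stopped (jump_process g) tau (t * k%:R / n.+1%:R) w| <= jump_process g0 t w.
Proof.
move=> jg tau0 v0 gg t0; have e0 := jf_pos jg.
have [r rt] := big_jumps_exist (cX w) e0 t0.
pose u k : R := t * k%:R / n.+1%:R.
have u0 k : 0 <= u k by rewrite /u !mulr_ge0.
have uS k : u k <= u k.+1 by rewrite /u ler_wpM2r// ler_wpM2l// ler_nat.
have ut k : (k <= n.+1)%N -> u k <= t.
  by move=> kn; rewrite /u ler_pdivrMr// ler_wpM2l// ler_nat.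
have g00 y : 0 <= g0 y by apply: le_trans (gg y).
apply: (@le_trans _ _ (\sum_(k < n.+1) (jump_process g0 (u k.+1) w - jump_process g0 (u k) w))).
  apply: ler_sum => k _; have kn : u k.+1 <= t by exact: ut.
  have [r' rt'] := big_jumps_exist (cX w) e0 (u0 k.+1).
  rewrite (jump_increment_path jg tau0 (u0 k) (uS k) rt').
  rewrite /jump_process (jump_sumE v0 rt' (lexx _)) (jump_sumE v0 rt' (uS k)).
  rewrite [X in _ <= X - _](bigID (fun x => x <= u k))/= addrAC.
  rewrite [X in _ <= X - _ + _](_ : _ =
    \sum_(x <- r' | x <= u k) g0 (jump (X ^~ w) x)); last first.
    by apply: eq_bigl => x; case: (leP x (u k)) => h; rewrite ?andbF// andbT (le_trans h).
  rewrite subrr add0r; apply: (le_trans (ler_norm_sum _ _ _)).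
  rewrite big_mkcond [leRHS]big_mkcond; apply: ler_sum => x _.
  case: ifPn => [/andP[ux xt]|_]; last by case: ifPn.
  by rewrite (le_trans xt (stop_at_le _ tau0)) -ltNge ux.
rewrite -(big_mkord xpredT (fun k => jump_process g0 (u k.+1) w - jump_process g0 (u k) w)).
rewrite telescope_sumr//.
have -> : u n.+1 = t by rewrite /u mulfK.
have -> : u 0%N = 0 by rewrite /u mulr0 mul0r.
by rewrite {2}/jump_process jump_sum0 subr0.
Qed.

(** A martingale of integrable variation is orthogonal to bounded continuous
    martingales. *)
Lemma jump_process_orthogonal g g0 e v tau (L : R -> T -> R) K t :
  jump_functional g e -> stopping_time F tau ->
  measurable_fun setT g0 -> vanish_near0 g0 e -> (forall y, `|g y| <= g0 y) ->
  levy_bound g0 v -> adapted F (jump_process g0) ->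
  martingale P F L -> (forall t w, 0 <= t -> `|L t w| <= K) ->
  (forall w, continuous_path_eps (L ^~ w)) -> 0 <= t ->
  expect P (fun w => L t w * stopped (jump_process g) tau t w) = 0.
Proof.
move=> jg stau mg0 v0 gg gv a0 mL LK cL t0; have [tau0 _] := stau.
have g00 y : 0 <= g0 y by apply: le_trans (gg y).
have mJ := martingale_jump_process jg stau.
have [iH _] := jump_process_mean mg0 g00 (jf_pos jg) v0 gv a0 t0.
apply: (product_expect0 uF mJ mL LK _ _ t0 iH).
- by move=> w; rewrite stoppedE stop_at0// /jump_process jump_sum0.
- by move=> w t' e' t0' e0'; exact: continuous_path_uniform (cL w) t0' e0'.
- by move=> n w; exact: (jump_process_variation n jg (tau0 w) v0 gg t0).
Qed.

(** * From tails of the Levy measures to truncated moments *)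

(** Tails at the dyadic radii below rho. Halving the radius costs a factor q; what
    will matter is q < 4. *)
Definition tail_bound rho c q := forall x k,
  (phi x [set y | (rho * 2^-1 ^+ k < enorm y)%R] <= (c * q ^+ k)%:E)%E.

Lemma tail_indic rho c q x k : tail_bound rho c q ->
  (\int[phi x]_(y in [set y | y != 0%R]) (\1_[set y : 'cV[R]_d | (rho * 2^-1 ^+ k < enorm y)%R] y)%:E
     <= (c * q ^+ k)%:E)%E.
Proof.
move=> h; rewrite integral_indic; [|exact: measurable_neq0|exact: measurable_enorm_gt].
apply: le_trans (h x k); apply: le_measure; rewrite ?inE.
- by apply: measurableI; [exact: measurable_enorm_gt|exact: measurable_neq0].
- exact: measurable_enorm_gt.
- by move=> y [].
Qed.

Lemma tail_boundS rho c q m : tail_bound rho c q ->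
  tail_bound (rho * 2^-1 ^+ m) (c * q ^+ m) q.
Proof. by move=> h x k; rewrite -!mulrA -!exprD; exact: h. Qed.

Lemma dyadic_layer rho (y : 'cV[R]_d) : 0 < rho -> y != 0 ->
  exists k, rho * 2^-1 ^+ k.+1 < enorm y /\ Num.min (enorm y) rho <= rho * 2^-1 ^+ k.
Proof.
move=> rho0 /enorm_gt0 y0.
have exn : exists n, rho * 2^-1 ^+ n < enorm y.
  have [N HN] := half_power_small (divr_gt0 y0 rho0); exists N.
  by rewrite mulrC -ltr_pdivlMr//; exact: HN.
case: (ex_minnP exn) => -[|m] hm minm.
  exists 0%N; split; last by rewrite expr0 mulr1 ge_min lexx orbT.
  by apply: le_lt_trans hm; rewrite ler_wpM2l// ?(ltW rho0)// expr0 expr1 invf_le1// ler1n.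
exists m; split => //; rewrite ge_min leNgt; apply/orP; left; apply/negP => /minm.
by rewrite ltnn.
Qed.

(** Layer cake over the shells rho 2^(-k-1) < |y| <= rho 2^(-k): the square is at most
    rho^2 4^(-k) there, so that the series is geometric of ratio q / 4. *)
Lemma tail_levy_square rho c q : 0 < rho -> 0 <= c -> 0 <= q -> q < 4 ->
  tail_bound rho c q ->
  levy_bound (fun y => Num.min (enorm y) rho ^+ 2) (rho ^+ 2 * c * (4 * q / (4 - q))).
Proof.
move=> rho0 c0 q0 q4 h x.
pose f k (y : 'cV[R]_d) := (((rho * 2^-1 ^+ k) ^+ 2) * \1_[set y : 'cV[R]_d | rho * 2^-1 ^+ k.+1 < enorm y] y)%:E.
have f0 k y : (0 <= f k y)%E by rewrite lee_fin mulr_ge0 ?sqr_ge0.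
have mf k : measurable_fun [set y : 'cV[R]_d | y != 0] (f k).
  apply: pdxp; apply: measurable_funM => //; apply: measurable_indic.
  exact: measurable_enorm_gt.
apply: (@le_trans _ _ (\int[phi x]_(y in [set y | y != 0%R]) \big[+%E/0%R]_(0 <= k <oo) f k y)%E).
  apply: ge0_le_lower_integral => y y0; first by rewrite lee_fin sqr_ge0.
  have [k [h1 h2]] := dyadic_layer rho0 y0.
  apply: (le_trans _ (@nneseries_lim_ge R (fun k => f k y) xpredT 0 k.+1 _)) => //.
  rewrite big_nat_recr//=; apply: (@le_trans _ _ (f k y)); last by rewrite leeDr// sume_ge0.
  rewrite /f indicE mem_set// mulr1 lee_fin ler_sqr// nnegrE.
    by rewrite le_min enorm_ge0 ltW.
  by rewrite mulr_ge0 ?exprn_ge0// ltW.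
rewrite integral_nneseries//; last exact: measurable_neq0.
apply: lime_le.
  by apply: is_cvg_nneseries => k _ _; apply: integral_ge0 => y _; exact: f0.
apply: nearW => n; apply: (@le_trans _ _ (\sum_(0 <= k < n) (rho ^+ 2 * c * q * (q / 4) ^+ k)%:E)%E).
  apply: lee_sum => k _; rewrite /f; under eq_integral do rewrite EFinM.
  rewrite ge0_integralZl; [|exact: measurable_neq0|
    by apply: pdxp; apply: measurable_indic; exact: measurable_enorm_gt|
    by move=> y _; rewrite lee_fin|by rewrite lee_fin sqr_ge0].
  apply: (@le_trans _ _ (((rho * 2^-1 ^+ k) ^+ 2)%:E * (c * q ^+ k.+1)%:E)%E).
    by apply: lee_wpmul2l; [rewrite lee_fin sqr_ge0|exact: tail_indic].
  rewrite -EFinM lee_fin le_eqVlt; apply/orP; left; apply/eqP.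
  have e4 : (4^-1 : R) ^+ k = (2^-1 ^+ k) ^+ 2.
    by rewrite -exprM mulnC exprM; congr (_ ^+ k); field.
  by rewrite [(q / 4) ^+ k]exprMn e4 [q ^+ k.+1]exprS; ring.
rewrite sumEFin lee_fin -mulr_sumr -!mulrA.
do 2 (apply: ler_wpM2l; first exact: ltW).
apply: ler_wpM2l => //.
have z1 : q / 4 < 1 by rewrite ltr_pdivrMr// mul1r.
apply: (@le_trans _ _ (q * (1 - q / 4)^-1)); first by rewrite ler_wpM2l// geometric_le// divr_ge0.
rewrite le_eqVlt; apply/orP; left; apply/eqP; field.
by rewrite !gt_eqF ?subr_gt0//; split.
Qed.

Lemma tail_levy_cutoff rho c q e : 0 < rho -> tail_bound rho c q -> 0 < e ->
  exists v, levy_bound (cutoff e) v.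
Proof.
move=> rho0 h e0; have e2 : 0 < e / 2 / rho by rewrite !divr_gt0.
have [N HN] := half_power_small e2; exists (c * q ^+ N) => x.
apply: le_trans (tail_indic x N h); apply: ge0_le_lower_integral => y _.
  by rewrite lee_fin cutoff_ge0.
rewrite lee_fin indicE; have [ye|ye] := leP (enorm y) (e / 2).
  by rewrite cutoff_near.
rewrite mem_set ?cutoff_le1//=; apply: lt_trans ye.
by rewrite mulrC -ltr_pdivlMr//; exact: HN.
Qed.

(** The truncated second moment tends to 0 with the level of truncation, so that the
    levels can be chosen along a sequence as small as desired. The rate 16^(-n) will
    leave room for Chebyshev's inequality at the level 2^(-n) up to time n. *)
Lemma tail_cutoff_levels rho c q : 0 < rho -> 0 <= c -> 0 <= q -> q < 4 ->
  tail_bound rho c q -> exists e : nat -> R, [/\ forall n, 0 < e n,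
    forall n m, (n <= m)%N -> e m <= e n, forall n, e n <= 2^-1 ^+ n, forall n, e n <= rho &
    forall n, levy_bound (fun y => Num.min (enorm y) (e n) ^+ 2) (16^-1 ^+ n)].
Proof.
move=> rho0 c0 q0 q4 h.
pose B := rho ^+ 2 * c * (4 * q / (4 - q)).
have z0 : 0 <= q / 4 by rewrite divr_ge0.
have z1 : q / 4 < 1 by rewrite ltr_pdivrMr// mul1r.
have exm n : exists m : nat, forall k, (m <= k)%N -> rho * 2^-1 ^+ k <= 2^-1 ^+ n /\
    B * (q / 4) ^+ k <= 16^-1 ^+ n.
  have n2 : 0 < (2^-1 : R) ^+ n / rho by rewrite divr_gt0// exprn_gt0.
  have n16 : 0 < (16^-1 : R) ^+ n by rewrite exprn_gt0.
  have [N1 h1] := half_power_small n2.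
  have := @cvg_geometric R B (q / 4); rewrite ger0_norm// => /(_ z1).
  move=> /cvgrPdist_lt/(_ _ n16)[N2 _ h2]; exists (maxn N1 N2) => k.
  rewrite geq_max => /andP[k1 k2]; split.
    by rewrite mulrC -ler_pdivlMr// ltW// h1.
  by apply: (le_trans (ler_norm _)); rewrite -normrN -sub0r ltW// h2.
have [m hm] := choice exm.
(* Cumulating the indices makes the levels decreasing. *)
pose M n := (\sum_(j < n.+1) m j)%N.
have mM n : (m n <= M n)%N by rewrite /M big_ord_recr/= leq_addl.
have MM n k : (n <= k)%N -> (M n <= M k)%N.
  have MS j : (M j <= M j.+1)%N by rewrite [X in (_ <= X)%N]/M big_ord_recr/= leq_addr.
  elim: k => [|k ih]; first by rewrite leqn0 => /eqP ->.
  by rewrite leq_eqVlt => /predU1P[->//|/ih nk]; exact: leq_trans nk (MS k).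
have half1 k j : (k <= j)%N -> (2^-1 : R) ^+ j <= 2^-1 ^+ k.
  by move=> kj; rewrite ler_wiXn2l// invf_le1// ler1n.
exists (fun n => rho * 2^-1 ^+ M n); split.
- by move=> n; rewrite mulr_gt0// exprn_gt0.
- by move=> n k nk; rewrite ler_wpM2l ?(ltW rho0)// half1// MM.
- by move=> n; have [] := hm n (M n) (mM n).
- by move=> n; rewrite ger_pMr// exprn_ile1// invf_le1// ler1n.
- move=> n x; have r0 : 0 < rho * 2^-1 ^+ M n by rewrite mulr_gt0// exprn_gt0.
  have c1 : 0 <= c * q ^+ M n by rewrite mulr_ge0// exprn_ge0.
  apply: (le_trans (tail_levy_square r0 c1 q0 q4 (tail_boundS (M n) h) x)).
  rewrite lee_fin; have [_] := hm n (M n) (mM n); apply: le_trans; rewrite le_eqVlt.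
  apply/orP; left; apply/eqP; rewrite /B.
  have e4 : (4^-1 : R) ^+ M n = (2^-1 ^+ M n) ^+ 2.
    by rewrite -exprM mulnC exprM; congr (_ ^+ _); field.
  by rewrite [(q / 4) ^+ _]exprMn e4; ring.
Qed.

(** * Cut off coordinates of the jumps *)

Hypothesis levy_tail : forall e, 0 < e -> exists v, levy_bound (cutoff e) v.

(** The cutoff at e / 2 dominates all functions cut off at e. *)
Lemma adapted_cutoff e : 0 < e -> adapted F (jump_process (cutoff (e / 2))).
Proof.
move=> e0.
have cc : continuous (cutoff (R := R) (d := d) (e / 2)) by exact: continuous_cutoff.
exact: (adapted_jump_process cc (cutoff_radius_gt0 (d := d) e0) (vanish_cutoff (d := d) e0)).
Qed.

Lemma levy_bound_le g1 g2 v : (forall y, 0 <= g1 y) -> (forall y, g1 y <= g2 y) ->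
  levy_bound g2 v -> levy_bound g1 v.
Proof.
move=> g10 g12 h x; apply: le_trans (h x); apply: ge0_le_lower_integral => y _.
  by rewrite lee_fin.
by rewrite lee_fin.
Qed.

Lemma levy_boundZ g v c : 0 <= c -> measurable_fun setT g -> (forall y, 0 <= g y) ->
  levy_bound g v -> levy_bound (fun y => c * g y) (c * v).
Proof.
move=> c0 mg g0 h x; under eq_integral do rewrite EFinM.
rewrite ge0_integralZl//; [|exact: measurable_neq0|exact: pdxp|by move=> y _; rewrite lee_fin].
by rewrite EFinM lee_wpmul2l ?lee_fin.
Qed.

Lemma jump_functional_cut_diff i e r : 0 < e -> e <= r ->
  jump_functional (cut_coord_diff i e r) (cutoff_radius (d := d) e).
Proof.
move=> e0 er; have r0 := lt_le_trans e0 er.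
have cD : continuous (cut_coord_diff (R := R) (d := d) i e r).
  move=> y; apply: (@continuousB _ _ _ (cut_coord i e) (cut_coord i r)); exact: continuous_cut_coord.
have vD : vanish_near0 (cut_coord_diff i e r) (cutoff_radius (d := d) e).
  move=> y ye; rewrite /cut_coord_diff (vanish_cut_coord i e0 ye) cut_coord_near ?subrr//.
  by have := enorm_lt_radius e0 ye; lra.
have rad0 := cutoff_radius_gt0 (d := d) e0.
split => //.
- exact: continuous_measurable_vector.
- by move=> y; rewrite /cut_coord_diff !cut_coordN opprB opprK addrC.
- have e2 : 0 < e / 2 by rewrite divr_gt0.
  have [v hv] := levy_tail e2; exists (r * v).
  apply: (@levy_bound_le _ (fun y => r * cutoff (e / 2) y)) => //.
    by move=> y; exact: cut_coord_diff_le_cutoff.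
  apply: levy_boundZ => //; first exact: ltW.
    by apply: continuous_measurable_vector; exact: continuous_cutoff.
  by move=> y; exact: cutoff_ge0.
- exact: (adapted_jump_process cD rad0 vD).
Qed.

(** The jumps removed by the truncation function of the characteristics. *)
Definition big_coord i (y : 'cV[R]_d) : R := if enorm y < 1 then 0 else y i 0.

Lemma vanish_big_coord i : vanish_near0 (big_coord i) (cutoff_radius (d := d) 1).
Proof.
move=> y y1; rewrite /big_coord (_ : enorm y < 1)//.
by have := enorm_lt_radius (ltr01 : 0 < 1 :> R) y1; lra.
Qed.

Lemma truncated_coord t w i : 0 <= t ->
  truncated X unit_truncation t w i 0 = X t w i 0 - jump_process (big_coord i) t w.
Proof.
move=> t0; have r1 := cutoff_radius_gt0 (d := d) (ltr01 : 0 < 1 :> R).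
have [r rt] := big_jumps_exist (cX w) r1 t0; have [sr r0 rj] := rt.
have ur : uniq r by exact: (sorted_uniq lt_trans ltxx sr).
have bigE y : (y - unit_truncation y) i 0 = big_coord i y.
  by rewrite /unit_truncation /big_coord; case: ifPn => _; rewrite ?subrr ?subr0 ?mxE.
rewrite /truncated /jump_process (jump_sumE (vanish_big_coord i) rt (lexx t)) !mxE; congr (_ - _).
rewrite (fsbigE r) //; last first.
  move=> s /=; rewrite in_itv/= => /andP[s0 st] nr.
  have := enorm_lt_radius (ltr01 : 0 < 1 :> R) (rj s s0 st nr) => h.
  by rewrite /unit_truncation (_ : enorm _ < 1) ?subrr//; lra.
rewrite summxE big_seq_cond [RHS]big_seq_cond; apply: eq_big => s; last by rewrite bigE.
by rewrite mem_setE in_itv/=; case: (boolP (s \in r)) => //= /r0/andP[-> ->].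
Qed.

(** The jumps smaller than 1, without those near 0. This function is discontinuous on
    the unit sphere, because the truncation function is. *)
Definition small_coord i e y : R := cut_coord i e y - big_coord i y.

Lemma small_coord_le i e y : 0 < e -> e <= 1 -> `|small_coord i e y| <= cutoff (e / 2) y.
Proof.
move=> e0 e1; rewrite /small_coord /big_coord; case: ifPn => [y1|]; last first.
  rewrite -leNgt => y1; rewrite cut_coord_far//; last exact: le_trans y1.
  by rewrite subrr normr0 cutoff_ge0.
rewrite subr0; have [ye|ye] := ltP (enorm y) (e / 2).
  by rewrite cut_coord_near ?normr0 ?cutoff_ge0// (ltW ye).
rewrite [leRHS]cutoff_far ?divr_gt0// /cut_coord normrM.
rewrite mulr_ile1// ?(le_trans (coord_le_enorm y i)) ?(ltW y1)//.
by rewrite ger0_norm ?cutoff_ge0// cutoff_le1.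
Qed.

(** Riemann sums do not reach the discontinuous function [big_coord]; that its sum is
    adapted is taken as a hypothesis, and will follow from the adaptedness of the
    truncated process. *)
Lemma jump_functional_small i e : 0 < e -> e <= 1 ->
  adapted F (jump_process (big_coord i)) ->
  jump_functional (small_coord i e) (cutoff_radius (d := d) e).
Proof.
move=> e0 e1 aB; have e2 : 0 < e / 2 by rewrite divr_gt0.
have rad0 := cutoff_radius_gt0 (d := d) e0.
have rad1 := cutoff_radius_gt0 (d := d) (ltr01 : 0 < 1 :> R).
have vC := vanish_cut_coord (d := d) i e0.
have aC : adapted F (jump_process (cut_coord i e)).
  by apply: (adapted_jump_process _ rad0 vC); exact: continuous_cut_coord.
have mI : measurable_fun setT (fun y : 'cV[R]_d => y i 0).
  by apply: continuous_measurable_vector; exact: continuous_coord.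
have mE : measurable_fun setT (@enorm R d).
  by apply: continuous_measurable_vector; exact: continuous_enorm.
split => //.
- apply: measurable_funB; first by apply: continuous_measurable_vector; exact: continuous_cut_coord.
  by apply: measurable_fun_ifT => //; apply: measurable_fun_ltr.
- move=> y; rewrite /small_coord /big_coord cut_coordN enormN mxE.
  by case: ifPn => _; rewrite ?subr0// opprB opprK addrC.
- move=> y ye; rewrite /small_coord vC// /big_coord (_ : enorm y < 1) ?subrr//.
  by have := enorm_lt_radius e0 ye; lra.
- have [v hv] := levy_tail e2; exists v.
  by apply: levy_bound_le hv => // y; exact: small_coord_le.
- move=> t t0 B mB.
  have m1 := (usual_sigma_fun uF (jump_process (cut_coord i e) t) t0).1 (fun B => aC t t0 B).
  have m2 := (usual_sigma_fun uF (jump_process (big_coord i) t) t0).1 (fun B => aB t t0 B).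
  have m3 : measurable_fun (setT : set (g_sigma_algebraType (F t))) (jump_process (small_coord i e) t).
    rewrite (_ : jump_process _ t = fun w => jump_process (cut_coord i e) t w - jump_process (big_coord i) t w).
      exact: (@measurable_funB _ (g_sigma_algebraType (F t))).
    by apply/funext => w; rewrite (jump_processB w t0 rad0 vC rad1 (vanish_big_coord i)).
  by apply: (usual_sigma_fun uF _ t0).2.
Qed.

(** * The process is the sum of its jumps *)

Section identification.
Variables (i : 'I_d) (e : nat -> R) (Xc : R -> T -> R).
Hypothesis e0 : forall n, 0 < e n.
Hypothesis eS : forall n m, (n <= m)%N -> e m <= e n.
Hypothesis e2 : forall n, e n <= 2^-1 ^+ n.
Hypothesis he : forall n, levy_bound (fun y => Num.min (enorm y) (e n) ^+ 2) (16^-1 ^+ n).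

Definition cut_process n := jump_process (cut_coord i (e n)).
Local Notation J := cut_process.

(** The times up to n are considered at the n-th step, so that the Borel-Cantelli
    lemma gives convergence on all bounded intervals at once. *)
Definition exceed n := [set w | exists s, [/\ 0 <= s, s <= n%:R & 2^-1 ^+ n < `|J n.+1 s w - J n s w|]].

Definition good := ~` lim_sup_set exceed.

Definition jump_limit s w : R := limn (fun n => J n s w).

Lemma cut_processB n m s w : 0 <= s ->
  J m s w - J n s w = jump_process (cut_coord_diff i (e m) (e n)) s w.
Proof.
move=> s0; rewrite -(jump_processB w s0 (cutoff_radius_gt0 (d := d) (e0 m)) _ (cutoff_radius_gt0 (d := d) (e0 n)))//.
- exact: vanish_cut_coord.
- exact: vanish_cut_coord.
Qed.

Lemma levy_cut_diff n m : (n <= m)%N ->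
  levy_bound (fun y => cut_coord_diff i (e m) (e n) y ^+ 2) (16^-1 ^+ n).
Proof.
move=> nm; apply: levy_bound_le (he n) => y; first exact: sqr_ge0.
rewrite -real_normK ?num_real// ler_sqr ?nnegrE//.
  exact: (cut_coord_diff_le i y (e0 m) (eS nm)).
by rewrite le_min enorm_ge0 (ltW (e0 n)).
Qed.

Lemma functional_cut_diff n m : (n <= m)%N ->
  jump_functional (cut_coord_diff i (e m) (e n)) (cutoff_radius (d := d) (e m)).
Proof. by move=> nm; apply: jump_functional_cut_diff; [exact: e0|exact: eS]. Qed.

Lemma exceedE n : exceed n =
  [set w | exists s, [/\ 0 <= s, s <= n%:R &
     2^-1 ^+ n < `|jump_process (cut_coord_diff i (e n.+1) (e n)) s w|]].
Proof.
by apply/seteqP; split=> w [s [s0 sn h]]; exists s; split=> //; move: h; rewrite cut_processB.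
Qed.

Lemma measurable_exceed n : measurable (exceed n).
Proof.
rewrite exceedE; have n0 : 0 <= n%:R :> R by [].
have hf := functional_cut_diff (leqnSn n).
apply: (usual_meas uF n0); apply: (exceed_measurable uF) => //.
- exact: jf_adapted hf.
- by move=> w; exact: cadlag_jump_process hf.
Qed.

(** The variance is at most 16^(-n) n, and Chebyshev's inequality divides it by
    4^(-n). *)
Lemma prob_exceed n : (P (exceed n) <= (2 / (2 ^ n.+1)%:R)%:E)%E.
Proof.
rewrite exceedE; have hf := functional_cut_diff (leqnSn n).
have K0 : 0 < (2^-1 : R) ^+ n by rewrite exprn_gt0.
apply: (le_trans (jump_process_maximal hf (levy_cut_diff (leqnSn n)) K0 (ler0n _ n))).
have h : n%:R <= (2 : R) ^+ n by rewrite -natrX ler_nat ltnW// ltn_expl.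
have hq : (2 : R) ^+ n * 2^-1 ^+ n = 1 by rewrite exprVn mulfV// expf_neq0.
have -> : (16^-1 : R) ^+ n = (2^-1 ^+ n) ^+ 4.
  by rewrite -exprM mulnC exprM; congr (_ ^+ n); field.
have -> : 2 / (2 ^ n.+1)%:R = (2^-1 : R) ^+ n.
  by rewrite natrX exprS invfM mulrA mulfV// mul1r exprVn.
move: K0 h hq; set q := 2^-1 ^+ n; set p := 2 ^+ n => q0 h hq.
have -> : q ^+ 4 * n%:R / q ^+ 2 = q * (n%:R * q) by field; rewrite gt_eqF.
by rewrite lee_fin ger_pMr// -[leRHS]hq ler_wpM2r// (ltW q0).
Qed.

Lemma measurable_good : measurable good.
Proof.
apply: measurableC; apply: bigcap_measurable => // n _.
by apply: bigcup_measurable => k _; exact: measurable_exceed.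
Qed.

Lemma prob_good : P (~` good) = 0%E.
Proof.
rewrite setCK; apply: lim_sup_set_cvg0; first exact: measurable_exceed.
apply: (@le_lt_trans _ _ 2%:E); last exact: ltry.
apply: (le_trans _ (@epsilon_trick0 R 2 xpredT _)) => //.
by apply: lee_nneseries => n *; rewrite ?measure_ge0 ?prob_exceed.
Qed.

Lemma ae_good : {ae P, forall w, good w}.
Proof.
exists (~` good); split; [by apply: measurableC; exact: measurable_good|exact: prob_good|].
by move=> w.
Qed.

Lemma good_limit w : good w -> exists N, forall n, (N <= n)%N -> forall s, 0 <= s -> s <= n%:R ->
  J m s w @[m --> \oo] --> jump_limit s w /\ `|jump_limit s w - J n s w| <= 2 * 2^-1 ^+ n.
Proof.
move=> gw; have [N HN] : exists N, forall n, (N <= n)%N -> ~ exceed n w.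
  apply: contrapT => h; apply: gw => N _; apply: contrapT => h'; apply: h; exists N => n Nn Ew.
  by apply: h'; exists n.
exists N => n Nn s s0 sn.
have [|c b] := @dyadic_cauchy _ (fun n => J n s w) n; last by split => //; exact: b.
move=> m nm; rewrite leNgt; apply/negP => h; apply: (HN m (leq_trans Nn nm)).
by exists s; split => //; rewrite (le_trans sn)// ler_nat.
Qed.

(** What remains of X when its jumps and its continuous martingale part are taken
    away. It is set to 0 on the null set where the jump sums may diverge, so that all
    its paths are regular. *)
Definition drift t w : R :=
  if w \in good then X t w i 0 - X 0 w i 0 - jump_limit t w - Xc t w else 0.

Lemma drift0 w : Xc 0 w = 0 -> drift 0 w = 0.
Proof.
move=> Xc0; rewrite /drift; case: ifPn => // /set_mem gw.
have [N HN] := good_limit gw; have [cJ _] := HN N (leqnn _) 0 (lexx 0) (ler0n _ _).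
have -> : jump_limit 0 w = 0.
  apply/esym/(cvg_unique _ _ cJ); first exact: norm_hausdorff.
  rewrite (_ : (fun n => J n 0 w) = fun=> 0); first exact: cvg_cst.
  by apply/funext => n; exact: jump_sum0.
by rewrite Xc0 !subrr ?subr0.
Qed.

(** The jump of X at t is matched by the jump of J n up to e n, the size below which
    jumps are affected by the cutoff. *)
Lemma remainder_left n w t eps : 0 < t -> 0 < eps -> exists2 dl, 0 < dl &
  forall u, 0 <= u -> t - dl < u -> u < t ->
    `|(X t w i 0 - J n t w) - (X u w i 0 - J n u w)| < e n + eps.
Proof.
move=> t0 eps0; have [dl1 dl10 H1] := cadlag_left (cX w) t0 eps0.
have [dl2 dl20 H2] := jump_sum_near_left (cX w) (cutoff_radius_gt0 (d := d) (e0 n))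
  (vanish_cut_coord i (e0 n)) t0.
exists (Num.min dl1 dl2) => [|u u0]; first by rewrite lt_min dl10.
rewrite ltrBlDr -ltrBlDl lt_min => /andP[h1 h2] ut.
have k1 : `|X u w - lim (X v w @[v --> t^'-])| < eps by apply: H1 => //; lra.
have k2 : J n u w = J n t w - cut_coord i (e n) (jump (X ^~ w) t) by apply: H2 => //; lra.
have k3 := cut_coord_rest i (jump (X ^~ w) t) (e0 n).
have k4 := le_lt_trans (norm_coord_le _ i) k1.
move: k3 k4; rewrite k2 /jump !mxE; set a := X t w i 0; set b := X u w i 0.
set c := fun_of_matrix (lim _) i 0; set g := cut_coord _ _ _; set j := J n t w => k3 k4.
rewrite (_ : _ - _ = (a - c - g) - (b - c)); last by ring.
by apply: (le_lt_trans (ler_normB _ _)); rewrite ler_ltD.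
Qed.

Lemma remainder_right n w t eps : 0 <= t -> 0 < eps -> exists2 dl, 0 < dl &
  forall u, t <= u -> u < t + dl ->
    `|(X t w i 0 - J n t w) - (X u w i 0 - J n u w)| < eps.
Proof.
move=> t0 eps0; have [dl1 dl10 H1] := cadlag_right (cX w) t0 eps0.
have [dl2 dl20 H2] := jump_sum_near_right (cX w) (cutoff_radius_gt0 (d := d) (e0 n))
  (vanish_cut_coord i (e0 n)) t0.
exists (Num.min dl1 dl2) => [|u tu]; first by rewrite lt_min dl10.
rewrite -ltrBlDl lt_min => /andP[h1 h2].
have k1 : `|X u w - X t w| < eps by apply: H1 => //; lra.
have k2 : J n u w = J n t w by apply: H2 => //; lra.
have := le_lt_trans (norm_coord_le _ i) k1; rewrite !mxE k2 distrC.
by rewrite opprD opprK addrACA addrC addNr add0r distrC.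
Qed.

(** The limit of the J n is uniform near t, and X - J n has oscillation at most e n
    there. *)
Lemma continuous_drift w : continuous_path_eps (Xc ^~ w) -> continuous_path_eps (drift ^~ w).
Proof.
move=> cXc t eps t0 eps0; rewrite /drift; case: ifPn => [/set_mem gw|_]; last first.
  by exists 1 => // u _ _; rewrite subrr normr0.
have eps8 : 0 < eps / 8 by rewrite divr_gt0.
have [N0 HN0] := good_limit gw.
have [N1 HN1] := half_power_small eps8.
have [N2 HN2] := natr_above (t + 1).
(* n is large enough for the uniform estimate up to time t + 1, and for e n and
   2^(-n) to be small compared with eps. *)
pose n := maxn N0 (maxn N1 N2).
have n0 : (N0 <= n)%N by exact: leq_maxl.
have n1 : (N1 <= n)%N by rewrite /n !leq_max leqnn orbT.
have n2 : (N2 <= n)%N by rewrite /n !leq_max leqnn !orbT.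
have en : e n < eps / 8 by exact: le_lt_trans (e2 n) (HN1 n n1).
have Jn u : 0 <= u -> u <= t + 1 -> `|jump_limit u w - J n u w| < eps / 4.
  move=> u0 ut; have [_ h] := HN0 n n0 u u0 (le_trans ut (HN2 n n2)).
  by apply: (le_lt_trans h); have := HN1 n n1; lra.
have [dl1 dl10 H1] := cXc t _ t0 eps8.
have [dl2 dl20 H2] : exists2 dl, 0 < dl & forall u, 0 <= u -> `|u - t| < dl ->
    `|(X t w i 0 - J n t w) - (X u w i 0 - J n u w)| < e n + eps / 8.
  have [a a0 Ha] := remainder_right n w t0 eps8.
  have [b b0 Hb] : exists2 dl, 0 < dl & forall u, 0 <= u -> t - dl < u -> u < t ->
      `|(X t w i 0 - J n t w) - (X u w i 0 - J n u w)| < e n + eps / 8.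
    have [t0'|t0'] := ltP 0 t; first exact: remainder_left.
    by exists 1 => // u u0 _ ut; have := le_lt_trans u0 (lt_le_trans ut t0'); rewrite ltxx.
  exists (Num.min a b) => [|u u0]; first by rewrite lt_min a0.
  rewrite lt_min (ltr_distl u t a) (ltr_distl u t b) => /andP[/andP[h1 h2] /andP[h3 h4]].
  have [tu|ut] := leP t u; last exact: Hb.
  by apply: (lt_trans (Ha u tu h2)); rewrite ltrDr e0.
exists (Num.min 1 (Num.min dl1 dl2)); first by rewrite !lt_min ltr01 dl10.
move=> u u0; rewrite !lt_min => /andP[h1 /andP[h2 h3]].
have u1 : u <= t + 1 by move: h1; rewrite ltr_distl => /andP[_ /ltW].
have k1 := Jn u u0 u1; have k2 : `|jump_limit t w - J n t w| < eps / 4 by apply: Jn => //; lra.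
have k3 := H2 u u0 h3; have k4 := H1 u u0 h2.
set x0 := X 0 w i 0; move: k1 k2 k3 k4.
set a := X t w i 0; set b := X u w i 0; set p := jump_limit t w; set q := jump_limit u w.
set a' := J n t w; set b' := J n u w; set y := Xc t w; set z := Xc u w => k1 k2 k3 k4.
rewrite (_ : _ - _ = (p - a') - (q - b') - ((a - a') - (b - b')) - (z - y)); last by ring.
apply: (le_lt_trans (ler_normB _ _)).
have := ler_normB (p - a' - (q - b')) (a - a' - (b - b')).
have := ler_normB (p - a') (q - b'); lra.
Qed.

Lemma good_adapted t : 0 <= t -> F t good.
Proof.
move=> t0; rewrite -[good]setCK; apply: (sigma_setC (usual_sigma uF t0)).
by apply: (usual_null uF t0); [apply: measurableC; exact: measurable_good|exact: prob_good].
Qed.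

Lemma coord_X_measurable t j : 0 <= t ->
  measurable_fun (setT : set (g_sigma_algebraType (F t))) (fun w => X t w j 0).
Proof.
move=> t0; apply: (@measurableT_comp _ _ _ (g_sigma_algebraType (F t)) _ _ (fun v : 'cV[R]_d => v j 0)).
  by apply: continuous_measurable_vector; exact: continuous_coord.
by apply/(usual_sigma_fun uF _ t0) => B mB; exact: aX.
Qed.

Lemma cut_process_measurable n t : 0 <= t ->
  measurable_fun (setT : set (g_sigma_algebraType (F t))) (J n t).
Proof.
move=> t0; apply/(usual_sigma_fun uF _ t0) => B mB.
apply: (adapted_jump_process _ (cutoff_radius_gt0 (d := d) (e0 n)) (vanish_cut_coord i (e0 n))) => //.
exact: continuous_cut_coord.
Qed.

Lemma adapted_drift : adapted F Xc -> adapted F drift.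
Proof.
move=> aXc t t0; apply/(usual_sigma_fun uF _ t0).
apply: (@measurable_fun_cvg _ (g_sigma_algebraType (F t)) R setT
  (fun n w => if w \in good then X t w i 0 - X 0 w i 0 - J n t w - Xc t w else 0)).
  move=> n; apply: (usual_fun_if uF t0); [exact: good_adapted| |exact: measurable_cst].
  do 3 try apply: (@measurable_funB _ (g_sigma_algebraType (F t))).
  - exact: coord_X_measurable.
  - by apply: (usual_fun_mono uF (lexx 0) t0); exact: coord_X_measurable.
  - exact: cut_process_measurable.
  - by apply/(usual_sigma_fun uF _ t0); exact: aXc.
move=> w _; rewrite /drift; case: ifPn => [/set_mem gw|_]; last exact: cvg_cst.
have [N0 HN0] := good_limit gw; have [N1 HN1] := natr_above t.
have [cJ _] := HN0 _ (leq_maxl N0 N1) t t0 (HN1 _ (leq_maxr N0 N1)).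
apply: cvgB; last exact: cvg_cst.
by apply: cvgB; [exact: cvg_cst|exact: cJ].
Qed.

(** The jumps not yet counted in J n, up to the stopping time. *)
Definition remainder n tau t w : R :=
  if w \in good then jump_limit (stop_at tau t w) w - J n (stop_at tau t w) w else 0.

(** The variance of J m - J n is at most 16^(-n) t for all m >= n, and passes to the
    limit by Fatou's lemma. The bound |Q| <= 2^(-n) + 2^n Q^2 then controls the
    mean. *)
Lemma remainder_small n tau t : stopping_time F tau -> 0 <= t ->
  [/\ measurable_fun setT (remainder n tau t), intble P (remainder n tau t) &
    expect P (fun w => `|remainder n tau t w|) <= 2^-1 ^+ n * (1 + t)].
Proof.
move=> stau t0; have [tau0 _] := stau.
pose f m w := stopped (jump_process (cut_coord_diff i (e (n + m)%N) (e n))) tau t w.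
have hf m := functional_cut_diff (leq_addr m n).
have mf m : measurable_fun setT (f m).
  apply: (adapted_measurable uF) => //; apply: (adapted_stopped uF) => //.
  - exact: jf_adapted (hf m).
  - by move=> w; exact: cadlag_jump_process (hf m).
have cf w : good w -> f m w @[m --> \oo] --> remainder n tau t w.
  move=> gw; rewrite /remainder mem_set//.
  have s0 : 0 <= stop_at tau t w by exact: stop_at_ge0.
  have [N0 HN0] := good_limit gw; have [N1 HN1] := natr_above (stop_at tau t w).
  have [cJ _] := HN0 _ (leq_maxl N0 N1) _ s0 (HN1 _ (leq_maxr N0 N1)).
  rewrite (_ : (fun m => f m w) = fun m => J (n + m)%N (stop_at tau t w) w - J n (stop_at tau t w) w).
    apply: cvgB; last exact: cvg_cst.
    by under eq_fun do rewrite addnC; move: cJ; rewrite -(cvg_shiftn n).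
  by apply/funext => m; rewrite cut_processB.
have mQ : measurable_fun setT (remainder n tau t).
  apply: (@measurable_fun_cvg _ T R setT (fun m w => if w \in good then f m w else 0)).
    move=> m; apply: measurable_fun_ifT => //.
    by apply: (measurable_fun_bool true); rewrite setTI preimage_mem_true; exact: measurable_good.
  move=> w _; have [gw|bw] := boolP (w \in good); first exact/cf/set_mem.
  by rewrite /remainder (negbTE bw); exact: cvg_cst.
have [iQ2 eQ2] : intble P (fun w => remainder n tau t w ^+ 2) /\
    expect P (fun w => remainder n tau t w ^+ 2) <= 16^-1 ^+ n * t.
  have v m := jump_process_variance (hf m) (levy_cut_diff (leq_addr m n)) stau t0.
  apply: (@expect_fatou _ _ _ _ (fun m w => f m w ^+ 2)).
  - by move=> m; exact: (v m).1.
  - by move=> m w; exact: sqr_ge0.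
  - exact: measurable_funX.
  - by move=> w; exact: sqr_ge0.
  - apply: filterS ae_good => w gw; apply: (@cvg_comp _ _ _ _ (fun x : R => x ^+ 2) _ _ _ (cf w gw)).
    exact: exprn_continuous.
  - by move=> m; exact: (v m).2.
have iB : intble P (fun w => 2^-1 ^+ n + 2 ^+ n * remainder n tau t w ^+ 2).
  by apply: intbleD; [exact: intble_cst|exact: intbleZ].
have q0 : 0 < (2^-1 : R) ^+ n by rewrite exprn_gt0.
have p0 : 0 < (2 : R) ^+ n by rewrite exprn_gt0.
have hq : (2 : R) ^+ n * 2^-1 ^+ n = 1 by rewrite exprVn mulfV// expf_neq0.
have q1 : (2^-1 : R) ^+ n <= 1 by rewrite exprn_ile1// invf_le1// ler1n.
(* If |Q| > 2^(-n) then |Q| <= 2^n Q^2. *)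
have bQ w : `|remainder n tau t w| <= 2^-1 ^+ n + 2 ^+ n * remainder n tau t w ^+ 2.
  rewrite -(real_normK (num_real (remainder _ _ _ _))).
  have : 0 <= `|remainder n tau t w| by [].
  move: `|_| q0 p0 hq => x; set q := _ ^+ n; set p := _ ^+ n => q0 p0 hq x0.
  have [xq|qx] := leP x q; first by rewrite (le_trans xq)// lerDl mulr_ge0 ?sqr_ge0// ltW.
  have : q * x <= x * x by rewrite ler_wpM2r// ltW.
  have : p * (q * x) = x by rewrite mulrA hq mul1r.
  by rewrite expr2; nra.
have iQ : intble P (remainder n tau t) by exact: intble_le iB.
split => //; apply: (le_trans (le_expect (intble_norm iQ) iB bQ)).
rewrite expectD; [|exact: intble_cst|exact: intbleZ]; rewrite expect_cst expectZ//.
rewrite mulrDr mulr1 lerD2l.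
apply: (@le_trans _ _ (2 ^+ n * (16^-1 ^+ n * t))); first by rewrite ler_wpM2l// ltW.
rewrite mulrA ler_wpM2r//.
have -> : (16^-1 : R) ^+ n = (2^-1 ^+ n) ^+ 4.
  by rewrite -exprM mulnC exprM; congr (_ ^+ n); field.
rewrite (exprS _ 3) mulrA hq mul1r exprS; apply: ler_piMr; first exact: ltW.
by rewrite exprn_ile1// ltW.
Qed.

(** The sum of the big jumps is the difference of the process and of its truncation,
    and both are adapted. *)
Lemma big_coord_adapted : adapted F (fun t w => truncated X unit_truncation t w i 0 - X 0 w i 0) ->
  adapted F (jump_process (big_coord i)).
Proof.
move=> aM t t0; apply/(usual_sigma_fun uF _ t0).
rewrite (_ : jump_process _ t = fun w => (X t w i 0 - X 0 w i 0) -
   (truncated X unit_truncation t w i 0 - X 0 w i 0)).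
  apply: (@measurable_funB _ (g_sigma_algebraType (F t))).
    apply: (@measurable_funB _ (g_sigma_algebraType (F t))); first exact: coord_X_measurable.
    by apply: (usual_fun_mono uF (lexx 0) t0); exact: coord_X_measurable.
  by apply/(usual_sigma_fun uF _ t0); exact: aM.
by apply/funext => w; rewrite truncated_coord//; ring.
Qed.

Section drift_martingale.
Let M t w : R := truncated X unit_truncation t w i 0 - X 0 w i 0 - Xc t w.
Hypothesis aM : adapted F (fun t w => truncated X unit_truncation t w i 0 - X 0 w i 0).
Hypothesis aXc : adapted F Xc.
Hypothesis cXc : forall w, continuous_path_eps (Xc ^~ w).
Hypothesis Xc0 : forall w, Xc 0 w = 0.

Let N n := jump_process (small_coord i (e n)).

Lemma functional_small n : jump_functional (small_coord i (e n)) (cutoff_radius (d := d) (e n)).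
Proof.
apply: jump_functional_small; [exact: e0| |exact: big_coord_adapted].
by apply: (le_trans (e2 n)); rewrite exprn_ile1// invf_le1// ler1n.
Qed.

(** X(h) - X_0 is the sum of the jumps smaller than 1, plus the drift and Xc; N n and
    the remainder split that sum. *)
Lemma drift_decomposition n tau t w : stopping_time F tau -> 0 <= t -> good w ->
  stopped drift tau t w = stopped M tau t w - stopped (N n) tau t w - remainder n tau t w.
Proof.
move=> [tau0 _] t0 gw; have s0 := stop_at_ge0 (tau0 w) t0.
rewrite !stoppedE /drift /remainder mem_set// /M truncated_coord//.
rewrite /N /small_coord (jump_processB w s0 (cutoff_radius_gt0 (d := d) (e0 n))
  (vanish_cut_coord i (e0 n)) (cutoff_radius_gt0 (d := d) ltr01) (vanish_big_coord i)).
by rewrite /cut_process; ring.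
Qed.

Lemma adapted_cadlag_drift : adapted F drift /\ forall w, cadlag (drift ^~ w).
Proof.
split; first exact: adapted_drift.
by move=> w; apply: continuous_path_cadlag; exact: continuous_drift.
Qed.

(** Up to an error that vanishes in mean, the drift is a difference of two
    martingales. *)
Lemma martingale_drift tau : stopping_time F tau -> martingale P F (stopped M tau) ->
  martingale P F (stopped drift tau).
Proof.
move=> stau mM; have [aD cD] := adapted_cadlag_drift.
have aS : adapted F (stopped drift tau) by exact: (adapted_stopped uF aD cD stau).
have mN n := martingale_jump_process (functional_small n) stau.
have [_ _ iM _] := mM.
apply: (martingaleI uF aS).
- by move=> w; apply: cadlag_stopped => //; exact: stau.1.
- move=> t t0; have [_ _ iN _] := mN 0%N; have [_ iQ _] := remainder_small 0 stau t0.
  have i1 : intble P (fun w => stopped M tau t w - stopped (N 0) tau t w - remainder 0 tau t w).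
    apply: intbleB => //; apply: intbleB; [exact: iM|exact: iN].
  apply: (ae_eq_intble i1 (adapted_measurable uF aS t0) _).1.
  by apply: filterS ae_good => w gw; rewrite (drift_decomposition 0 stau t0 gw).
- move=> s t A s0 st FA; have t0 := le_trans s0 st; have mA := usual_meas uF s0 FA.
  have [iM1 eM1] := martingale_increment uF mM s0 st FA.
  suff h n : `|expect P (fun w => \1_A w * (stopped drift tau t w - stopped drift tau s w))| <=
      2^-1 ^+ n * ((1 + t) + (1 + s)).
    by apply/eqP; rewrite -normr_le0; exact: half_power_le0 h.
  have [iN1 eN1] := martingale_increment uF (mN n) s0 st FA.
  have [_ iQt eQt] := remainder_small n stau t0; have [_ iQs eQs] := remainder_small n stau s0.
  have iQ : intble P (fun w => \1_A w * (remainder n tau t w - remainder n tau s w)).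
    by apply: intble_indicM => //; exact: intbleB.
  have iMNQ := intbleB (intbleB iM1 iN1) iQ.
  have mD : measurable_fun setT (fun w => \1_A w * (stopped drift tau t w - stopped drift tau s w)).
    by apply: measurable_funM => //; apply: measurable_funB; exact: (adapted_measurable uF aS).
  have [_ ->] : intble P (fun w => \1_A w * (stopped drift tau t w - stopped drift tau s w)) /\
     expect P (fun w => \1_A w * (stopped drift tau t w - stopped drift tau s w)) =
     expect P (fun w => \1_A w * (stopped M tau t w - stopped M tau s w) -
       \1_A w * (stopped (N n) tau t w - stopped (N n) tau s w) -
       \1_A w * (remainder n tau t w - remainder n tau s w)).
    apply: (ae_eq_intble iMNQ mD); apply: filterS ae_good => w gw.
    rewrite (drift_decomposition n stau t0 gw) (drift_decomposition n stau s0 gw).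
    rewrite -!mulrBr; congr (_ * _).
    have aux (a b c a' b' c' : R) : a - b - c - (a' - b' - c') = a - a' - (b - b') - (c - c') by ring.
    exact/esym/aux.
  rewrite expectB//; last exact: intbleB.
  rewrite expectB// eM1 eN1 subrr sub0r normrN.
  apply: (le_trans (le_norm_expect iQ)); rewrite mulrDr.
  apply: (le_trans _ (lerD eQt eQs)).
  have iQt' := intble_norm iQt; have iQs' := intble_norm iQs.
  rewrite -expectD//; apply: le_expect; [exact: intble_norm|exact: intbleD|].
  move=> w; rewrite normrM; apply: (@le_trans _ _ (1 * `|remainder n tau t w - remainder n tau s w|)).
    by rewrite ler_wpM2r// indicE; case: (_ \in _); rewrite ?normr1 ?normr0.
  by rewrite mul1r ler_normB.
Qed.

(** Multiply the decomposition of the drift L = M - N n - Q n by L. The expectation of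
    L M is its value 0 at time 0, since L M is a martingale; that of L N n is 0 by
    orthogonality, and that of L Q n tends to 0 as L is bounded. So E L^2 = 0. *)
Lemma martingale_drift_null tau K t : stopping_time F tau ->
  martingale P F (stopped M tau) ->
  martingale P F (stopped (fun t w => M t w * drift t w) tau) ->
  (forall t w, 0 <= t -> `|stopped drift tau t w| <= K) -> 0 <= t ->
  {ae P, forall w, stopped drift tau t w = 0}.
Proof.
move=> stau mM mMD DK t0; have [aD cD] := adapted_cadlag_drift.
have mD := martingale_drift stau mM; have [aS _ _ _] := mD.
have cS w : continuous_path_eps ((stopped drift tau) ^~ w).
  by apply: continuous_path_stopped; [exact: stau.1|exact: continuous_drift].
have mDt := adapted_measurable uF aS t0.
have iD2 : intble P (fun w => stopped drift tau t w ^+ 2).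
  apply: (@intble_bounded _ _ _ _ (K ^+ 2)); first exact: measurable_funX.
  move=> w; rewrite normrX; have := DK t w t0; have : 0 <= `|stopped drift tau t w| by [].
  by move=> h0 h1; rewrite ler_pXn2r ?nnegrE// (le_trans h0).
suff e2' : expect P (fun w => stopped drift tau t w ^+ 2) = 0.
  have := expect_eq0 iD2 (fun w => sqr_ge0 _) e2'; apply: filterS => w /eqP.
  by rewrite sqrf_eq0 => /eqP.
apply/eqP; rewrite eq_le expect_ge0 ?andbT; last by move=> w; exact: sqr_ge0.
have K0 : 0 <= K by apply: le_trans (normr_ge0 _) (DK 0 point (lexx 0)).
apply: (@half_power_le0 _ _ (K * (1 + t))) => n.
have [mQ iQ eQ] := remainder_small n stau t0.
have hN := functional_small n.
have iN : intble P (stopped (N n) tau t).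
  by have [_ _ iN _] := martingale_jump_process hN stau; exact: iN.
have en1 : e n <= 1 by apply: (le_trans (e2 n)); rewrite exprn_ile1// invf_le1// ler1n.
have [v hv] : exists v, levy_bound (cutoff (e n / 2)) v by apply: levy_tail; rewrite divr_gt0.
have mc : measurable_fun setT (cutoff (R := R) (d := d) (e n / 2)).
  by apply: continuous_measurable_vector; exact: continuous_cutoff.
have oN := jump_process_orthogonal hN stau mc (vanish_cutoff (d := d) (e0 n))
  (fun y => small_coord_le i y (e0 n) en1) hv (adapted_cutoff (e0 n)) mD DK cS t0.
have DKt w : `|stopped drift tau t w| <= K by exact: DK.
have iDN : intble P (fun w => stopped drift tau t w * stopped (N n) tau t w).
  exact: (intbleM mDt DKt iN).
have iDQ : intble P (fun w => stopped drift tau t w * remainder n tau t w).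
  exact: (intbleM mDt DKt iQ).
have [_ _ iMD _] := mMD.
have eMD : expect P (stopped (fun t w => M t w * drift t w) tau t) = 0.
  have := martingale_expect mMD (lexx 0) t0 (usual_setT uF (lexx 0)).
  under eq_expect do rewrite indicT mul1r.
  move=> ->; rewrite -[RHS](expect_cst P 0); apply: eq_expect => w.
  by rewrite stoppedE stop_at0 ?drift0 ?mulr0//; exact: stau.1.
have i1 := intbleB (intbleB (iMD t t0) iDN) iDQ.
have [_ ->] : intble P (fun w => stopped drift tau t w ^+ 2) /\
   expect P (fun w => stopped drift tau t w ^+ 2) =
   expect P (fun w => stopped (fun t w => M t w * drift t w) tau t w -
      stopped drift tau t w * stopped (N n) tau t w -
      stopped drift tau t w * remainder n tau t w).
  apply: (ae_eq_intble i1); first exact: measurable_funX.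
  apply: filterS ae_good => w gw; have h := drift_decomposition n stau t0 gw.
  rewrite expr2 [X in _ = _ * X]h 2![in RHS]mulrBr; congr (_ - _ - _).
  by rewrite !stoppedE; exact: mulrC.
rewrite expectB//; last by apply: intbleB => //; exact: iMD.
rewrite expectB//; last exact: iMD.
rewrite eMD oN subrr sub0r (le_trans (ler_norm _))// normrN.
apply: (le_trans (le_norm_expect iDQ)).
rewrite mulrCA; apply: (@le_trans _ _ (K * expect P (fun w => `|remainder n tau t w|))).
  rewrite -expectZ; last exact: intble_norm.
  apply: le_expect; [exact: intble_norm|by apply: intbleZ; exact: intble_norm|].
  by move=> w; rewrite normrM ler_wpM2r.
by rewrite ler_wpM2l.
Qed.

End drift_martingale.

(** Localisation: stop when M, or M L, ceases to be controlled as a martingale, and when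
    L reaches the level k. Pure discontinuity of M is applied to the continuous local
    martingale L. *)
Lemma drift_vanishes t :
  adapted F (fun t w => truncated X unit_truncation t w i 0 - X 0 w i 0) ->
  (forall w, Xc 0 w = 0) -> continuous_local_martingale P F Xc ->
  purely_discontinuous P F (fun t w => truncated X unit_truncation t w i 0 - X 0 w i 0 - Xc t w) ->
  0 <= t -> {ae P, forall w, drift t w = 0}.
Proof.
move=> aM Xc0 [[aXc cdXc _] cXc'] [lM _ pd] t0.
have cXc w : continuous_path_eps (Xc ^~ w) by exact/continuous_pathP.
have cD w : continuous_path_eps (drift ^~ w) by exact: continuous_drift.
have [aD dD] := adapted_cadlag_drift aXc cXc.
have [_ _ [tau [stau ntau ctau mtau]]] := lM.
have lD : continuous_local_martingale P F drift.
  split; last by move=> w; exact/continuous_pathP.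
  split; [exact: aD|exact: dD|exists tau; split; [exact: stau|exact: ntau|exact: ctau|]].
  by move=> k; exact: (martingale_drift aM aXc cXc (stau k) (mtau k)).
have [_ _ [rho [srho nrho crho mrho]]] := pd _ lD.
pose ex k := exit_level drift k%:R.
have sex k : stopping_time F (ex k) by exact: (exit_level_stopping uF _ aD dD).
(* Stopping at the level k makes the drift bounded. *)
pose S k w := Order.min (rho k w) (Order.min (tau k w) (ex k w)).
have sS k : stopping_time F (S k).
  by apply: (stopping_time_min uF (srho k)); exact: (stopping_time_min uF (stau k) (sex k)).
have nullS k : {ae P, forall w, stopped drift (S k) t w = 0}.
  apply: (martingale_drift_null aM aXc cXc Xc0 (K := k%:R) (sS k) _ _ _ t0).
  - rewrite (_ : S k = fun w => Order.min (tau k w) (Order.min (rho k w) (ex k w))).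
      apply: (martingale_stopped_min uF); [exact: stau|exact: (stopping_time_min uF (srho k) (sex k))|exact: mtau].
    by apply/funext => w; rewrite /S minCA.
  - apply: (martingale_stopped_min uF); [exact: srho|exact: (stopping_time_min uF (stau k) (sex k))|exact: mrho].
  - move=> u w u0; rewrite stoppedE; have S0 := (sS k).1 w.
    apply: exit_level_continuous => //; [by rewrite drift0// normr0|exact: stop_at_ge0|].
    apply: (@le_trans _ _ (S k w)); last by rewrite /S !ge_min lexx !orbT.
    by case: stop_atP => // r -> _ _; rewrite lexx.
apply: filterS3 (ae_foralln nullS) ctau crho => w h /cvgeyPge/(_ t)[k1 _ h1] /cvgeyPge/(_ t)[k2 _ h2].
have [K KD] := continuous_path_bounded (cD w) t0.
have [k3 h3] := natr_above K.
pose k := maxn k1 (maxn k2 k3).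
have tS : (t%:E <= S k w)%E.
  rewrite /S !le_min h1/= ?h2/= /k ?leq_max ?leqnn ?orbT//.
  apply: exit_level_after => s s0 st; apply: (le_trans (KD s s0 st)).
  by apply: h3; rewrite /k !leq_max leqnn !orbT.
by rewrite -(h k) stoppedE stop_at_id.
Qed.

End identification.

(** * Probability of leaving a ball *)

Definition exit_event x rho t :=
  [set w | exists s, [/\ 0 <= s, s <= t & rho < enorm (X s w - x)]].

(** An enumeration of the rational times, moved into [0, t] so that t itself is
    included. *)
Definition clipped_time t k : R :=
  Num.min t (Num.max 0 (ratr (odflt 0 (unpickle k : option rat)))).

Lemma clipped_time_bounds t k : 0 <= t -> 0 <= clipped_time t k <= t.
Proof. by move=> t0; rewrite /clipped_time le_min t0 le_max lexx ge_min lexx. Qed.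

Lemma exit_persists x rho s w : 0 <= s -> rho < enorm (X s w - x) ->
  exists2 dl, 0 < dl & forall u, s <= u -> u < s + dl -> rho < enorm (X u w - x).
Proof.
move=> s0 h; have cE := @continuous_enorm R d (X s w - x).
have /cE : nbhs (enorm (X s w - x)) [set z | rho < z].
  by apply: open_nbhs_nbhs; split => //; exact: open_gt.
move=> /nbhs_ballP[r /= r0 hr]; have [dl dl0 H] := cadlag_right (cX w) s0 r0.
exists dl => // u su us; apply: hr; rewrite -ball_normE/= distrC.
by rewrite opprB addrA subrK; exact: H.
Qed.

(** Leaving the closed ball is an open condition, so that by right-continuity the
    rational times, together with t, detect it. *)
Lemma exit_eventE x rho t : 0 <= t -> exit_event x rho t =
  \bigcup_k [set w | rho < enorm (X (clipped_time t k) w - x)].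
Proof.
move=> t0; apply/seteqP; split=> [w [s [s0 st h]]|w [k _ /= h]]; last first.
  by have /andP[k0 kt] := clipped_time_bounds k t0; exists (clipped_time t k).
have [dl dl0 H] := exit_persists s0 h.
have sdl : s < s + dl by rewrite ltrDl.
have [q] := rat_in_itvoo sdl.
rewrite in_itv/= => /andP[sq qs]; exists (pickle q) => //=.
have q0 : 0 <= ratr q :> R by rewrite (le_trans s0)// ltW.
rewrite /clipped_time pickleK/= (max_r q0); have [tq|qt] := leP t (ratr q).
  by apply: H => //; exact: le_lt_trans qs.
by apply: H => //; exact: ltW.
Qed.

Lemma measurable_exit_event x rho t : 0 <= t -> measurable (exit_event x rho t).
Proof.
move=> t0; rewrite exit_eventE//; apply: bigcup_measurable => k _.
have /andP[k0 _] := clipped_time_bounds k t0.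
have mX : measurable_fun setT (fun w => X (clipped_time t k) w - x).
  apply: measurable_vectorP => i; under eq_fun do rewrite !mxE.
  apply: measurable_funB => //; apply: (usual_fun_measurable uF k0).
  exact: coord_X_measurable.
rewrite (_ : [set w | _] = (fun w => X (clipped_time t k) w - x) @^-1` [set y | rho < enorm y])//.
by rewrite -[X in measurable X]setTI; apply: mX => //; exact: measurable_enorm_gt.
Qed.

(** A jump of norm at least rho / 2 contributes 1 to the sum of the cutoffs at rho / 2;
    without any, the function cut off at rho sees no jump. *)
Lemma no_big_jump rho t s i w : 0 < rho -> 0 <= s -> s <= t ->
  jump_process (cutoff (rho / 2)) t w < 1 -> jump_process (cut_coord i rho) s w = 0.
Proof.
move=> rho0 s0 st J1; have t0 := le_trans s0 st; have rho2 : 0 < rho / 2 by rewrite divr_gt0.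
have [r rt] := big_jumps_exist (cX w) (cutoff_radius_gt0 (d := d) rho0) t0.
rewrite /jump_process (jump_sumE (vanish_cut_coord i rho0) rt st) big_seq_cond big1// => u /andP[ur _].
apply: (cut_coord_near i rho0); rewrite leNgt; apply/negP => hu.
have [_ r0 _] := rt; have /andP[_ ut] := r0 u ur.
move: J1; rewrite /jump_process (jump_sumE (vanish_cutoff rho0) rt (lexx t)) ltNge; case/negP.
have cu : cutoff (rho / 2) (jump (X ^~ w) u) = 1 by rewrite cutoff_far// (ltW hu).
rewrite [leRHS](big_rem u ur).
rewrite /= ifT; last exact: ut.
rewrite cu.
have S0 : 0 <= \sum_(s <- rem u r | s <= t) cutoff (rho / 2) (jump (X ^~ w) s).
  by apply: sumr_ge0 => v _; exact: cutoff_ge0.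
by rewrite lerDl.
Qed.

(** The first term accounts for the big jumps: the cutoff at rho / 2 is supported where
    |y| > rho / 4, two halvings of the radius. The second term accounts for the d
    coordinates: the variance is divided by (rho / d)^2. *)
Definition exit_constant q : R := q ^+ 2 + d%:R ^+ 3 * (4 * q / (4 - q)).

(** Outside a null set every coordinate of X - X_0 is the limit of the sums J_n of its
    cut off jumps. If the ball is left and no jump has norm rho / 2 or more, some
    coordinate of this limit exceeds rho / d, hence so does J_n for all large n; and
    J_n is then also the sum of the jumps between e n and rho, to which the maximal
    inequality applies uniformly in n. *)
Lemma exit_probability rho c q x t (Xc : R -> T -> 'cV[R]_d) :
  (0 < d)%N -> 0 < rho -> 0 <= c -> 0 <= q -> q < 4 -> tail_bound rho c q ->
  (forall i, adapted F (fun t w => truncated X unit_truncation t w i 0 - X 0 w i 0)) ->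
  (forall i, [/\ continuous_local_martingale P F (fun t w => Xc t w i 0),
    forall w, Xc 0 w i 0 = 0,
    purely_discontinuous P F (fun t w =>
        truncated X unit_truncation t w i 0 - X 0 w i 0 - Xc t w i 0) &
    local_martingale P F (fun t w => Xc t w i 0 * Xc t w i 0)]) ->
  P [set w | X 0 w = x] = 1%E -> 0 <= t ->
  (P (exit_event x rho t) <= (exit_constant q * (c * t))%:E)%E.
Proof.
move=> d0 rho0 c0 q0 q4 tb aM hXc PX0 t0.
have [e [e0 eS e2 er he]] := tail_cutoff_levels rho0 c0 q0 q4 tb.
pose u := clipped_time t.
have u0 k : 0 <= u k by have /andP[] := clipped_time_bounds k t0.
have ut k : u k <= t by have /andP[] := clipped_time_bounds k t0.
have aeX0 : {ae P, forall w, X 0 w = x}.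
  have m0 : measurable [set w | X 0 w = x].
    have := aX (lexx 0) (_ : measurable [set x]).
    rewrite (_ : X 0 @^-1` [set x] = [set w | X 0 w = x])// => h.
    apply: (usual_meas uF (lexx 0)); apply: h; rewrite -[X in measurable X]setCK; apply: measurableC.
    apply: measurable_open; apply: closed_openC; apply: accessible_closed_set1.
    by apply: hausdorff_accessible; exact: norm_hausdorff.
  exists (~` [set w | X 0 w = x]); split => //; first exact: measurableC.
  by rewrite probability_setC// PX0 subee.
have aeX i k : {ae P, forall w, good i e w /\ X (u k) w i 0 - X 0 w i 0 = jump_limit i e (u k) w}.
  have [cXc Xc0 pd sq] := hXc i; have [[aXc _ _] _] := cXc.
  have h1 := drift_vanishes e0 eS e2 he (aM i) Xc0 cXc pd (u0 k).
  have h2 := square_martingale_null uF aXc Xc0 sq (u0 k).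
  apply: filterS3 (ae_good i e0 eS he) h1 h2 => w gw; rewrite /drift mem_set// => + h.
  by rewrite h subr0 => /eqP; rewrite subr_eq0 => /eqP.
(* The event that contains the paths with a jump of norm rho / 2 or more. *)
pose bigjump := [set w | 1 <= jump_process (cutoff (rho / 2)) t w].
pose A i n := [set w | exists s, [/\ 0 <= s, s <= t &
  rho / d%:R < `|jump_process (cut_coord_diff i (e n) rho) s w|]].
(* The i-th coordinate exceeds rho / d for all large n. *)
pose B i := \bigcup_N \bigcap_(n in [set n | (N <= n)%N]) A i n.
have d0' : 0 < d%:R :> R by rewrite ltr0n.
have jA i n := jump_functional_cut_diff i (e0 n) (er n).
have mA i n : measurable (A i n).
  apply: (usual_meas uF t0); apply: (exceed_measurable uF) => //.
  - exact: jf_adapted (jA i n).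
  - by move=> w; exact: cadlag_jump_process (jA i n).
pose v := rho ^+ 2 * c * (4 * q / (4 - q)).
have PA i n : (P (A i n) <= (d%:R ^+ 2 * (4 * q / (4 - q)) * (c * t))%:E)%E.
  have bv : levy_bound (fun y => cut_coord_diff i (e n) rho y ^+ 2) v.
    apply: levy_bound_le (tail_levy_square rho0 c0 q0 q4 tb) => y; first exact: sqr_ge0.
    rewrite -real_normK ?num_real// ler_sqr ?nnegrE//.
      exact: (cut_coord_diff_le i y (e0 n) (er n)).
    by rewrite le_min enorm_ge0 (ltW rho0).
  have K0 : 0 < rho / d%:R by rewrite divr_gt0.
  apply: (le_trans (jump_process_maximal (jA i n) bv K0 t0)).
  rewrite lee_fin le_eqVlt; apply/orP; left; apply/eqP; rewrite /v.
  move: (4 * q / (4 - q)) => z; field.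
  by rewrite !gt_eqF.
have mB i : measurable (B i) by have [] := measure_liminf_le (mA i) (PA i).
have PB i : (P (B i) <= (d%:R ^+ 2 * (4 * q / (4 - q)) * (c * t))%:E)%E.
  by have [] := measure_liminf_le (mA i) (PA i).
have rho2 : 0 < rho / 2 by rewrite divr_gt0.
have aJ : adapted F (jump_process (cutoff (rho / 2))) by exact: adapted_cutoff.
have mJ : measurable_fun setT (jump_process (cutoff (rho / 2)) t) by exact: (adapted_measurable uF aJ t0).
have mbig : measurable bigjump.
  rewrite (_ : bigjump = jump_process (cutoff (rho / 2)) t @^-1` `[1, +oo[).
    by rewrite -[X in measurable X]setTI; exact: mJ.
  by apply/seteqP; split=> w; rewrite /bigjump/= in_itv/= andbT.
have Pbig : (P bigjump <= (q ^+ 2 * (c * t))%:E)%E.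
  have lc : levy_bound (cutoff (rho / 2)) (c * q ^+ 2).
    move=> y; apply: le_trans (tail_indic y 2 tb); apply: ge0_le_lower_integral => z _.
      by rewrite lee_fin cutoff_ge0.
    rewrite lee_fin indicE; have [zr|zr] := leP (enorm z) (rho / 2 / 2).
      by rewrite cutoff_near.
    rewrite mem_set ?cutoff_le1//=; apply: le_lt_trans zr.
    by rewrite expr2 mulrA.
  have mc : measurable_fun setT (cutoff (R := R) (d := d) (rho / 2)).
    by apply: continuous_measurable_vector; exact: continuous_cutoff.
  have [iJ eJ] := jump_process_mean mc (@cutoff_ge0 _ _ _) (cutoff_radius_gt0 (d := d) rho0)
    (vanish_cutoff rho0) lc aJ t0.
  have J0 w : 0 <= jump_process (cutoff (rho / 2)) t w.
    have [r rt] := big_jumps_exist (cX w) (cutoff_radius_gt0 (d := d) rho0) t0.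
    rewrite /jump_process (jump_sumE (vanish_cutoff rho0) rt (lexx t)).
    by apply: sumr_ge0 => z _; exact: cutoff_ge0.
  have bJ w : bigjump w -> 1 <= jump_process (cutoff (rho / 2)) t w by [].
  apply: (le_trans (expect_markov mbig iJ J0 bJ ltr01)).
  by rewrite lee_fin divr1 (le_trans eJ)// (mulrC c) mulrA.
have aeall : {ae P, forall w, X 0 w = x /\ forall i : 'I_d, forall k,
    good i e w /\ X (u k) w i 0 - X 0 w i 0 = jump_limit i e (u k) w}.
  have h : {ae P, forall w, forall k, forall i : 'I_d,
      good i e w /\ X (u k) w i 0 - X 0 w i 0 = jump_limit i e (u k) w}.
    apply: ae_foralln => k; apply: filter_forall => i; exact: aeX.
  by apply: filterS2 aeX0 h => w ? h; split => // i k; exact: h.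
have [Z [mZ PZ hZ]] := aeall.
have [mU PU] := measure_big_union_le (index_enum 'I_d) mB PB.
apply: (@le_trans _ _ (P (Z `|` (bigjump `|` \big[setU/set0]_(i : 'I_d) B i)))).
  apply: le_measure; rewrite ?inE; first exact: measurable_exit_event.
    by apply: measurableU => //; exact: measurableU.
  rewrite exit_eventE// => w [k _ /= hk]; rewrite -/(u k) in hk.
  have [Zw|nZ] := pselect (Z w); [by left|right].
  have [big|small] := pselect (bigjump w); [by left|right].
  have [X0 hw] : X 0 w = x /\ forall i : 'I_d, forall k,
      good i e w /\ X (u k) w i 0 - X 0 w i 0 = jump_limit i e (u k) w.
    by apply: contrapT => h; apply: nZ; exact: hZ.
  have [i hi] := enorm_gt_coord d0 hk.
  rewrite (bigD1 i)//=; left; have [gw hX] := hw i k.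
  have [N0 HN0] := good_limit gw; have [N1 HN1] := natr_above (u k).
  have [cJ _] := HN0 _ (leq_maxl N0 N1) _ (u0 k) (HN1 _ (leq_maxr N0 N1)).
  have hl : rho / d%:R < `|jump_limit i e (u k) w| by rewrite -hX X0; move: hi; rewrite !mxE.
  have e0' : 0 < `|jump_limit i e (u k) w| - rho / d%:R by rewrite subr_gt0.
  have /cvgrPdist_lt/(_ _ e0')[N _ HN] := cJ.
  exists N => // n /= Nn; exists (u k); split; [exact: u0|exact: ut|].
  (* Without big jumps the sum cut off at rho is 0, so that subtracting it changes
     nothing. *)
  have J1 : jump_process (cutoff (rho / 2)) t w < 1 by rewrite ltNge; apply/negP.
  have := HN n Nn; have := lerB_dist (jump_limit i e (u k) w) (cut_process i e n (u k) w).
  rewrite (jump_processB w (u0 k) (cutoff_radius_gt0 (d := d) (e0 n)) (vanish_cut_coord i (e0 n))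
    (cutoff_radius_gt0 (d := d) rho0) (vanish_cut_coord i rho0)).
  rewrite (no_big_jump i rho0 (u0 k) (ut k) J1) subr0 -/(cut_process i e n (u k) w).
  by move=> h1 h2; lra.
apply: (le_trans (measureU2 _ mZ _)); first exact: measurableU.
rewrite [X in (X + _)%E]PZ add0e.
apply: (le_trans (measureU2 _ mbig mU)).
apply: (le_trans (leeD Pbig PU)).
have -> : size (index_enum 'I_d) = d by rewrite -sum1_size big_const_ord iter_addn_0 mul1n.
rewrite -EFinD lee_fin /exit_constant le_eqVlt; apply/orP; left; apply/eqP.
by move: (4 * q / (4 - q)) => z; ring.
Qed.

End jump_processes.

(** * Exponentials of symmetric matrices *)

Lemma diagonalized_power {F : fieldType} {n : nat} (M Q : 'M[F]_n) (D : 'rV[F]_n) l :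
  Q \in unitmx -> M = invmx Q *m diag_mx D *m Q ->
  M ^+ l = invmx Q *m diag_mx (\row_k D 0 k ^+ l) *m Q.
Proof.
move=> uQ eM; elim: l => [|l ih].
  rewrite expr0 (_ : \row_k _ = const_mx 1); last by apply/rowP => k; rewrite !mxE.
  by rewrite diag_const_mx mulmx1 mulVmx.
rewrite exprS ih [X in X * _]eM -[LHS]/(invmx Q *m diag_mx D *m Q *m (invmx Q *m diag_mx (\row_k D 0 k ^+ l) *m Q)) !mulmxA mulmxK//.
rewrite -(mulmxA _ (diag_mx D)) mulmx_diag; congr (_ *m diag_mx _ *m _).
by apply/rowP => k; rewrite !mxE exprS.
Qed.

Section symmetric_matrices.
Context {R : realType} {d : nat}.
Variable A : 'M[R]_d.
Hypothesis symA : A^T = A.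

Let Ac : 'M[R[i]]_d := map_mx (real_complex R) A.
Let U := spectralmx Ac.
Let D := spectral_diag Ac.

Definition spec_val (k : 'I_d) : R := complex.Re (D 0 k).
(** The real part of the projection on the k-th vector of a unitary eigenbasis. As A
    is real this gives a real spectral decomposition, without choosing real
    eigenvectors: when eigenvalues coincide the single matrices need not be
    projections, but the formula for the powers of A holds. *)
Definition spec_proj (k : 'I_d) : 'M[R]_d :=
  \matrix_(i, j) complex.Re ((U k i)^* * U k j).

Let hermA : Ac \is hermsymmx.
Proof.
apply/is_hermitianmxP; rewrite expr0 scale1r.
apply/matrixP => i j; rewrite !mxE -{1}symA mxE.
by rewrite /= /Num.conj/= /conjc oppr0.
Qed.

Let valE k : D 0 k = (spec_val k)%:C%C.
Proof.
have /mxOverP/(_ 0 k) := hermitian_spectral_diag_real hermA.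
by rewrite /spec_val -/D; case: (D 0 k) => a b; rewrite complex_real => /eqP /= ->.
Qed.

Let specA : Ac = invmx U *m diag_mx D *m U.
Proof. by apply/orthomx_spectralP; exact: hermitian_normalmx. Qed.

Let unitU : U \in unitmx. Proof. exact: spectral_unit. Qed.

Let invU i k : invmx U i k = (U k i)^*.
Proof. by rewrite invmx_unitary ?spectral_unitarymx// !mxE. Qed.

Let powerAc l : Ac ^+ l = invmx U *m diag_mx (\row_k D 0 k ^+ l) *m U.
Proof. exact: diagonalized_power unitU specA. Qed.

(** Take real parts in the complex decomposition, whose eigenvalues are real because
    A is hermitian. *)
Lemma spec_power l : A ^+ l = \sum_k spec_val k ^+ l *: spec_proj k.
Proof.
have mapX : map_mx (real_complex R) (A ^+ l) = Ac ^+ l.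
  elim: (l) => [|m ih]; first by rewrite !expr0 map_mx1.
  by rewrite !exprS -!/(_ *m _) map_mxM ih.
apply/matrixP => i j; have := congr1 (fun M : 'M[R[i]]_d => complex.Re (M i j)) mapX.
rewrite mxE /= => ->; rewrite powerAc mxE summxE raddf_sum; apply: eq_bigr => k _.
rewrite mul_mx_diag !mxE invU valE -rmorphXn/=.
case: ((U k i)^*) => a b; case: (U k j) => a' b' /=; ring.
Qed.

Let spec_quad k (v : 'cV[R]_d) : R := \sum_i \sum_j v i 0 * spec_proj k i j * v j 0.

(** It is the squared modulus of the component of v on the k-th eigenvector. *)
Lemma spec_quad_ge0 k v : 0 <= spec_quad k v.
Proof.
pose w := \sum_j U k j * (v j 0)%:C%C.
have : 0 <= w^* * w by rewrite mulrC mul_conjC_ge0.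
rewrite lecE => /andP[_]; congr (_ <= _).
rewrite /w rmorph_sum /= mulr_suml raddf_sum; apply: eq_bigr => i _.
rewrite mulr_sumr raddf_sum; apply: eq_bigr => j _; rewrite mxE rmorphM /=.
case: (U k j) => a b; case: (U k i) => a' b' /=; ring.
Qed.

Let spec_comb (f : 'I_d -> R) : 'M[R]_d := \sum_k f k *: spec_proj k.

Let spec_poly (c : nat -> R) n : 'M[R]_d := \sum_(0 <= l < n) c l *: A ^+ l.

Let spec_polyE c n : spec_poly c n = spec_comb (fun k => \sum_(0 <= l < n) c l * spec_val k ^+ l).
Proof.
rewrite /spec_poly /spec_comb; under eq_bigr do rewrite spec_power scaler_sumr.
rewrite exchange_big/=; apply: eq_bigr => k _; rewrite scaler_suml.
by apply: eq_bigr => l _; rewrite scalerA.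
Qed.

(** The product of two polynomials in A is a polynomial in A, so that the values at
    the eigenvalues are multiplied. *)
Let spec_poly_sqr c n : spec_poly c n *m spec_poly c n =
  spec_comb (fun k => (\sum_(0 <= l < n) c l * spec_val k ^+ l) ^+ 2).
Proof.
rewrite {1}/spec_poly mulmx_suml /spec_comb.
under eq_bigr do rewrite mulmx_sumr.
transitivity (\sum_(0 <= l < n) \sum_(0 <= m < n) \sum_k
    ((c l * spec_val k ^+ l) * (c m * spec_val k ^+ m)) *: spec_proj k).
  apply: eq_bigr => l _; apply: eq_bigr => m _.
  rewrite -scalemxAl -scalemxAr scalerA -[A ^+ l *m A ^+ m]exprD spec_power scaler_sumr.
  by apply: eq_bigr => k _; rewrite scalerA; congr (_ *: _); rewrite exprD; ring.
under eq_bigr do rewrite exchange_big/=.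
rewrite exchange_big/=; apply: eq_bigr => k _.
under eq_bigr do rewrite -scaler_suml -mulr_sumr.
by rewrite -scaler_suml -mulr_suml expr2.
Qed.

Let enorm_sqr (v : 'cV[R]_d) : enorm v ^+ 2 = \sum_i v i 0 ^+ 2.
Proof. by rewrite /enorm sqr_sqrtr// sumr_ge0// => i _; exact: sqr_ge0. Qed.

Let enorm_sqr_mx (v : 'cV[R]_d) : enorm v ^+ 2 = (v^T *m v) 0 0.
Proof. by rewrite enorm_sqr mxE; apply: eq_bigr => i _; rewrite mxE expr2. Qed.

Let spec_comb_quad f v : (v^T *m spec_comb f *m v) 0 0 = \sum_k f k * spec_quad k v.
Proof.
rewrite /spec_comb mulmx_sumr mulmx_suml summxE; apply: eq_bigr => k _.
rewrite -scalemxAr -scalemxAl mxE; congr (_ * _).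
rewrite mxE /spec_quad exchange_big/=; apply: eq_bigr => j _.
by rewrite mxE mulr_suml; apply: eq_bigr => i _; rewrite mxE.
Qed.

Let tr_power l : (A ^+ l)^T = A ^+ l.
Proof.
elim: l => [|l ih]; first by rewrite expr0 trmx1.
by rewrite {1}exprS -[A * _]/(A *m _) trmx_mul ih symA -[_ *m _]/(_ * _) -exprSr.
Qed.

Let spec_poly_norm c n v : enorm (spec_poly c n *m v) ^+ 2 =
  \sum_k (\sum_(0 <= l < n) c l * spec_val k ^+ l) ^+ 2 * spec_quad k v.
Proof.
rewrite enorm_sqr_mx trmx_mul -mulmxA (mulmxA _ (spec_poly c n)) mulmxA.
rewrite -spec_comb_quad -spec_poly_sqr; congr ((_ *m (_ *m _) *m _) 0 0).
by rewrite /spec_poly linear_sum; apply: eq_bigr => l _; rewrite linearZ/= tr_power.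
Qed.

Lemma spec_quad_sum v : \sum_k spec_quad k v = enorm v ^+ 2.
Proof.
transitivity (\sum_k 1 * spec_quad k v); first by apply: eq_bigr => k _; rewrite mul1r.
rewrite -spec_comb_quad enorm_sqr_mx; congr (fun_of_matrix _ 0 0).
rewrite -[in RHS](mulmx1 v^T); congr (_ *m _ *m _).
by rewrite -[RHS]/(A ^+ 0) spec_power; apply: eq_bigr => k _; rewrite expr0.
Qed.

Let spec_comb_coord f (v : 'cV[R]_d) i : (spec_comb f *m v) i 0 = \sum_k f k * (spec_proj k *m v) i 0.
Proof.
rewrite /spec_comb mulmx_suml summxE; apply: eq_bigr => k _.
by rewrite -scalemxAl mxE.
Qed.

(** For polynomials p, |p(A) v|^2 = v^T p(A)^2 v since A is symmetric; functions that
    are limits of polynomials on the spectrum inherit the formula. *)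
Let spec_comb_norm (c : nat -> R) f (v : 'cV[R]_d) :
  (forall k, \sum_(0 <= l < n) c l * spec_val k ^+ l @[n --> \oo] --> f k) ->
  enorm (spec_comb f *m v) ^+ 2 = \sum_k f k ^+ 2 * spec_quad k v.
Proof.
move=> cf; pose fn n k := \sum_(0 <= l < n) c l * spec_val k ^+ l.
have c1 : \sum_i (\sum_k fn n k * (spec_proj k *m v) i 0) ^+ 2 @[n --> \oo] -->
    \sum_i (\sum_k f k * (spec_proj k *m v) i 0) ^+ 2.
  apply: cvg_big => [|i _]; first exact: add_continuous.
  apply: (@cvg_comp _ _ _ _ (fun x : R => x ^+ 2)); last exact: exprn_continuous.
  apply: cvg_big => [|k _]; first exact: add_continuous.
  by apply: cvgMr_tmp; exact: cf.
have c2 : \sum_k fn n k ^+ 2 * spec_quad k v @[n --> \oo] --> \sum_k f k ^+ 2 * spec_quad k v.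
  apply: cvg_big => [|k _]; first exact: add_continuous.
  apply: cvgMr_tmp.
  by apply: (@cvg_comp _ _ _ _ (fun x : R => x ^+ 2) _ _ _ (cf k)); exact: exprn_continuous.
rewrite enorm_sqr; under eq_bigr do rewrite spec_comb_coord.
have e12 : (fun n => \sum_i (\sum_k fn n k * (spec_proj k *m v) i 0) ^+ 2) =
    (fun n => \sum_k fn n k ^+ 2 * spec_quad k v).
  apply/funext => n; rewrite -spec_poly_norm enorm_sqr spec_polyE.
  by apply: eq_bigr => i _; rewrite spec_comb_coord.
rewrite e12 in c1; apply/esym/(cvg_unique _ c2 c1); exact: norm_hausdorff.
Qed.

Lemma exp_poly_cvg t (x : R) :
  \sum_(0 <= l < n) (t ^+ l / l`!%:R) * x ^+ l @[n --> \oo] --> expR (t * x).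
Proof.
have := is_cvg_series_exp_coeff (t * x); rewrite /expR => /cvg_ex[l cl].
rewrite (cvg_lim _ cl)//; apply: cvg_trans cl; apply: near_eq_cvg; near=> n.
apply: eq_bigr => k _; rewrite /exp_coeff/= exprMn; ring.
Unshelve. all: by end_near. Qed.

Lemma mxexp_spectral t : mxexp (t *: A) = spec_comb (fun k => expR (t * spec_val k)).
Proof.
have tX l : (t *: A) ^+ l = t ^+ l *: A ^+ l.
  elim: l => [|l ih]; first by rewrite !expr0 scale1r.
  by rewrite !exprS ih -[_ * _]/(_ *m _) -scalemxAl -scalemxAr scalerA.
rewrite /mxexp (_ : series _ = fun n => spec_comb (fun k => \sum_(0 <= l < n) (t ^+ l / l`!%:R) * spec_val k ^+ l)).
  apply: cvg_lim; first exact: norm_hausdorff.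
  apply: cvg_big => [|k _]; first exact: add_continuous.
  apply: cvgZr_tmp; exact: exp_poly_cvg.
apply/funext => n; rewrite -spec_polyE /spec_poly /series/=; apply: eq_bigr => l _.
by rewrite tX scalerA mulrC.
Qed.

Lemma mxexp_norm t v : enorm (mxexp (t *: A) *m v) ^+ 2 =
  \sum_k expR (t * spec_val k) ^+ 2 * spec_quad k v.
Proof. by rewrite mxexp_spectral; apply: spec_comb_norm => k; exact: exp_poly_cvg. Qed.

(** The operator norm of the exponential is governed by the largest exponent. *)
Lemma mxexp_norm_le t m v : (forall k, t * spec_val k <= m) ->
  enorm (mxexp (t *: A) *m v) <= expR m * enorm v.
Proof.
move=> tm; rewrite -ler_sqr ?nnegrE ?mulr_ge0 ?enorm_ge0 ?expR_ge0//.
rewrite mxexp_norm exprMn -spec_quad_sum mulr_sumr; apply: ler_sum => k _.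
rewrite ler_wpM2r ?spec_quad_ge0// ler_sqr ?nnegrE ?expR_ge0// ler_expR.
exact: tm.
Qed.

Lemma mxexp_entry t i j : mxexp (t *: A) i j = \sum_k expR (t * spec_val k) * spec_proj k i j.
Proof. by rewrite mxexp_spectral summxE; apply: eq_bigr => k _; rewrite mxE. Qed.

Lemma spec_val_eigen k : eigen_re A (spec_val k).
Proof.
exists (D 0 k) => //=; apply/eigenvalueP; exists (row k U).
  rewrite -/Ac specA !mulmxA -row_mul mulmxV// -row_mul mul1mx.
  by rewrite row_diag_mx -scalemxAl -rowE.
apply/negP => /eqP U0; have : row k (U *m invmx U) = 0 by rewrite row_mul U0 mul0mx.
move=> /rowP/(_ k); rewrite mulmxV// !mxE eqxx => /eqP; rewrite oner_eq0//.
Qed.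

End symmetric_matrices.

(** Compare both sides of the eigenvalue equation in the l1 norm. Boundedness makes
    the infimum and the supremum in [lambda_min] and [lambda_max] meaningful. *)
Lemma eigen_re_bounded {R : realType} {d : nat} (A : 'M[R]_d) x : eigen_re A x ->
  `|x| <= \sum_i \sum_j `|A i j|.
Proof.
move=> [z /eigenvalueP[v vA v0] <-]; set B := \sum_i _.
suff : `|z| <= B%:C%C.
  move=> zB; have := le_trans (normc_ge_Re z) zB; rewrite lecR; apply: le_trans.
  by [].
pose S := \sum_j `|v 0 j|.
have S0 : 0 < S.
  rewrite lt_neqAle sumr_ge0// andbT eq_sym; apply: contra v0 => /eqP S0.
  apply/eqP/rowP => j; rewrite mxE; apply/eqP; rewrite -normr_eq0.
  by rewrite (psumr_eq0P (fun j _ => normr_ge0 (v 0 j)) S0).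
rewrite -(ler_pM2r S0) /S mulr_sumr.
have AB i j : `|(map_mx (real_complex R) A) i j| = (`|A i j|)%:C%C by rewrite mxE normc_def/= expr0n addr0 sqrtr_sqr.
apply: (@le_trans _ _ (\sum_j \sum_i `|v 0 i| * (`|A i j|)%:C%C)).
  apply: ler_sum => j _; rewrite -normrM.
  have -> : z * v 0 j = (v *m map_mx (real_complex R) A) 0 j by rewrite vA mxE.
  rewrite mxE; apply: (le_trans (ler_norm_sum _ _ _)); apply: ler_sum => i _.
  by rewrite normrM AB.
rewrite exchange_big/= mulr_sumr; apply: ler_sum => i _.
rewrite -mulr_sumr mulrC ler_wpM2r// -rmorph_sum lecR /B.
by rewrite [leRHS](bigD1 i)//= lerDl; apply: sumr_ge0 => k _; apply: sumr_ge0.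
Qed.

Lemma lambda_min_le {R : realType} {d : nat} (A : 'M[R]_d) x : eigen_re A x -> lambda_min A <= x.
Proof.
move=> Ax; apply: ge_inf => //; exists (- \sum_i \sum_j `|A i j|) => y /eigen_re_bounded.
by rewrite ler_norml => /andP[].
Qed.

Lemma lambda_max_ge {R : realType} {d : nat} (A : 'M[R]_d) x : eigen_re A x -> x <= lambda_max A.
Proof.
move=> Ax; apply: ub_le_sup => //; exists (\sum_i \sum_j `|A i j|) => y /eigen_re_bounded.
by rewrite ler_norml => /andP[].
Qed.

(** * The operator-stable-like Levy measure *)

Section levy_measure.
Context {R : realType} {d : nat}.
Implicit Types (A : 'M[R]_d) (B : set 'cV[R]_d) (v theta : 'cV[R]_d) (r c : R).

(** By the spectral formula the entries of r^A are combinations of exponentials of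
    multiples of ln r. *)
Lemma measurable_mxpow A : A^T = A ->
  measurable_fun setT (fun p : 'cV[R]_d * R => mxpow p.2 A *m p.1).
Proof.
move=> sA; apply: measurable_vectorP => i.
under eq_fun do rewrite mxE.
apply: measurable_sum => j; apply: measurable_funM.
  under eq_fun do rewrite mxexp_entry//.
  apply: measurable_sum => k; apply: measurable_funM => //.
  apply: (measurableT_comp (@measurable_expR R)); apply: measurable_funM => //.
  by apply: (measurableT_comp (@measurable_ln R)).
apply: (@measurableT_comp _ _ _ _ _ _ (fun v : 'cV[R]_d => v j 0)) => //.
by apply: continuous_measurable_vector; exact: continuous_coord.
Qed.

(** The inner integral in the polar form of the Levy measure. *)
Definition radial_integral A B theta : \bar R :=
  (\int[lebesgue_measure]_(r in `]0%R, +oo[) (\1_B (mxpow r A *m theta) / r ^+ 2)%:E)%E.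

Lemma radial_integral_ge0 A B theta : (0 <= radial_integral A B theta)%E.
Proof. by apply: integral_ge0 => r _; rewrite lee_fin divr_ge0// sqr_ge0. Qed.

(** Writing 1 / r^2 through the logarithm gives a function that is measurable on the
    whole line. *)
Lemma expR_ln_sqr r : 0 < r -> expR (- (ln r + ln r)) = (r ^+ 2)^-1.
Proof. by move=> r0; rewrite expRN expRD lnK ?posrE// expr2. Qed.

Let density A B (p : 'cV[R]_d * R) : \bar R :=
  (\1_(`]0, +oo[%classic) p.2 * (\1_B (mxpow p.2 A *m p.1) * expR (- (ln p.2 + ln p.2))))%:E.

Let density_ge0 A B p : (0 <= density A B p)%E.
Proof. by rewrite lee_fin !mulr_ge0// expR_ge0. Qed.

Let measurable_density A B : A^T = A -> measurable B -> measurable_fun setT (density A B).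
Proof.
move=> sA mB; apply/measurable_EFinP; apply: measurable_funM.
  by apply: (measurableT_comp (measurable_indic _)).
apply: measurable_funM.
  by apply: (measurableT_comp (measurable_indic mB)); exact: measurable_mxpow.
apply: (measurableT_comp (@measurable_expR R)); apply: measurableT_comp => //.
by apply: measurable_funD; apply: (measurableT_comp (@measurable_ln R)).
Qed.

Let radial_integralE A B theta : radial_integral A B theta =
  (\int[lebesgue_measure]_r density A B (theta, r))%E.
Proof.
rewrite /radial_integral integral_mkcond; apply: eq_integral => r _.
rewrite /density patchE /=; case: ifPn => rr.
  have r0 : 0 < r by move: (rr); rewrite inE/= in_itv/= andbT.
  by rewrite [\1_(`]0, +oo[) r]indicE rr mul1r expR_ln_sqr.
by rewrite [\1_(`]0, +oo[) r]indicE (negbTE rr) mul0r.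
Qed.

Lemma measurable_radial_integral A B : A^T = A -> measurable B ->
  measurable_fun setT (radial_integral A B).
Proof.
move=> sA mB; rewrite (_ : radial_integral A B = fubini_F lebesgue_measure (density A B)).
  apply: measurable_fun_fubini_tonelli_F => //; exact: measurable_density.
by apply/funext => theta; rewrite radial_integralE.
Qed.

Lemma indic_bigcup_series (F : (set 'cV[R]_d)^nat) v : (forall n, measurable (F n)) ->
  trivIset setT F ->
  ((\1_(\bigcup_n F n) v)%:E = \sum_(0 <= n <oo) (\1_(F n) v)%:E :> \bar R)%E.
Proof.
move=> mF tF; have := measure_semi_bigcup (\d_v : {measure set 'cV[R]_d -> \bar R}) _ tF.
by apply => //; exact: bigcup_measurable.
Qed.

Lemma radial_integral_bigcup A (F : (set 'cV[R]_d)^nat) theta : A^T = A ->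
  (forall n, measurable (F n)) -> trivIset setT F ->
  (radial_integral A (\bigcup_n F n) theta = \sum_(0 <= n <oo) radial_integral A (F n) theta)%E.
Proof.
move=> sA mF tF; rewrite radial_integralE.
under [RHS]eq_eseriesr do rewrite radial_integralE.
rewrite -integral_nneseries//; last first.
  by move=> n; exact: (measurableT_comp (measurable_density sA (mF n)) (pair1_measurable theta)).
apply: eq_integral => r _; rewrite /density/=.
rewrite mulrCA EFinM indic_bigcup_series// muleC -nneseriesZl//.
by apply: eq_eseriesr => n _; rewrite -EFinM; congr EFin; ring.
Qed.

Lemma integral_inv_sqr c : 0 < c ->
  (\int[lebesgue_measure]_(r in `[c, +oo[) ((r ^+ 2)^-1)%:E = (c^-1)%:E)%E.
Proof.
move=> c0; have cr r : c <= r -> r != 0 by move=> cr; rewrite gt_eqF// (lt_le_trans c0).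
have dV r : c <= r -> is_derive r 1 (fun r : R => - r^-1) (r ^+ 2)^-1.
  move=> /cr r0; have := is_deriveN (is_deriveV r0 (is_derive_id r 1)).
  by rewrite /GRing.scale/= mulr1 opprK.
rewrite (@ge0_continuous_FTC2y R _ (fun r => - r^-1) c 0).
- by rewrite -EFinB sub0r opprK.
- by move=> r _; rewrite invr_ge0 sqr_ge0.
- apply: continuous_in_subspaceT => r; rewrite inE/= in_itv/= andbT => rc.
  apply: (@cvgV _ _ _ _ (fun r : R => r ^+ 2)); first by rewrite expf_neq0// cr.
  exact: exprn_continuous.
- rewrite -oppr0; apply: cvgN; apply/gtr0_cvgV0; last exact: cvg_id.
  by exists 0; split => // r.
- by move=> r /ltW /dV[].
- apply: cvg_at_right_filter; apply: cvgN; apply: (@cvgV _ _ _ _ id); first by rewrite cr.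
  exact: cvg_id.
- by move=> r; rewrite in_itv/= andbT => /ltW /dV[_ <-]; rewrite derive1E.
Qed.

(** A set reached along the orbit of theta only after the time c has radial mass at
    most the integral of 1 / r^2 over [c, +oo[. *)
Lemma radial_integral_tail A B theta c : 0 < c ->
  (forall r, 0 < r -> B (mxpow r A *m theta) -> c <= r) ->
  (radial_integral A B theta <= (c^-1)%:E)%E.
Proof.
move=> c0 Bc; rewrite -integral_inv_sqr// /radial_integral integral_mkcond [leRHS]integral_mkcond.
apply: ge0_le_lower_integral => r _.
  by rewrite patchE; case: ifPn => // _; rewrite lee_fin divr_ge0// sqr_ge0.
rewrite !patchE; case: ifPn => [|_]; last first.
  by case: ifPn => // _; rewrite lee_fin invr_ge0 sqr_ge0.
rewrite inE/= in_itv/= andbT => r0; rewrite indicE; have [/set_mem/(Bc r r0) cr|_] := boolP (_ \in B).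
  by rewrite mem_set ?mul1r//= in_itv/= cr.
by rewrite mul0r; case: ifPn => // _; rewrite lee_fin invr_ge0 sqr_ge0.
Qed.

Lemma measurable_usphere : measurable (@usphere R d).
Proof.
rewrite -[X in measurable X]setCK; apply: measurableC; apply: measurable_open.
rewrite (_ : ~` _ = (@enorm R d) @^-1` [set x | x != 1]); last first.
  by apply/seteqP; split=> v /eqP.
by apply: open_comp; [move=> v _; exact: continuous_enorm|exact: open_neq].
Qed.

Variables (E : 'cV[R]_d -> 'M[R]_d) (sigma : {finite_measure set 'cV[R]_d -> \bar R}).
Hypothesis symE : forall x, (E x)^T = E x.

(** Countable additivity comes from monotone convergence in both integrals; it needs the
    radial integral to be measurable in theta, which is Tonelli's theorem. *)
Lemma osl_levy_measure x :
  exists mu : {measure set 'cV[R]_d -> \bar R}, mu = osl_levy E sigma x :> (set 'cV[R]_d -> \bar R).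
Proof.
have m0 : osl_levy E sigma x set0 = 0%E.
  rewrite /osl_levy integral0_eq// => theta _; apply: integral0_eq => r _.
  by rewrite indic0 mul0r.
have mge0 B : (0 <= osl_levy E sigma x B)%E.
  by apply: integral_ge0 => theta _; exact: radial_integral_ge0.
have madd : semi_sigma_additive (osl_levy E sigma x).
  move=> F mF tF _; rewrite (_ : osl_levy E sigma x (\bigcup_n F n) =
      \sum_(0 <= n <oo) osl_levy E sigma x (F n))%E.
    by apply: is_cvg_nneseries => n _ _; exact: mge0.
  rewrite /osl_levy -integral_nneseries.
  - by apply: eq_integral => theta _; exact: radial_integral_bigcup.
  - exact: measurable_usphere.
  - move=> n; apply: measurable_funTS.
    exact: (measurable_radial_integral (symE x) (mF n)).
  - by move=> n theta _; exact: radial_integral_ge0.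
pose m := isMeasure.Build _ _ _ (osl_levy E sigma x) m0 mge0 madd.
pose mu : {measure set 'cV[R]_d -> \bar R} := HB.pack (osl_levy E sigma x) m.
by exists mu.
Qed.

Lemma osl_levy_tail x B c : measurable B -> 0 < c ->
  (forall r theta, 0 < r -> enorm theta = 1 -> B (mxpow r (E x) *m theta) -> c <= r) ->
  (osl_levy E sigma x B <= (fine (sigma setT) * c^-1)%:E)%E.
Proof.
move=> mB c0 Bc; have c1 : 0 <= c^-1 by rewrite invr_ge0 ltW.
apply: (@le_trans _ _ (\int[sigma]_(theta in usphere) (c^-1)%:E)%E).
  apply: ge0_le_lower_integral => theta s1; first exact: radial_integral_ge0.
  by apply: radial_integral_tail => // r r0; exact: Bc.
rewrite integral_cst/=; last exact: measurable_usphere.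
rewrite mulrC EFinM fineK ?fin_num_measure//; apply: lee_wpmul2l; first by rewrite lee_fin.
by apply: le_measure; rewrite ?inE//; exact: measurable_usphere.
Qed.

Hypothesis hsigma : spherical_symmetric sigma.

Lemma preimage_oppE (B : set 'cV[R]_d) : -%R @` B = -%R @^-1` B.
Proof.
apply/seteqP; split=> [v [u Bu <-]|v Bv] /=; first by rewrite opprK.
by exists (- v) => //; rewrite opprK.
Qed.

Lemma measurable_opp : measurable_fun setT (-%R : 'cV[R]_d -> 'cV[R]_d).
Proof.
apply: measurable_vectorP => i; under eq_fun do rewrite mxE.
apply: measurableT_comp => //.
by apply: continuous_measurable_vector; exact: continuous_coord.
Qed.

(** Change of variables by the reflection, which leaves the measure invariant. *)
Lemma integral_symmetric (mu : {measure set 'cV[R]_d -> \bar R})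
    (D : set 'cV[R]_d) (f : 'cV[R]_d -> \bar R) :
  measurable D -> -%R @^-1` D = D -> (forall B : set 'cV[R]_d, measurable B -> mu (-%R @^-1` B) = mu B) ->
  measurable_fun setT f -> (forall y, 0 <= f y)%E ->
  (\int[mu]_(y in D) f (- y)%R = \int[mu]_(y in D) f y)%E.
Proof.
move=> mD oD sym mf f0.
have mfD : measurable_fun D f by exact: measurable_funTS.
have := ge0_integral_pushforward measurable_opp mu mD mfD (fun y _ => f0 y).
rewrite oD => <-; apply: (eq_measure_integral mu); first exact: measurable_opp.
by move=> mo B mB _; exact: sym.
Qed.

(** Since r^E(x) is linear, reflecting the set amounts to reflecting theta, and sigma is
    symmetric. *)
Lemma osl_levy_opp x B : measurable B -> osl_levy E sigma x (-%R @^-1` B) = osl_levy E sigma x B.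
Proof.
move=> mB; rewrite /osl_levy.
transitivity (\int[sigma]_(theta in usphere) radial_integral (E x) B (- theta))%E.
  apply: eq_integral => theta _; apply: eq_integral => r _.
  by rewrite mulmxN !indicE.
apply: integral_symmetric.
- exact: measurable_usphere.
- by apply/seteqP; split=> v; rewrite /usphere/= enormN.
- by move=> D mD; rewrite [RHS](spherical_sym hsigma mD) preimage_oppE.
- exact: measurable_radial_integral.
- by move=> theta; exact: radial_integral_ge0.
Qed.

End levy_measure.

(** * Exit events and exit times *)

Section exit_bounds.
Context {R : realType} {disp : measure_display} {T : measurableType disp} {d : nat}.
Variables (X : R -> T -> 'cV[R]_d) (P : 'cV[R]_d -> probability T R).

Lemma sup_dist_exit_event x r t :
  [set w | (r%:E < sup_dist X x t w)%E] = exit_event X x r t.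
Proof.
apply/seteqP; split=> w /=.
  move=> /ereal_sup_gt[_ [s /= hs <-]]; rewrite lte_fin => h.
  by exists s; move: hs; rewrite in_itv/= => /andP[s0 st].
move=> [s [s0 st h]]; apply: (@lt_le_trans _ _ (enorm (X s w - x))%:E); first by rewrite lte_fin.
by apply: ereal_sup_ubound; exists s => //=; rewrite in_itv/= s0.
Qed.

Hypothesis hX : universal_markov X P.

(** The infimum need not be attained, hence the intersection over 1 / (n + 1). A path
    that is outside the ball at time 0 stays outside for a while, so that excluding
    the time 0 from the exit time makes no difference. *)
Lemma exit_time_exit_event x r t : 0 < t ->
  [set w | (exit_time X x r w <= t%:E)%E] = \bigcap_n exit_event X x r (t + n.+1%:R^-1).
Proof.
move=> t0; apply/seteqP; split=> w /=.
  move=> h n _; have : (exit_time X x r w < (t + n.+1%:R^-1)%:E)%E.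
    by apply: (le_lt_trans h); rewrite lte_fin ltrDl invr_gt0.
  move=> /ereal_inf_lt[_ [s [s0 rs] <-]]; rewrite lte_fin => st.
  by exists s; split; rewrite // ltW.
move=> h; apply/lee_addgt0Pr => e e0.
have [n ne] : exists n : nat, n.+1%:R^-1 < e.
  have [N HN] := natr_above e^-1; exists N; rewrite invf_plt ?posrE//.
  by apply: (le_lt_trans (HN N (leqnn N))); rewrite ltr_nat.
have n0 : 0 < n.+1%:R^-1 :> R by rewrite invr_gt0.
have [s [s0 st rs]] := h n I.
apply: (@le_trans _ _ (t + n.+1%:R^-1)%:E); last by rewrite -EFinD lee_fin lerD2l ltW.
have [s1|] := ltP 0 s.
  by apply: (@le_trans _ _ s%:E); [apply: ereal_inf_lbound; exists s|rewrite lee_fin].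
move=> s1; have es : s = 0 by apply/eqP; rewrite eq_le s1.
have [dl dl0 H] := exit_persists (um_cadlag hX) s0 rs.
pose u := Num.min t (dl / 2).
have u0 : 0 < u by rewrite /u lt_min t0 divr_gt0.
have ut : u <= t by rewrite /u ge_min lexx.
have ud : u < dl by apply: (@le_lt_trans _ _ (dl / 2)); [rewrite /u ge_min lexx orbT|lra].
apply: (@le_trans _ _ u%:E); last by rewrite lee_fin (le_trans ut)// lerDl ltW.
by apply: ereal_inf_lbound; exists u => //; split => //; apply: H; rewrite es ?add0r// ltW.
Qed.

(** The exit time is at most t only if the ball is left before t + 1 / (n + 1), and
    this time is less than 2 t for large n. *)
Lemma exit_bounds x r c : 0 <= c ->
  (forall t, 0 <= t -> measurable (exit_event X x r t) /\
    (P x (exit_event X x r t) <= (c * t)%:E)%E) ->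
  forall t, 0 < t ->
    (P x [set w | (r%:E < sup_dist X x t w)%E] <= (2 * c * t)%:E)%E /\
    (P x [set w | (exit_time X x r w <= t%:E)%E] <= (2 * c * t)%:E)%E.
Proof.
move=> c0 h t t0; split.
  rewrite sup_dist_exit_event; apply: (le_trans (h t (ltW t0)).2); rewrite lee_fin.
  by rewrite ler_wpM2r ?(ltW t0)//; lra.
have [n nt] : exists n : nat, n.+1%:R^-1 < t.
  have [N HN] := natr_above t^-1; exists N; rewrite invf_plt ?posrE//.
  by apply: (le_lt_trans (HN N (leqnn N))); rewrite ltr_nat.
have t2 m : 0 <= t + m.+1%:R^-1 by rewrite addr_ge0 ?(ltW t0)// invr_ge0.
rewrite exit_time_exit_event//.
apply: (@le_trans _ _ (P x (exit_event X x r (t + n.+1%:R^-1)))).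
  apply: le_measure; rewrite ?inE; last by move=> w; apply.
    by apply: bigcap_measurable => // m _; exact: (h _ (t2 m)).1.
  exact: (h _ (t2 n)).1.
apply: (le_trans (h _ (t2 n)).2); rewrite lee_fin.
have -> : 2 * c * t = c * (t + t) by ring.
by rewrite ler_wpM2l// lerD2l ltW.
Qed.

End exit_bounds.

(** * Tails of the Levy measures *)

Section osl_tails.
Context {R : realType} {d : nat}.
Variables (E : 'cV[R]_d -> 'M[R]_d) (a : R).
Variable sigma : {finite_measure set 'cV[R]_d -> \bar R}.
Hypothesis hE : admissible_exponent E a.
Hypothesis d_gt0 : (0 < d)%N.

Let mass : R := fine (sigma setT).

Lemma exponent_gt0 : 0 < a.
Proof. by apply: lt_trans (admissible_gt hE); rewrite invr_gt0. Qed.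

Lemma spec_val_ge x k : a <= spec_val (E x) k.
Proof.
apply: (le_trans (admissible_lambda hE x)); apply: lambda_min_le.
by apply: spec_val_eigen; exact: admissible_sym hE x.
Qed.

Lemma spec_val_le b x k : lambda_max (E x) <= b -> spec_val (E x) k <= b.
Proof.
move=> h; apply: le_trans h; apply: lambda_max_ge.
by apply: spec_val_eigen; exact: admissible_sym hE x.
Qed.

Lemma exponent_le b x : lambda_max (E x) <= b -> a <= b.
Proof.
by move=> h; exact: le_trans (spec_val_ge x (Ordinal d_gt0)) (spec_val_le (Ordinal d_gt0) h).
Qed.

(** With g the exponent to be proved, the assumption says that |r^E(x) theta| <= rho
    whenever r < rho^(1/g). *)
Lemma osl_tail x rho g : 0 < rho -> 0 < g ->
  (forall r k, 0 < r -> ln r < ln rho / g -> ln r * spec_val (E x) k <= ln rho) ->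
  (osl_levy E sigma x [set y | (rho < enorm y)%R] <= (mass * expR (- (ln rho / g)))%:E)%E.
Proof.
move=> rho0 g0 h; rewrite expRN; apply: osl_levy_tail.
- exact: measurable_enorm_gt.
- exact: expR_gt0.
- move=> r theta r0 th1 /= hr; rewrite leNgt; apply/negP => rl.
  have lr : ln r < ln rho / g.
    by rewrite -[ltRHS]expRK ltr_ln ?posrE ?expR_gt0.
  have := mxexp_norm_le (admissible_sym hE x) theta (fun k => h r k r0 lr).
  by rewrite th1 mulr1 lnK ?posrE// leNgt hr.
Qed.

(** For rho <= 1 only times r < 1 matter, where the smallest eigenvalue dominates. *)
Lemma osl_tail_small x rho : 0 < rho -> rho <= 1 ->
  (osl_levy E sigma x [set y | (rho < enorm y)%R] <= (mass * expR (- (ln rho / a)))%:E)%E.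
Proof.
move=> rho0 rho1; have a0 := exponent_gt0; apply: osl_tail => // r k r0.
have l0 : ln rho <= 0 by exact: ln_le0.
rewrite ltr_pdivlMr// => h.
have lr0 : ln r < 0 by have : ln r * a < 0 by [exact: lt_le_trans h l0]; rewrite pmulr_llt0.
apply: ltW; apply: le_lt_trans h; rewrite ler_nM2l//; exact: spec_val_ge.
Qed.

(** For rho >= 1 the vector r^E(x) theta has norm at most 1 as long as r <= 1, and for
    r >= 1 the largest eigenvalue dominates. *)
Lemma osl_tail_large b x rho : lambda_max (E x) <= b -> 1 <= rho ->
  (osl_levy E sigma x [set y | (rho < enorm y)%R] <= (mass * expR (- (ln rho / b)))%:E)%E.
Proof.
move=> hb rho1; have a0 := exponent_gt0; have b0 := lt_le_trans a0 (exponent_le hb).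
have rho0 : 0 < rho by exact: lt_le_trans rho1.
apply: osl_tail => // r k r0; rewrite ltr_pdivlMr// => h.
have sa := spec_val_ge x k; have sb := spec_val_le k hb.
have [lr|lr] := leP (ln r) 0.
  apply: (@le_trans _ _ 0); last exact: ln_ge0.
  by rewrite mulr_le0_ge0// (le_trans (ltW a0)).
by apply: le_trans (ltW h); rewrite ler_pM2l.
Qed.

(** The factor 2^(1/a) by which the tails grow at most when the radius is halved. *)
Definition tail_ratio : R := expR (ln 2 / a).

Lemma tail_ratio_ge0 : 0 <= tail_ratio. Proof. exact: expR_ge0. Qed.

(** This is where a > 1/2 enters: the second moments of the small jumps are finite. *)
Lemma tail_ratio_lt4 : tail_ratio < 4.
Proof.
have a0 := exponent_gt0; have l2 : 0 < ln (2 : R) by rewrite ln_gt0// ltr1n.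
have -> : (4 : R) = expR (2%:R * ln 2) by rewrite expRM_natl lnK ?posrE// expr2; ring.
rewrite ltr_expR ltr_pdivrMr//; have := admissible_gt hE.
by rewrite -(ltr_pM2l l2) mulrC; lra.
Qed.

Lemma ln_dyadic (r : R) k : 0 < r -> ln (r * 2^-1 ^+ k) = ln r - k%:R * ln 2.
Proof.
move=> r0; rewrite lnM ?posrE ?exprn_gt0// exprVn lnV ?posrE ?exprn_gt0//.
by rewrite lnXn// mulr_natl.
Qed.

Lemma tail_ratioX k : tail_ratio ^+ k = expR (k%:R * (ln 2 / a)).
Proof. by rewrite expRM_natl. Qed.

Variable phi : 'cV[R]_d -> {measure set 'cV[R]_d -> \bar R}.
Hypothesis hphi : forall x, phi x = osl_levy E sigma x :> (set 'cV[R]_d -> \bar R).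

Lemma dyadic_le (r : R) k : 0 < r -> r * 2^-1 ^+ k <= r.
Proof. by move=> r0; rewrite ger_pMr// exprn_ile1// invf_le1// ler1n. Qed.

Lemma osl_tail_bound_small r : 0 < r -> r <= 1 ->
  tail_bound phi r (mass * expR (- (ln r / a))) tail_ratio.
Proof.
move=> r0 r1 x k; rewrite hphi.
have rho0 : 0 < r * 2^-1 ^+ k by rewrite mulr_gt0// exprn_gt0.
have rho1 : r * 2^-1 ^+ k <= 1 by exact: le_trans (dyadic_le k r0) r1.
apply: (le_trans (osl_tail_small x rho0 rho1)); rewrite lee_fin -mulrA.
rewrite tail_ratioX -expRD ln_dyadic// mulrBl opprB addrC mulrA.
by rewrite lexx.
Qed.

(** Halving a radius above 1 costs only 2^(1/b), and 2^(1/b) <= 2^(1/a); below 1 the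
    rate is that of the small radii. A dyadic radius may fall on either side of 1. *)
Lemma osl_tail_bound_large b r : (forall x, lambda_max (E x) <= b) -> 1 <= r ->
  tail_bound phi r (mass * expR (- (ln r / b))) tail_ratio.
Proof.
move=> hb r1 x k; rewrite hphi; have r0 : 0 < r by exact: lt_le_trans r1.
have a0 := exponent_gt0; have ab := exponent_le (hb x); have b0 := lt_le_trans a0 ab.
have vab : b^-1 <= a^-1 by rewrite lef_pV2 ?posrE.
have l2 : 0 <= ln (2 : R) by rewrite ln_ge0// ler1n.
have lr : 0 <= ln r by rewrite ln_ge0.
have mass0 : 0 <= mass by rewrite fine_ge0.
have rho0 : 0 < r * 2^-1 ^+ k by rewrite mulr_gt0// exprn_gt0.
have goalE (m : R) : m <= - (ln r / b) + k%:R * (ln 2 / a) ->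
    ((mass * expR m)%:E <= (mass * expR (- (ln r / b)) * tail_ratio ^+ k)%:E)%E.
  by move=> hm; rewrite lee_fin -mulrA ler_wpM2l// tail_ratioX -expRD ler_expR.
have [rho1|rho1] := leP (r * 2^-1 ^+ k) 1.
  apply: (le_trans (osl_tail_small x rho0 rho1)); apply: goalE.
  rewrite ln_dyadic// mulrBl opprB addrC mulrA lerD2r lerN2; exact: ler_wpM2l.
apply: (le_trans (osl_tail_large (hb x) (ltW rho1))); apply: goalE.
rewrite ln_dyadic// mulrBl opprB addrC lerD2l -mulrA ler_wpM2l//.
exact: ler_wpM2l.
Qed.

End osl_tails.

(** * The bounds for operator-stable-like processes *)

(** The coordinates of the characteristics of the process are brought into the form
    required by [exit_probability]; the filtration is the augmented natural one. *)
Lemma osl_exit_probability {R : realType} {d : nat} (E : 'cV[R]_d -> 'M[R]_d)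
    (sigma : {finite_measure set 'cV[R]_d -> \bar R})
    (phi : 'cV[R]_d -> {measure set 'cV[R]_d -> \bar R})
    {disp : measure_display} {T : measurableType disp}
    (X : R -> T -> 'cV[R]_d) (P : 'cV[R]_d -> probability T R) (r c q : R) :
  (0 < d)%N -> (forall x, (E x)^T = E x) -> spherical_symmetric sigma ->
  (forall x, phi x = osl_levy E sigma x :> (set 'cV[R]_d -> \bar R)) ->
  osl_process E sigma X P -> 0 < r -> 0 <= c -> 0 <= q -> q < 4 -> tail_bound phi r c q ->
  forall x t, 0 <= t -> measurable (exit_event X x r t) /\
    (P x (exit_event X x r t) <= (exit_constant (d := d) q * c * t)%:E)%E.
Proof.
move=> d0 symE hsigma hphi [hM hchar] r0 c0 q0 q4 tb x t t0.
have uF := augmentation_usual (P x) (um_measurable hM).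
have cX := um_cadlag hM.
have aX : forall s B, 0 <= s -> measurable B ->
    augmentation (P x) (natural_filtration X) s (X s @^-1` B).
  by move=> s B s0 mB; exact: (augmentation_adapted (P x) (um_measurable hM)).
have [_ [hB [[Xc [hXc hC]] hK]]] := hchar x.
have hK' : jump_compensator (P x) (augmentation (P x) (natural_filtration X)) X
    (fun s w => phi (X s w)).
  move: hK; congr jump_compensator; apply/funext => s; apply/funext => w.
  by rewrite hphi.
have phi_sym y (f : 'cV[R]_d -> \bar R) : measurable_fun setT f -> (forall z, 0 <= f z)%E ->
    (\int[phi y]_(z in [set z | z != 0%R]) f (- z)%R = \int[phi y]_(z in [set z | z != 0%R]) f z)%E.
  move=> mf f0; apply: integral_symmetric => //; first exact: measurable_neq0.
    by apply/seteqP; split=> z /=; rewrite oppr_eq0.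
  by move=> B mB; rewrite hphi osl_levy_opp.
split; first exact: (measurable_exit_event uF cX aX x r t0).
have Z0 i : (0 : 'cV[R]_d) i 0 = 0 by rewrite mxE.
have Z1 i : (0 : 'M[R]_d) i i = 0 by rewrite mxE.
rewrite -mulrA; apply: (exit_probability uF cX hK' phi_sym aX _ d0 r0 c0 q0 q4 tb (Xc := Xc) _ _ _ t0).
- by move=> e e0; exact: tail_levy_cutoff tb e0.
- move=> i; have [_ _ _ [aM _ _]] := hB i; move: aM; congr adapted.
  by apply/funext => s; apply/funext => w; rewrite Z0 subr0.
- move=> i; have [cXc Xc0 pd] := hXc i; have [_ _ _ sq] := hC i i; split => //.
    move: pd; congr purely_discontinuous.
    by apply/funext => s; apply/funext => w; rewrite Z0 subr0.
  move: sq; congr local_martingale.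
  by apply/funext => s; apply/funext => w; rewrite Z1 subr0.
- exact: um_start hM x.
Qed.

Theorem corollary3p3 (R : realType) (d : nat) (d_gt0 : (0 < d)%N)
    (E : 'cV[R]_d -> 'M[R]_d) (a : R) (hE : admissible_exponent E a)
    (sigma : {finite_measure set 'cV[R]_d -> \bar R})
    (hsigma : spherical_symmetric sigma)
    (disp : measure_display) (T : measurableType disp)
    (X : R -> T -> 'cV[R]_d) (P : 'cV[R]_d -> probability T R)
    (hX : osl_process E sigma X P) :
  (exists2 C : R, 0 < C &
    forall (x : 'cV[R]_d) (t r : R), 0 < t -> 0 < r -> r <= 1 ->
      (P x [set w | r%:E < sup_dist X x t w] <= (C * t * r `^ (- a^-1))%:E)%E /\
      (P x [set w | exit_time X x r w <= t%:E] <= (C * t * r `^ (- a^-1))%:E)%E)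
  /\
  (forall b : R, (forall x, lambda_max (E x) <= b) ->
    exists2 C : R, 0 < C &
    forall (x : 'cV[R]_d) (t r : R), 0 < t -> 1 <= r ->
      (P x [set w | r%:E < sup_dist X x t w] <= (C * t * r `^ (- b^-1))%:E)%E /\
      (P x [set w | exit_time X x r w <= t%:E] <= (C * t * r `^ (- b^-1))%:E)%E).
Proof.
have symE := admissible_sym hE.
have [phi hphi] := choice (osl_levy_measure sigma symE).
have a0 := exponent_gt0 hE.
pose K : R := exit_constant (d := d) (tail_ratio a) * fine (sigma setT).
have q0 := tail_ratio_ge0 a; have q4 := tail_ratio_lt4 hE.
have m0 : 0 <= fine (sigma setT) by rewrite fine_ge0.
have ec0 : 0 <= exit_constant (d := d) (tail_ratio a).
  by rewrite addr_ge0 ?sqr_ge0// mulr_ge0 ?exprn_ge0// divr_ge0 ?mulr_ge0// subr_ge0 ltW.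
have K0 : 0 <= K by rewrite mulr_ge0.
have C0 : 0 < 2 * K + 1 by rewrite ltr_wpDl// mulr_ge0.
have powE (r g : R) : 0 < r -> r `^ (- g^-1) = expR (- (ln r / g)).
  by move=> r0; rewrite /powR gt_eqF// mulNr mulrC.
have main r g x t : 0 < r -> 0 < t ->
    tail_bound phi r (fine (sigma setT) * expR (- (ln r / g))) (tail_ratio a) ->
    (P x [set w | r%:E < sup_dist X x t w] <= ((2 * K + 1) * t * r `^ (- g^-1))%:E)%E /\
    (P x [set w | exit_time X x r w <= t%:E] <= ((2 * K + 1) * t * r `^ (- g^-1))%:E)%E.
  move=> r0 t0 tb; have c0 : 0 <= fine (sigma setT) * expR (- (ln r / g)).
    by rewrite mulr_ge0// expR_ge0.
  have h := osl_exit_probability d_gt0 symE hsigma hphi hX r0 c0 q0 q4 tb x.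
  have [h1 h2] := exit_bounds hX.1 (mulr_ge0 ec0 c0) h t0.
  have le : 2 * (exit_constant (d := d) (tail_ratio a) * (fine (sigma setT) * expR (- (ln r / g)))) * t
      <= (2 * K + 1) * t * r `^ (- g^-1).
    rewrite powE//.
    have -> : (2 * K + 1) * t * expR (- (ln r / g)) =
        2 * K * t * expR (- (ln r / g)) + t * expR (- (ln r / g)) by ring.
    have -> : 2 * (exit_constant (d := d) (tail_ratio a) * (fine (sigma setT) * expR (- (ln r / g)))) * t =
        2 * K * t * expR (- (ln r / g)) by rewrite /K; ring.
    by rewrite lerDl mulr_ge0 ?expR_ge0// ltW.
  by split; [apply: (le_trans h1)|apply: (le_trans h2)]; rewrite lee_fin.
split.
  exists (2 * K + 1) => // x t r t0 r0 r1; apply: main => //.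
  exact: (osl_tail_bound_small hE hphi r0 r1).
move=> b hb; exists (2 * K + 1) => // x t r t0 r1.
have r0 : 0 < r by exact: lt_le_trans r1.
by apply: main => //; exact: (osl_tail_bound_large hE d_gt0 hphi hb r1).
Qed.
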